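(* Let $N\ge2$ be an integer, $\lambda>0$ real, and $\mathbf n\in\mathbb Z^N$ with $n_1\ge n_2\ge\dots\ge n_N\ge0$. Consider the Sutherland Hamiltonian $$H=-\sum_{j=1}^N\frac{\partial^2}{\partial x_j^2}+2\lambda(\lambda-1)\sum_{1\le j<k\le N}\frac{1}{4\sin^2((x_j-x_k)/2)},\qquad -\pi\le x_j\le\pi,$$ and its eigenvalues $$E_{\mathbf n}=\sum_{j=1}^N\Bigl(n_j+\lambda\bigl[\tfrac12(N+1)-j\bigr]\Bigr)^2.$$ For non-degenerate eigenvalues $E_{\mathbf n}$, the eigenfunctions $f_{\mathbf n}=\Phi_{\mathbf n}\Psi_0$ of $H$ obtained with Sutherland's algorithm and with the novel algorithm (both described in the context) are equal up to normalization, and the functions $\Phi_{\mathbf n}$, which are symmetric polynomials in the variables $z_j=e^{i x_j}$, are proportional to the so-called Jack polynomials. Here $\Psi_0(\mathbf x)=\prod_{1\le j<k\le N}\sin((x_k-x_j)/2)^\lambda$.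
   Context: Conventions: the phase of $\sin(r/2)^\lambda$ can be fixed by reading it as $\lim_{\varepsilon\downarrow0}\sin(r/2+i\varepsilon)^\lambda$; phase ambiguities are irrelevant here. $E_{\mathbf m}$ is defined by the displayed formula for every $\mathbf m\in\mathbb Z^N$. Indices: $(\mathbf E_{jk})_\ell=\delta_{j\ell}-\delta_{k\ell}$. $\underline\mu$ denotes a tuple $(\mu_{jk})_{1\le j<k\le N}$ of non-negative integers, which in expressions like $\mathbf n\pm\underline\mu$ stands for the vector $\sum_{j<k}\mu_{jk}\mathbf E_{jk}\in\mathbb Z^N$. As an index of a coefficient, $\underline\mu-\nu\mathbf E_{jk}$ is the tuple obtained from $\underline\mu$ by replacing $\mu_{jk}$ with $\mu_{jk}-\nu$; coefficients whose index has a negative entry are absent, i.e. zero. Sutherland's algorithm: let $S_{\mathbf m}(\mathbf x)=\sum_P\prod_{j=1}^Ne^{i m_jx_{Pj}}$ (sum over all permutations $P$ of $\{1,\dots,N\}$) and $E'_{\mathbf m}=\sum_{j=1}^N\bigl(m_j^2+\lambda[N+1-2j]m_j\bigr)$. Set $f_{\mathbf n}=\Phi_{\mathbf n}\Psi_0$ with $$\Phi_{\mathbf n}=\sum_{\underline\mu\ge\underline0}c_{\underline\mu}S_{\mathbf n-\underline\mu},$$ where $c_{\underline\mu}=0$ if $(\mathbf n-\underline\mu)_j<(\mathbf n-\underline\mu)_k$ for at least one $j<k$, $c_{\underline0}=1$, and the other $c_{\underline\mu}$ are determined recursively by $$\bigl[E'_{\mathbf n}-E'_{\mathbf n-\underline\mu}\bigr]c_{\underline\mu}=\lambda\sum_{1\le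 j<k\le N}\ \sum_{\nu=1}^{n_j-n_k}\bigl[(\mathbf n-\underline\mu)_j-(\mathbf n-\underline\mu)_k+2\nu\bigr]\,c_{\underline\mu-\nu\mathbf E_{jk}} .$$ Novel algorithm: for $\mathbf m\in\mathbb Z^N$ let $$\mathcal P_{\mathbf m}(\mathbf x)=\lim_{\varepsilon\downarrow0}\int_{-\pi}^{\pi}\frac{dy_1}{2\pi}e^{i m_1y_1}\cdots\int_{-\pi}^{\pi}\frac{dy_N}{2\pi}e^{i m_Ny_N}\;\frac{\prod_{1\le j<k\le N}\bigl(1-e^{i(y_j-y_k)-(k-j)\varepsilon}\bigr)^\lambda}{\prod_{j,k=1}^N\bigl(1-e^{i(x_k-y_j)-j\varepsilon}\bigr)^\lambda}$$ (powers $(1-w)^{\pm\lambda}$, $|w|<1$, given by the binomial series). Set $f_{\mathbf n}=\Phi_{\mathbf n}\Psi_0$ with $\Phi_{\mathbf n}=\sum_{\underline\mu\ge\underline0}a_{\underline\mu}\mathcal P_{\mathbf n+\underline\mu}$ (only finitely many terms are non-zero), where $a_{\underline0}=1$ and the other $a_{\underline\mu}$ are determined recursively by $$\bigl[E_{\mathbf n+\underline\mu}-E_{\mathbf n}\bigr]a_{\underline\mu}=2\lambda(\lambda-1)\sum_{1\le j<k\le N}\ \sum_{\nu=1}^{\mu_{jk}}\nu\,a_{\underline\mu-\nu\mathbf E_{jk}} .$$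
   Formalization: That Sutherland's f_n is an eigenfunction of H with eigenvalue E_n is assumed in the claims on equality up to normalization and on Sutherland's Φ_n being Jack: the displayed recursion fails, e.g. N=2, n=(3,0), λ irrational (c=3λ/(4+2λ), but 6λ/(4+2λ) is needed). *)

(* Defs.v *)
From HB Require Import structures.
From mathcomp Require Import all_boot all_order all_algebra all_fingroup.
From mathcomp Require Import all_classical all_reals all_analysis.
From mathcomp Require Import complex.
From mathcomp Require mpoly.

Set Implicit Arguments.
Unset Strict Implicit.
Unset Printing Implicit Defensive.

Import Order.TTheory GRing.Theory Num.Theory.
Import numFieldNormedType.Exports.

Local Open Scope classical_set_scope.
Local Open Scope ring_scope.
Local Open Scope complex_scope.

(** Indices j = 1..N are represented by j : 'I_N, so "j" in a formula is
    [j.+1] here.  Functions of x in R^N are complex valued, and limits,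
    derivatives and integrals of complex-valued functions of a real variable
    are taken on the real and imaginary parts. *)

Section ComplexCalculus.
Variable R : realType.
Implicit Types (g : R -> R[i]) (t : R).

Definition expi t : R[i] := cos t +i* sin t.

Definition cderivable g t : Prop :=
  derivable (fun s => complex.Re (g s)) t 1 /\
  derivable (fun s => complex.Im (g s)) t 1.

Definition cderive1 g t : R[i] :=
  derive1 (fun s => complex.Re (g s)) t +i*
  derive1 (fun s => complex.Im (g s)) t.

Definition cintegral (a b : R) g : R[i] :=
  (\int[lebesgue_measure]_(t in `[a, b]) complex.Re (g t))%R +i*
  (\int[lebesgue_measure]_(t in `[a, b]) complex.Im (g t))%R.

Definition clim_at_right0 g : R[i] :=
  lim ((fun e => complex.Re (g e)) e @[e --> 0^'+]) +i*
  lim ((fun e => complex.Im (g e)) e @[e --> 0^'+]).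

Definition clim_seq (u : nat -> R[i]) : R[i] :=
  lim ((fun k => complex.Re (u k)) @ \oo) +i*
  lim ((fun k => complex.Im (u k)) @ \oo).

Definition gbinom (s : R) (k : nat) : R :=
  (\prod_(i < k) (s - i%:R)) / (k`!)%:R.

(** (1 - w)^s for |w| < 1, by the binomial series. *)
Definition one_sub_pow (s : R) (w : R[i]) : R[i] :=
  clim_seq (fun m => \sum_(k < m) (gbinom s k)%:C * (- w) ^+ k).

End ComplexCalculus.

Section Sutherland.
Variables (R : realType) (N : nat) (lam : R).
Implicit Types (x y : 'I_N -> R) (n m : 'I_N -> int).

Definition idx_pair : finType := {p : 'I_N * 'I_N | (p.1 < p.2)%N}.
Definition pair_fst (p : idx_pair) : 'I_N := (val p).1.
Definition pair_snd (p : idx_pair) : 'I_N := (val p).2.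

(** f viewed as a function of its j-th variable at x. *)
Definition slice (f : ('I_N -> R) -> R[i]) x (j : 'I_N) : R -> R[i] :=
  fun t => f [eta x with j |-> t].

Definition partial (j : 'I_N) (f : ('I_N -> R) -> R[i]) : ('I_N -> R) -> R[i] :=
  fun x => cderive1 (slice f x j) (x j).

Definition hamiltonian (f : ('I_N -> R) -> R[i]) : ('I_N -> R) -> R[i] :=
  fun x =>
    - (\sum_(j < N) partial j (partial j f) x)
    + (2 * lam * (lam - 1) *
       \sum_(p : idx_pair)
          (4 * sin ((x (pair_fst p) - x (pair_snd p)) / 2) ^+ 2)^-1)%:C * f x.

(** The points of [-pi, pi]^N at which the potential is finite. *)
Definition config : set ('I_N -> R) :=
  [set x | (forall j, - pi <= x j <= pi) /\
           (forall p : idx_pair,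
              sin ((x (pair_fst p) - x (pair_snd p)) / 2) != 0)].

Definition twice_differentiable (f : ('I_N -> R) -> R[i]) x : Prop :=
  forall j : 'I_N,
    (\forall t \near x j, cderivable (slice f x j) t) /\
    cderivable (slice (partial j f) x j) (x j).

Definition is_eigenfunction (E : R) (f : ('I_N -> R) -> R[i]) : Prop :=
  (exists2 x, config x & f x != 0) /\
  (forall x, config x ->
     twice_differentiable f x /\ hamiltonian f x = E%:C * f x).

Definition energy m : R :=
  \sum_(j < N) ((m j)%:~R + lam * ((N%:R + 1) / 2 - (j.+1)%:R)) ^+ 2.

Definition nonincreasing m : Prop := forall j k : 'I_N, (j <= k)%N -> m k <= m j.

(** n ranges over n_1 >= ... >= n_N >= 0; E_n is non-degenerate when it is
    attained at no other such label. *)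
Definition admissible m : Prop := nonincreasing m /\ (forall j, 0 <= m j).

Definition nondegenerate_energy n : Prop :=
  forall m, admissible m -> energy m = energy n -> m =1 n.

(** For -2 pi < r < 2 pi this is [lim_(eps -> 0+) sin (r/2 + i eps)^lam], with
    the power continued from r > 0 through the upper half-plane (where the sine
    does not vanish): the phase is exp(i pi lam) when the sine is negative. *)
Definition sin_half_pow (r : R) : R[i] :=
  if 0 <= sin (r / 2) then (sin (r / 2) `^ lam)%:C
  else expi (pi * lam) * ((- sin (r / 2)) `^ lam)%:C.

Definition Psi0 x : R[i] :=
  \prod_(p : idx_pair) sin_half_pow (x (pair_snd p) - x (pair_fst p)).

(** Tuples (mu_jk)_(j < k) and the vector sum_(j < k) mu_jk E_jk. *)
Definition mtuple := {ffun idx_pair -> nat}.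

Definition mt0 : mtuple := [ffun=> 0%N].

Definition mt_vec (mu : mtuple) : 'I_N -> int := fun l =>
  \sum_(p : idx_pair)
     ((mu p)%:Z * ((pair_fst p == l)%:Z - (pair_snd p == l)%:Z)).

(** Only used below for nu <= mu_p, where the subtraction is exact. *)
Definition mt_lower (mu : mtuple) (p : idx_pair) (nu : nat) : mtuple :=
  [ffun q => (mu q - (q == p) * nu)%N].

Definition mt_size (mu : mtuple) : nat := (\sum_(p : idx_pair) mu p)%N.

Definition vsub n m : 'I_N -> int := fun j => n j - m j.
Definition vadd n m : 'I_N -> int := fun j => n j + m j.

(** *** Sutherland's algorithm *)

Definition S_fun m x : R[i] :=
  \sum_(s : 'S_N) \prod_(j < N) expi ((m j)%:~R * x (s j)).

Definition energy' m : R :=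
  \sum_(j < N) ((m j)%:~R ^+ 2
                + lam * (N%:R + 1 - 2 * (j.+1)%:R) * (m j)%:~R).

Definition orderedb m : bool :=
  [forall p : idx_pair, m (pair_snd p) <= m (pair_fst p)].

(** Each recursive call lowers the size of the index, so [mt_size mu] levels of
    recursion suffice (here and in [novel_rec]).  The energy differences divided
    by are positive: n is non-increasing and lam > 0.
    Pitfall: the terms S_m with m not non-increasing are discarded instead of
    being reordered, so that Phi_suth * Psi0 is not an eigenfunction for every n,
    for instance n = (3, 0) or n = (2, 0, 0) with generic lam. *)
Fixpoint suth_rec n (fuel : nat) (mu : mtuple) : R :=
  if mu == mt0 then 1 else
  if ~~ orderedb (vsub n (mt_vec mu)) then 0 else
  if fuel is fuel'.+1 then
    (lam * \sum_(p : idx_pair)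
       \sum_(1 <= nu < (absz (n (pair_fst p) - n (pair_snd p))).+1
              | (nu <= mu p)%N)
          ((vsub n (mt_vec mu) (pair_fst p) - vsub n (mt_vec mu) (pair_snd p))%:~R
           + 2 * nu%:R) * suth_rec n fuel' (mt_lower mu p nu))
    / (energy' n - energy' (vsub n (mt_vec mu)))
  else 0.

Definition suth_coeff n (mu : mtuple) : R := suth_rec n (mt_size mu) mu.

Definition Phi_suth n x : R[i] :=
  \sum_(mu \in [set: mtuple])
     (suth_coeff n mu)%:C * S_fun (vsub n (mt_vec mu)) x.

(** *** The novel algorithm *)

(** Integrand without the plane waves; for pairs k - j = [pair_snd - pair_fst]. *)
Definition P_kernel (eps : R) x y : R[i] :=
  (\prod_(p : idx_pair)
     one_sub_pow lam
       ((expR (- ((pair_snd p - pair_fst p)%N%:R * eps)))%:C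
        * expi (y (pair_fst p) - y (pair_snd p))))
  * \prod_(j < N) \prod_(k < N)
     one_sub_pow (- lam)
       ((expR (- ((j.+1)%:R * eps)))%:C * expi (x k - y j)).

(** Iterated integral over the variables in [js], the head being outermost. *)
Fixpoint iter_integral m (js : seq 'I_N) (G : ('I_N -> R) -> R[i]) y : R[i] :=
  if js is j :: js' then
    cintegral (- pi) pi (fun t =>
      ((2 * pi)^-1)%:C * expi ((m j)%:~R * t)
      * iter_integral m js' G [eta y with j |-> t])
  else G y.

Definition P_fun m x : R[i] :=
  clim_at_right0 (fun eps =>
    iter_integral m (enum 'I_N) (P_kernel eps x) (fun=> 0)).

Fixpoint novel_rec n (fuel : nat) (mu : mtuple) : R :=
  if mu == mt0 then 1 else
  if fuel is fuel'.+1 then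
    (2 * lam * (lam - 1) * \sum_(p : idx_pair) \sum_(1 <= nu < (mu p).+1)
       nu%:R * novel_rec n fuel' (mt_lower mu p nu))
    / (energy (vadd n (mt_vec mu)) - energy n)
  else 0.

Definition novel_coeff n (mu : mtuple) : R := novel_rec n (mt_size mu) mu.

Definition Phi_novel n x : R[i] :=
  \sum_(mu \in [set: mtuple])
     (novel_coeff n mu)%:C * P_fun (vadd n (mt_vec mu)) x.

Definition times_Psi0 (Phi : ('I_N -> R) -> R[i]) : ('I_N -> R) -> R[i] :=
  fun x => Phi x * Psi0 x.

Definition is_symmetric_poly (Phi : ('I_N -> R) -> R[i]) : Prop :=
  exists2 p : mpoly.mpoly N R[i], p \is @mpoly.symmetric N R[i] &
    forall x, Phi x = mpoly.meval (fun j => expi (x j)) p.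

Definition proportional (f g : ('I_N -> R) -> R[i]) : Prop :=
  exists2 c : R[i], c != 0 & forall x, f x = c * g x.

End Sutherland.

(** *** Jack polynomials

    Partitions of d are padded with zeros to length d.  An element of the degree
    d part of the ring of symmetric functions (in infinitely many variables) is
    given by its coefficients in the basis of power-sum products p_rho; identities
    between symmetric functions are identities in every number M of variables. *)
Section Jack.
Variable R : realType.

Definition is_intpart (d : nat) (kappa : {ffun 'I_d -> 'I_d.+1}) : bool :=
  [forall i : 'I_d, forall j : 'I_d, (i <= j)%N ==> (kappa j <= kappa i)%N]
  && ((\sum_(i < d) kappa i)%N == d).

Definition intpart (d : nat) : finType :=
  {kappa : {ffun 'I_d -> 'I_d.+1} | is_intpart kappa}.

Variable d : nat.
Implicit Types kappa rho : intpart d.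

Definition part_nth kappa (i : 'I_d) : nat := val kappa i.

(** Strict dominance order. *)
Definition dominated kappa rho : bool :=
  (kappa != rho) &&
  [forall r : 'I_d, (\sum_(i < d | (i <= r)%N) part_nth kappa i
                      <= \sum_(i < d | (i <= r)%N) part_nth rho i)%N].

Definition nz_parts (s : seq nat) : seq nat := [seq i <- s | i != 0%N].

Definition parts_of kappa : seq nat :=
  nz_parts [seq part_nth kappa i | i <- enum 'I_d].

(** The sum of all distinct monomials z^beta with beta a rearrangement of kappa. *)
Definition monomial_sym (M : nat) kappa (z : 'I_M -> R[i]) : R[i] :=
  \sum_(beta : {ffun 'I_M -> 'I_d.+1}
        | perm_eq (nz_parts [seq nat_of_ord (beta j) | j <- enum 'I_M])
                  (parts_of kappa))
     \prod_(j < M) z j ^+ beta j.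

Definition power_sum_prod (M : nat) rho (z : 'I_M -> R[i]) : R[i] :=
  \prod_(r <- parts_of rho) \sum_(j < M) z j ^+ r.

Definition symfun_eval (F : intpart d -> R) (M : nat) (z : 'I_M -> R[i]) : R[i] :=
  \sum_rho (F rho)%:C * power_sum_prod rho z.

Definition zee rho : nat :=
  (\prod_(1 <= r < d.+1)
     (r ^ count_mem r (parts_of rho) * (count_mem r (parts_of rho))`!))%N.

(** <p_rho, p_rho'> = delta z_rho alpha^(length rho). *)
Definition jack_scalar (alpha : R) (F G : intpart d -> R) : R :=
  \sum_rho F rho * G rho * (zee rho)%:R * alpha ^+ size (parts_of rho).

(** The Jack symmetric functions P_kappa^(alpha) of degree d in the
    normalization of Macdonald: unitriangular in the monomial symmetric functions
    for the dominance order, and pairwise orthogonal. *)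
Definition is_jack_family (alpha : R) (P : intpart d -> (intpart d -> R)) : Prop :=
  (forall kappa, exists u : intpart d -> R,
     forall (M : nat) (z : 'I_M -> R[i]),
       symfun_eval (P kappa) z =
       monomial_sym kappa z
       + \sum_(rho | dominated rho kappa) (u rho)%:C * monomial_sym rho z) /\
  (forall kappa rho, kappa != rho -> jack_scalar alpha (P kappa) (P rho) = 0).

End Jack.

Section JackOfLabel.
Variables (R : realType) (N : nat) (n : 'I_N -> int).

Definition label_degree : nat := (\sum_(j < N) `|n j|)%N.

Definition is_label_part (kappa : intpart label_degree) : Prop :=
  perm_eq (parts_of kappa) (nz_parts [seq `|n j|%N | j <- enum 'I_N]).

(** The coupling lam corresponds to the Jack parameter alpha = 1 / lam. *)
Definition proportional_to_jack (lam : R) (Phi : ('I_N -> R) -> R[i]) : Prop :=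
  exists2 kappa, is_label_part kappa &
    forall P, is_jack_family lam^-1 P ->
      proportional Phi (fun x => symfun_eval (P kappa) (fun j => expi (x j))).

End JackOfLabel.

(* Main.v *)
(** In the variables [z_j = exp (i x_j)], conjugation by [Psi0] turns the
    Sutherland Hamiltonian into the Laplace-Beltrami operator [laplace].  The
    functions [P_m] of the novel algorithm are the coefficients of [w^m] in
    [\prod_(j < k) (1 - w_k / w_j)^lam \prod_(j, k) (1 - z_k w_j)^(- lam)]
    (up to orientation), so that [P_m] is a combination of products of the
    one-row functions [g_r]; [laplace] maps [P_m] to [E_m P_m] minus
    [2 lam (lam - 1) \sum_p \sum_s s P_(m + s E_p)], and the recursion for the
    [a_mu] cancels the latter terms.  The lowest monomial (for the statistic
    [mheight]) of a symmetric polynomial eigenfunction is a partition with the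
    same energy, hence it is [n] if [E_n] is non-degenerate, and the eigenfunction
    is unique up to normalization: this gives the comparison with Sutherland's
    algorithm.  Finally the Cauchy kernel [\prod (1 - z_k w_j)^(- lam)] has a power
    sum expansion with positive coefficients, which makes [Phi] non-zero, and a
    Jack expansion by orthogonality; since [Phi] is a coefficient extraction in [w]
    of this kernel, it is a combination of Jack polynomials, of which only the one
    of [n] is compatible with the lowest monomial. *)

(* Series in the shifts [m -> m + E_jk] are handled as finite sums. The linear form [height] is
   negative on every [E_jk], while [Gm m] vanishes for negative height, so each series is cut off,
   at a bound that may be enlarged freely. Identities between such series follow from the uniqueness
   of the solution of a one-step recursion ([geom_unique]).

   The delicate cancellation is of three-body type: terms coupling two different pairs of indices
   must collapse to single pairs. One combinatorial lemma, [sum_pair_pair_posroot], does this from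
   an abstract addition formula; it serves for the shift operators, for the cotangents in the
   gradient of [Psi0] and for the ground state energy.

   The denominators [z_j - z_k] restrict the eigenvalue equation to distinct coordinates. Polynomial
   identities are recovered by multiplying with the Vandermonde product and by the density of the
   torus, which comes from Fourier coefficients. The novel eigenfunction is non-zero because one
   coefficient functional can be applied to both sets of variables of the Cauchy kernel, which
   yields a sum of squares. *)
From HB Require Import structures.
Require Import Defs.
From mathcomp Require Import all_boot all_order all_algebra all_fingroup.
From mathcomp Require Import ring zify.
From mathcomp Require mpoly lra.
From mathcomp Require reals complex.

Set Implicit Arguments.
Unset Strict Implicit.
Unset Printing Implicit Defensive.

Import Order.TTheory GRing.Theory Num.Theory.
Local Open Scope ring_scope.

(** The notations of [mpoly] clash with those of the analysis library: they are
    confined to this section, and the latter is imported after it. *)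
Section MultivariatePolynomials.
Import mpoly.

(** * The one-row functions [g_r] and their differential equations *)

Section BinomialCoefficients.
Variable C : numFieldType.

(** The coefficient of [w^k] in [(1 - w)^(- s)]. The sign fits the Cauchy kernel; the numerator
    factors [(1 - w)^lam] use [rising (- lam)]. *)
Definition rising (s : C) (k : nat) : C :=
  (\prod_(i < k) (s + i%:R)) / (k`!)%:R.

Lemma rising0 s : rising s 0 = 1.
Proof. by rewrite /rising big_ord0 fact0 divr1. Qed.

Lemma risingS s k : k.+1%:R * rising s k.+1 = (s + k%:R) * rising s k.
Proof.
rewrite /rising big_ord_recr /= factS natrM.
have h1 : (k`!)%:R != 0 :> C by rewrite pnatr_eq0 -lt0n fact_gt0.
have h2 : k.+1%:R != 0 :> C by rewrite pnatr_eq0.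
by field; rewrite h1 addrC natr1 h2.
Qed.

Lemma rising_eq0_pred s k : (0 < k)%N ->
  k%:R * rising s k = (s + k.-1%:R) * rising s k.-1.
Proof. by case: k => // k _; rewrite risingS. Qed.

End BinomialCoefficients.

Section Zeta.
Variable C : comNzRingType.
Implicit Types (z : C) (f : nat -> C).

(** On generating functions in [w], multiplication by [z w / (1 - z w)]. The logarithmic derivative
    [z d/dz] of [(1 - z w)^(- lam)] is [lam] times this factor. *)
Fixpoint zeta z f r : C := if r is r'.+1 then z * (zeta z f r' + f r') else 0.

Lemma zeta_sum (I : finType) z (F : I -> nat -> C) r :
  zeta z (fun r => \sum_i F i r) r = \sum_i zeta z (F i) r.
Proof.
elim: r => [|r IH] /=; first by rewrite big1.
by rewrite IH -big_split /= mulr_sumr.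
Qed.

Lemma zeta_scale z c f r : zeta z (fun r => c * f r) r = c * zeta z f r.
Proof. by elim: r => [|r IH] /=; rewrite ?mulr0 // IH; ring. Qed.

(** Partial fractions: with [A = z w / (1 - z w)] and [A' = z' w / (1 - z' w)], one has
    [(z - z') A A' = z' A - z A']. *)
Lemma zeta_comm z z' f r :
  (z - z') * zeta z (zeta z' f) r = z' * zeta z f r - z * zeta z' f r.
Proof.
elim: r => [|r IH] /=; first by rewrite !mulr0 subrr.
transitivity (z * ((z - z') * zeta z (zeta z' f) r + (z - z') * zeta z' f r)).
  by ring.
by rewrite IH; ring.
Qed.

(** The derivation [w d/dw] sends [A = z w / (1 - z w)] to [A + A^2]; this is the Leibniz rule on
    the product of [A] with the series of [f]. *)
Lemma zeta_degree z f r :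
  r%:R * zeta z f r =
  zeta z (fun r => r%:R * f r) r + zeta z f r + zeta z (zeta z f) r.
Proof.
elim: r => [|r IH] /=; first by rewrite mulr0 !addr0.
rewrite -natr1.
transitivity (z * (r%:R * zeta z f r + zeta z f r + r%:R * f r + f r)); first by ring.
by rewrite IH; ring.
Qed.

Lemma eq_zeta z f f' r : f =1 f' -> zeta z f r = zeta z f' r.
Proof. by move=> h; elim: r => //= r ->; rewrite h. Qed.

End Zeta.

Section EulerDerivation.
Variables (N : nat) (C : comNzRingType).
Implicit Types (p q : {mpoly C[N]}) (m : 'X_{1..N}).

(** In the angles, [theta k] is [- i] times the derivative in [x_k]; it acts diagonally on
    monomials. *)
Definition theta (k : 'I_N) p : {mpoly C[N]} := 'X_k * p^`M(k).

Lemma mcoeffXM p m m' :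
  ('X_[m'] * p)@_m = if (m' <= m)%MM then p@_(m - m') else 0.
Proof.
case: ifP => h; first by rewrite -{1}(submK h) mulrC addmC mcoeffMX.
rewrite mcoeffM big1 // => i /eqP hi; rewrite mcoeffX.
case: eqP => [e|]; last by rewrite mul0r.
by have := lem_addr i.1 i.2; rewrite -hi -e h.
Qed.

Lemma mcoeff_theta k p m : (theta k p)@_m = (m k)%:R * p@_m.
Proof.
rewrite /theta mcoeffXM lep1mP; case: (posnP (m k)) => [->|hk].
  by rewrite mul0r.
rewrite mcoeff_deriv submK ?lep1mP -?lt0n //.
by rewrite mnmBE mnm1E eqxx subn1 prednK // mulr_natl.
Qed.

Lemma theta_is_linear k : linear (theta k).
Proof.
move=> c p q; apply/mpolyP => m.
by rewrite !(mcoeff_theta, mcoeffD, mcoeffZ); ring.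
Qed.
HB.instance Definition _ k :=
  GRing.isLinear.Build C {mpoly C[N]} {mpoly C[N]} _ (theta k) (theta_is_linear k).

Lemma thetaM k p q : theta k (p * q) = theta k p * q + p * theta k q.
Proof. by rewrite /theta mderivM; ring. Qed.

Lemma thetaC k (c : C) : theta k c%:MP = 0.
Proof. by rewrite /theta mderivC mulr0. Qed.

Lemma theta1 k : theta k 1 = 0.
Proof. by rewrite -mpolyC1 thetaC. Qed.

Lemma thetaX k m : theta k 'X_[m] = (m k)%:R *: 'X_[m].
Proof.
apply/mpolyP => m'; rewrite mcoeff_theta mcoeffZ mcoeffX.
by case: eqP => [->|]; rewrite ?mulr0.
Qed.

Lemma theta_prod k (I : finType) (P : pred I) (F : I -> {mpoly C[N]}) :
  theta k (\prod_(i | P i) F i) =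
  \sum_(j | P j) theta k (F j) * \prod_(i | P i && (i != j)) F i.
Proof.
(* Over a sequence, [i != j] removes every occurrence of [j], so the induction must carry the
   absence of repetitions. *)
suff H (s : seq I) : uniq s ->
  theta k (\prod_(i <- s | P i) F i) =
  \sum_(j <- s | P j) theta k (F j) * \prod_(i <- s | P i && (i != j)) F i.
  by apply: H; rewrite /index_enum -enumT enum_uniq.
elim: s => [|a s IH] /=; first by rewrite !big_nil theta1.
case/andP => ha hs; rewrite !big_cons /= eqxx andbF.
case: (boolP (P a)) => Pa; last first.
  rewrite (IH hs); rewrite big_seq_cond [RHS]big_seq_cond.
  by apply: eq_bigr => j _; rewrite big_cons (negbTE Pa).
rewrite thetaM (IH hs); congr (_ * _ + _).
  rewrite big_seq_cond [RHS]big_seq_cond; apply: eq_bigl => i.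
  case: (boolP (i \in s)) => //= is_; case: eqP => [e|]; last by rewrite andbT.
  by move: is_ ha; rewrite e => ->.
rewrite mulr_sumr big_seq_cond [RHS]big_seq_cond; apply: eq_bigr => j /andP [js _].
rewrite big_cons Pa /=; case: eqP => [e|_]; first by move: js ha; rewrite e => ->.
by rewrite mulrCA.
Qed.

End EulerDerivation.

Section CompleteFunctions.
Variables (N : nat) (C : numFieldType) (lam : C).

(** The coefficient of [w^r] in [\prod_k (1 - z_k w)^(- lam)]. *)
Definition gpol (r : nat) : {mpoly C[N]} :=
  \sum_(m : 'X_{1..N < r.+1})
     ((mdeg m == r)%:R * \prod_i rising lam (m i)) *: 'X_[m].

Lemma mcoeff_gpol r m :
  (gpol r)@_m = (mdeg m == r)%:R * \prod_i rising lam (m i).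
Proof.
case: (ltnP (mdeg m) r.+1) => h.
  by rewrite /gpol (@mcoeff_mpoly _ _
      (fun m => (mdeg m == r)%:R * \prod_i rising lam (m i))).
rewrite gtn_eqF // mul0r /gpol raddf_sum big1 // => -[i /= hi] _.
rewrite mcoeffZ mcoeffX; case: (i =P m) => [e|]; last by rewrite mulr0.
by move: hi; rewrite e ltnS leqNgt h.
Qed.

Lemma gpol0 : gpol 0 = 1.
Proof.
apply/mpolyP => m; rewrite mcoeff_gpol mcoeff1 mdeg_eq0.
case: eqP => [->|]; last by rewrite mul0r.
by rewrite big1 ?mul1r // => i _; rewrite mnm0E rising0.
Qed.

Lemma theta_gpol0 k : theta k (gpol 0) = 0.
Proof. by rewrite gpol0 theta1. Qed.

(** The generating function [G] of the [g_r] satisfies [(1 - z_k w) theta_k G = lam z_k w G]; this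
    is the coefficient of [w^(r+1)]. *)
Lemma theta_gpolS k r :
  theta k (gpol r.+1) = 'X_k * (theta k (gpol r) + lam *: gpol r).
Proof.
apply/mpolyP => m; rewrite mcoeffXM lep1mP mcoeff_theta.
case: (posnP (m k)) => [->|hk]; first by rewrite mul0r.
rewrite mcoeffD mcoeffZ mcoeff_theta !mcoeff_gpol.
have hm : (U_(k) <= m)%MM by rewrite lep1mP -lt0n.
set m' := (m - U_(k))%MM; have em : m = (m' + U_(k))%MM by rewrite submK.
have -> : (mdeg m == r.+1) = (mdeg m' == r).
  by rewrite em mdegD mdeg1 addn1 eqSS.
rewrite (bigD1 k) //= [in RHS](bigD1 k) //=.
have -> : m' k = (m k).-1 by rewrite mnmBE mnm1E eqxx subn1.
have -> : \prod_(i < N | i != k) rising lam (m' i)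
          = \prod_(i < N | i != k) rising lam (m i).
  by apply: eq_bigr => i hi; rewrite mnmBE mnm1E eq_sym (negbTE hi) subn0.
have := rising_eq0_pred lam hk.
move: (rising _ _) (rising lam (m k).-1) (\prod_(_ < _ | _) _) => a b c H.
transitivity ((mdeg m' == r)%:R * ((m k)%:R * a) * c); first by ring.
by rewrite H; ring.
Qed.

Lemma euler_gpol r : \sum_k theta k (gpol r) = r%:R *: gpol r.
Proof.
apply/mpolyP => m; rewrite raddf_sum mcoeffZ /=.
under eq_bigr do rewrite mcoeff_theta.
rewrite -mulr_suml -natr_sum -mdegE mcoeff_gpol.
by case: eqP => [->|]; rewrite // !mul0r !mulr0.
Qed.

Lemma gpol_sym r : gpol r \is symmetric.
Proof.
apply/issymP => s; apply/mpolyP => m; rewrite mcoeff_sym !mcoeff_gpol.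
rewrite mdeg_mperm; congr (_ * _).
rewrite [RHS](reindex_inj (@perm_inj _ s)) /=.
by apply: eq_bigr => i _; rewrite mnmE.
Qed.

Section Values.
Variable z : 'I_N -> C.
Let g r := (gpol r).@[z].
Let u k r := (theta k (gpol r)).@[z].

Lemma theta_gpol_zeta k r : u k r = lam * zeta (z k) g r.
Proof.
elim: r => [|r IH]; first by rewrite /u theta_gpol0 meval0 mulr0.
rewrite /u theta_gpolS mevalM mevalXU mevalD mevalZ -/(u k r) -/(g r) IH /=.
by ring.
Qed.

Lemma theta2_gpol_zeta k r :
  (theta k (theta k (gpol r))).@[z] =
  lam * zeta (z k) g r + lam * (1 + lam) * zeta (z k) (zeta (z k) g) r.
Proof.
elim: r => [|r IH]; first by rewrite theta_gpol0 linear0 meval0 !mulr0 addr0.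
rewrite theta_gpolS thetaM [theta k 'X_k]thetaX mnm1E eqxx scale1r -theta_gpolS.
rewrite mevalD -/(u k r.+1) theta_gpol_zeta mevalM mevalXU linearD linearZ /=.
rewrite mevalD mevalZ -/(u k r) IH theta_gpol_zeta.
by ring.
Qed.

Lemma euler_gpol_zeta r : r%:R * g r = lam * \sum_k zeta (z k) g r.
Proof.
rewrite -[g r]/(_.@[z]) -mevalZ -euler_gpol rmorph_sum /= mulr_sumr.
by apply: eq_bigr => k _; rewrite -theta_gpol_zeta.
Qed.

(** Induction on [s]. By the recursion for [zeta], moving one unit of degree from [s + 1] to [r]
    changes the sum only by terms which Euler's identity frees from derivatives; at [s = 0] the sum
    vanishes. The sum over [v] is the source of the off-diagonal part of [laplace] on products of
    two factors. *)
Lemma gpol_carre_du_champ r s :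
  \sum_k u k r * u k s =
  lam * (\sum_(v < s) (r%:R - s%:R + 2 * v.+1%:R) * (g (r + v.+1) * g (s - v.+1))
         - s%:R * (g r * g s)).
Proof.
elim: s r => [|s IH] r.
  rewrite big_ord0 mul0r subr0 mulr0 big1 // => k _.
  by rewrite [u k 0]theta_gpol_zeta /= !mulr0.
have step : \sum_k u k r * u k s.+1 = \sum_k u k r.+1 * u k s
    + lam * (r.+1%:R * (g r.+1 * g s) - s.+1%:R * (g s.+1 * g r)).
  have -> : r.+1%:R * (g r.+1 * g s) = \sum_k u k r.+1 * g s.
    rewrite mulrA euler_gpol_zeta -mulr_suml; congr (_ * _); rewrite mulr_sumr.
    by apply: eq_bigr => k _; rewrite theta_gpol_zeta.
  have -> : s.+1%:R * (g s.+1 * g r) = \sum_k u k s.+1 * g r.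
    rewrite mulrA euler_gpol_zeta -mulr_suml; congr (_ * _); rewrite mulr_sumr.
    by apply: eq_bigr => k _; rewrite theta_gpol_zeta.
  rewrite -sumrB mulr_sumr -big_split /=; apply: eq_bigr => k _.
  by rewrite !theta_gpol_zeta /=; ring.
rewrite step IH [in RHS]big_ord_recl /=.
rewrite (eq_bigr (fun v : 'I_s => (r.+1%:R - s%:R + 2 * v.+1%:R)
         * (g (r.+1 + v.+1) * g (s - v.+1)))) //; last first.
rewrite [in RHS](eq_bigr (fun v : 'I_s => (r.+1%:R - s%:R + 2 * v.+1%:R)
         * (g (r.+1 + v.+1) * g (s - v.+1)))); last first.
  move=> v _; rewrite /bump /= add1n addSnnS subSS -!natr1.
  by congr (_ * _); ring.
rewrite addn1 subSS subn0 -!natr1; ring.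
Qed.

Hypothesis z_inj : forall k l, k != l -> z k != z l.

(** Every term is expressed by the convolutions [a k] and [b k l]. Partial fractions remove the
    denominators, and the resulting double sum of the [b k l] is the one contained in [r^2 g_r], so
    that [g_r] alone is an eigenfunction. *)
Lemma gpol_laplace_beltrami r :
  \sum_k (theta k (theta k (gpol r))).@[z]
  + lam * \sum_(k < N) \sum_(l < N | (k < l)%N)
       (z k + z l) / (z k - z l) * (u k r - u l r)
  = (r%:R ^+ 2 + lam * (N%:R - 1) * r%:R) * g r.
Proof.
pose a k := zeta (z k) g r.
pose b k l := zeta (z k) (zeta (z l) g) r.
have pairE (k l : 'I_N) : (k < l)%N -> (z k + z l) / (z k - z l) * (u k r - u l r)
    = lam * (a k + a l + 2 * b k l).
  move=> kl; have hz : z k - z l != 0 by rewrite subr_eq0 z_inj // -val_eqE /= ltn_eqF.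
  apply: (mulfI hz); rewrite !theta_gpol_zeta -/(a k) -/(a l).
  have := zeta_comm (z k) (z l) g r; rewrite -/(a k) -/(a l) -/(b k l) => H.
  transitivity ((z k + z l) * lam * (a k - a l)); first by field.
  transitivity (lam * ((z k - z l) * (a k + a l) + 2 * ((z k - z l) * b k l))).
    by rewrite H; ring.
  by ring.
have bC k l : b k l = b l k.
  case: (eqVneq k l) => [->//|kl].
  have hz : z k - z l != 0 by rewrite subr_eq0 z_inj.
  apply: (mulfI hz); rewrite /b (zeta_comm (z k) (z l)).
  by rewrite -opprB -(zeta_comm (z l) (z k)) -mulNr opprB.
have sumE (f : 'I_N -> 'I_N -> C) : (forall k l, f k l = f l k) ->
    2 * \sum_(k < N) \sum_(l < N | (k < l)%N) f k l = \sum_k \sum_l f k l - \sum_k f k k.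
  move=> fC.
  have sw : \sum_(k < N) \sum_(l < N | (k < l)%N) f k l
          = \sum_(k < N) \sum_(l < N | (l < k)%N) f k l.
    under eq_bigr do rewrite big_mkcond; rewrite exchange_big /=.
    by apply: eq_bigr => l _; rewrite -big_mkcond /=; apply: eq_bigr => k _.
  rewrite mulr_natl mulr2n {2}sw.
  rewrite -big_split -sumrB; apply: eq_bigr => k _ /=.
  rewrite [in RHS](bigD1 k) //= [X in X - _]addrC addrK.
  rewrite [RHS](bigID (fun l : 'I_N => (k < l)%N)) /=; congr (_ + _).
    by apply: eq_bigl => l; case: (ltngtP k l) => [kl|kl|/val_inj ->]; rewrite ?eqxx ?andbF //;
      rewrite neq_ltn kl ?orbT.
  by apply: eq_bigl => l; case: (ltngtP k l) => [kl|kl|/val_inj ->]; rewrite ?eqxx ?andbF //;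
      rewrite neq_ltn kl ?orbT.
(* Euler's identity applied twice; its use under [zeta] produces the double sum of the [b k l]. *)
have r2 : r%:R ^+ 2 * g r =
    lam * (lam * (\sum_k \sum_l b k l) + \sum_k a k + \sum_k b k k).
  rewrite expr2 -mulrA euler_gpol_zeta mulrCA mulr_sumr; congr (_ * _).
  rewrite mulr_sumr -!big_split /=; apply: eq_bigr => k _.
  rewrite zeta_degree -/(a k) -/(b k k); congr (_ + _ + _).
  rewrite (eq_zeta _ _ (fun r => euler_gpol_zeta r)) zeta_scale zeta_sum.
  by [].
have h2 : (2 : C) != 0 by rewrite pnatr_eq0.
have E1 : \sum_k (theta k (theta k (gpol r))).@[z]
    = lam * \sum_k a k + lam * (1 + lam) * \sum_k b k k.
  rewrite !mulr_sumr -big_split /=; apply: eq_bigr => k _.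
  exact: theta2_gpol_zeta.
pose S := \sum_(k < N) \sum_(l < N | (k < l)%N) (a k + a l + 2 * b k l).
have E2 : \sum_(k < N) \sum_(l < N | (k < l)%N)
    (z k + z l) / (z k - z l) * (u k r - u l r) = lam * S.
  rewrite mulr_sumr; apply: eq_bigr => k _; rewrite [RHS]mulr_sumr.
  by apply: eq_bigr => l; exact: pairE.
have r1 : r%:R * g r = lam * \sum_k a k by exact: euler_gpol_zeta.
have HS : 2 * S = 2 * ((N%:R - 1) * \sum_k a k + \sum_k \sum_l b k l - \sum_k b k k).
  rewrite (sumE (fun k l : 'I_N => a k + a l + 2 * b k l)); last first.
    by move=> k l; rewrite (bC k l) (addrC (a k)).
  under eq_bigr do rewrite !big_split /= sumr_const card_ord -mulr_sumr.
  rewrite !big_split /= sumr_const card_ord -mulr_sumr sumrMnl -[_ *+ N]mulr_natl.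
  rewrite -mulr_sumr; ring.
rewrite E1 E2 (mulfI h2 HS).
transitivity (r%:R ^+ 2 * g r + lam * (N%:R - 1) * (r%:R * g r)); last by ring.
by rewrite r2 r1; ring.
Qed.

End Values.
End CompleteFunctions.

(** * Positive roots, and the conjugated operator on products of one-row functions *)

Section PairSums.
Variables (N : nat) (V : nmodType).
Implicit Types (F : 'I_N -> 'I_N -> V).

Lemma ltn_pair (p : idx_pair N) : (pair_fst p < pair_snd p)%N.
Proof. exact: (valP p). Qed.

Lemma neq_pair (p : idx_pair N) : pair_fst p != pair_snd p.
Proof. by rewrite -val_eqE /= ltn_eqF // ltn_pair. Qed.

Lemma big_idx_pair F :
  \sum_(p : idx_pair N) F (pair_fst p) (pair_snd p)
  = \sum_(k < N) \sum_(l < N | (k < l)%N) F k l.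
Proof.
rewrite pair_big_dep /= (reindex_omap (val : idx_pair N -> _) insub) /=.
  by apply: eq_bigl => p; rewrite valK eqxx andbT (valP p).
by move=> [k l] /= kl; rewrite insubT.
Qed.

Lemma big_offdiag F :
  \sum_(k < N) \sum_(l < N | l != k) F k l
  = \sum_(p : idx_pair N)
      (F (pair_fst p) (pair_snd p) + F (pair_snd p) (pair_fst p)).
Proof.
rewrite (big_idx_pair (fun k l => F k l + F l k)).
under [RHS]eq_bigr do rewrite big_split /=.
rewrite big_split /=.
have -> : \sum_(k < N) \sum_(l < N | (k < l)%N) F l k
        = \sum_(k < N) \sum_(l < N | (l < k)%N) F k l.
  under eq_bigr do rewrite big_mkcond; rewrite exchange_big /=.
  by apply: eq_bigr => l _; rewrite -big_mkcond /=; apply: eq_bigr => k _.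
rewrite -big_split /=; apply: eq_bigr => k _.
rewrite (bigID (fun l : 'I_N => (k < l)%N)) /=; congr (_ + _); apply: eq_bigl => l.
  by rewrite -val_eqE /=; case: ltngtP; rewrite ?andbF.
by rewrite -val_eqE /=; case: ltngtP; rewrite ?andbF.
Qed.

Lemma sum_pair_snd (f : 'I_N -> V) :
  \sum_(p : idx_pair N) f (pair_snd p) = \sum_(k < N) f k *+ k.
Proof.
rewrite (big_idx_pair (fun _ l => f l)).
under eq_bigr do rewrite big_mkcond; rewrite exchange_big /=.
apply: eq_bigr => l _; rewrite -big_mkcond sumr_const; congr (_ *+ _).
rewrite -sum1_card -(big_ord_widen N (fun _ => 1%N) (ltnW (ltn_ord l))).
by rewrite sum1_card card_ord.
Qed.

End PairSums.

Section Lattice.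
Variable N : nat.
Notation ZN := {ffun 'I_N -> int}.

(** The vector [E_jk], a positive root of type A; finite functions provide the additive group in
    which the shifts take place. *)
Definition posroot (p : idx_pair N) : ZN :=
  [ffun l => (pair_fst p == l)%:Z - (pair_snd p == l)%:Z].

(** A grading in which adding a positive root always goes down ([height_posroot_le]); it is what
    makes all shift sums finite. *)
Definition height (m : ZN) : int := \sum_(j < N) j%:Z * m j.

Lemma ffunMzE (f : ZN) (s : int) l : (f *~ s) l = f l *~ s.
Proof. by case: s => s; rewrite ?NegzE ?mulrNz ?ffunE ffunMnE. Qed.

Lemma height_is_additive : additive height.
Proof.
move=> a b; rewrite /height -sumrB; apply: eq_bigr => j _.
by rewrite !ffunE; ring.
Qed.
HB.instance Definition _ :=
  GRing.isAdditive.Build ZN int height height_is_additive.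

Lemma posrootE p : [/\ posroot p (pair_fst p) = 1, posroot p (pair_snd p) = -1 &
  forall l, l != pair_fst p -> l != pair_snd p -> posroot p l = 0].
Proof.
rewrite /posroot; split; rewrite ?ffunE ?eqxx.
- by rewrite eq_sym (negbTE (neq_pair p)).
- by rewrite (negbTE (neq_pair p)).
- by move=> l /negbTE h1 /negbTE h2; rewrite ffunE ![_ == l]eq_sym h1 h2.
Qed.

Lemma sum_posroot (V : zmodType) (f : 'I_N -> V) p :
  \sum_l f l *~ posroot p l = f (pair_fst p) - f (pair_snd p).
Proof.
have [h1 h2 h3] := posrootE p.
rewrite (bigD1 (pair_fst p)) // (bigD1 (pair_snd p)) /=; last first.
  by rewrite eq_sym neq_pair.
rewrite h1 h2 big1 ?addr0 ?mulrNz // => l /andP [l1 l2].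
by rewrite h3.
Qed.

Lemma height_posroot p : height (posroot p) = (pair_fst p)%:Z - (pair_snd p)%:Z.
Proof.
rewrite -(sum_posroot (fun l => l%:Z)); apply: eq_bigr => l _.
by rewrite -mulrzr intz.
Qed.

Lemma height_posroot_le p : height (posroot p) <= -1.
Proof. by rewrite height_posroot; have := ltn_pair p; lia. Qed.

End Lattice.

Section LaplaceBeltrami.
Variables (N : nat) (C : numFieldType) (lam : C).
Notation ZN := {ffun 'I_N -> int}.
Implicit Types (z : 'I_N -> C) (m : ZN).

(** Extension by [0] to negative indices, so that shifted vectors can leave the range without case
    distinctions. *)
Definition gz (a : int) : {mpoly C[N]} :=
  if a is Posz r then gpol N lam r else 0.

Definition Gm m : {mpoly C[N]} := \prod_j gz (m j).

Definition rho (j : 'I_N) : C := (N%:R + 1) / 2 - (j.+1)%:R.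

Definition energyC m : C := \sum_(j < N) ((m j)%:~R + lam * rho j) ^+ 2.

(** Conjugation of the Sutherland Hamiltonian by its ground state [Psi0], in
    the variables [z_j = exp (i x_j)]. *)
Definition laplace z (f : {mpoly C[N]}) : C :=
  \sum_k (theta k (theta k f)).@[z]
  + lam * \sum_(p : idx_pair N)
      (z (pair_fst p) + z (pair_snd p)) / (z (pair_fst p) - z (pair_snd p))
      * ((theta (pair_fst p) f).@[z] - (theta (pair_snd p) f).@[z])
  + energyC 0 * f.@[z].

Lemma gz_lt0 a : a < 0 -> gz a = 0.
Proof. by case: a. Qed.

Lemma gz_sym a : gz a \is symmetric.
Proof. by case: a => r; rewrite ?gpol_sym ?rpred0. Qed.

Lemma Gm_sym m : Gm m \is symmetric.
Proof. by rewrite rpred_prod // => j _; exact: gz_sym. Qed.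

Lemma Gm_lt0 m j : m j < 0 -> Gm m = 0.
Proof. by move=> h; rewrite /Gm (bigD1 j) //= gz_lt0 // mul0r. Qed.

Lemma Gm_height_lt0 m : height m < 0 -> Gm m = 0.
Proof.
move=> h; have [/existsP [j hj]|/existsPn H] := boolP [exists j, m j < 0].
  exact: Gm_lt0 hj.
move: h; rewrite ltNge sumr_ge0 // => j _.
by rewrite mulr_ge0 // leNgt H.
Qed.

(** The version with integer indices and a free cut-off [B]. For negative [a] the left-hand side is
    zero, but terms with [a + v + 1 >= 0] reappear on the right and have to cancel among
    themselves. *)
Lemma gz_carre_du_champ z (a b : int) B : (`|b| <= B)%N ->
  \sum_k (theta k (gz a)).@[z] * (theta k (gz b)).@[z] =
  lam * (\sum_(v < B) ((a - b)%:~R + 2 * v.+1%:R)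
            * ((gz (a + v.+1%:Z)).@[z] * (gz (b - v.+1%:Z)).@[z])
         - b%:~R * ((gz a).@[z] * (gz b).@[z])).
Proof.
case: b => [s /= hs|s _]; last first.
  rewrite [gz (Negz s)]gz_lt0 // big1 => [|k _]; last by rewrite linear0 meval0 mulr0.
  rewrite big1 => [|v _]; last by rewrite [gz (Negz s - _)]gz_lt0 ?meval0 ?mulr0 //; lia.
  by rewrite meval0 !mulr0 subr0 mulr0.
have -> : \sum_(v < B) ((a - Posz s)%:~R + 2 * v.+1%:R)
            * ((gz (a + v.+1%:Z)).@[z] * (gz (Posz s - v.+1%:Z)).@[z])
   = \sum_(v < s) ((a - Posz s)%:~R + 2 * v.+1%:R)
            * ((gz (a + v.+1%:Z)).@[z] * (gz (Posz s - v.+1%:Z)).@[z]) :> C.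
  rewrite [RHS](big_ord_widen B (fun v => ((a - Posz s)%:~R + 2 * v.+1%:R)
            * ((gz (a + v.+1%:Z)).@[z] * (gz (Posz s - v.+1%:Z)).@[z]) : C)) //.
  rewrite [RHS]big_mkcond /=; apply: eq_bigr => v _; case: ltnP => // hv.
  by rewrite [gz (Posz s - _)]gz_lt0 ?meval0 ?mulr0 //; lia.
case: a => [r|t].
  rewrite /gz gpol_carre_du_champ; congr (_ * (_ - _)).
  apply: eq_bigr => v _; rewrite -PoszD.
  have -> : s%:Z - v.+1%:Z = (s - v.+1)%:Z by have := ltn_ord v; lia.
  by rewrite rmorphB.
rewrite [gz (Negz t)]gz_lt0 // big1 => [|k _]; last by rewrite linear0 meval0 mul0r.
rewrite meval0 mul0r mulr0 subr0.
set S := \sum_(v < s) _; suff -> : S = 0 by rewrite mulr0.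
pose F v : C := ((Negz t - Posz s)%:~R + 2 * v.+1%:R)
            * ((gz (Negz t + v.+1%:Z)).@[z] * (gz (Posz s - v.+1%:Z)).@[z]).
have SE : S = \sum_(0 <= v < s) F v by rewrite big_mkord.
have [ts|st] := leqP s t.
  rewrite SE big_nat big1 // => v /andP [_ hv].
  by rewrite /F gz_lt0 ?meval0 ?mul0r ?mulr0 //; lia.
have {}SE : S = \sum_(t <= v < s) F v.
  rewrite SE (big_cat_nat (leq0n t) (ltnW st)) /= big_nat big1 ?add0r // => v /andP [_ hv].
  by rewrite /F gz_lt0 ?meval0 ?mul0r ?mulr0 //; lia.
(* The reflection [v -> t + s - v - 1] of the remaining range exchanges the two factors and changes
   the sign of the coefficient. *)
have : S + S = 0.
  rewrite {2}SE big_nat_rev /= SE -big_split /= big_nat big1 // => v /andP [v1 v2].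
  rewrite /F.
  have -> : Negz t + (t + s - v.+1).+1%:Z = Posz s - v.+1%:Z by lia.
  have -> : Posz s - (t + s - v.+1).+1%:Z = Negz t + v.+1%:Z by lia.
  rewrite [X in _ + _ * X]mulrC -mulrDl.
  have -> : 2 * (t + s - v.+1).+1%:R = (2 * (t + s - v.+1).+1%:Z)%:~R :> C.
    by rewrite rmorphM.
  have -> : 2 * v.+1%:R = (2 * v.+1%:Z)%:~R :> C by rewrite rmorphM.
  rewrite -!rmorphD /=.
  have -> : Negz t - Posz s + 2 * v.+1%:Z
     + (Negz t - Posz s + 2 * (t + s - v.+1).+1%:Z) = 0 by lia.
  by rewrite mul0r.
by move/eqP; rewrite -mulr2n mulrn_eq0 /= => /eqP.
Qed.

Lemma gz_laplace z (a : int) : (forall k l, k != l -> z k != z l) ->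
  \sum_k (theta k (theta k (gz a))).@[z]
  + lam * \sum_(p : idx_pair N)
      (z (pair_fst p) + z (pair_snd p)) / (z (pair_fst p) - z (pair_snd p))
      * ((theta (pair_fst p) (gz a)).@[z] - (theta (pair_snd p) (gz a)).@[z])
  = (a%:~R ^+ 2 + lam * (N%:R - 1) * a%:~R) * (gz a).@[z].
Proof.
move=> zi.
rewrite (big_idx_pair (fun k l => (z k + z l) / (z k - z l)
  * ((theta k (gz a)).@[z] - (theta l (gz a)).@[z]))).
case: a => [r|r]; first by rewrite -gpol_laplace_beltrami.
rewrite [gz (Negz r)]gz_lt0 // meval0 mulr0 big1 => [|k _]; last by rewrite !linear0.
rewrite big1 ?mulr0 ?addr0 // => k _.
by rewrite big1 // => l _; rewrite !linear0 subr0 mulr0.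
Qed.

(** Splits the energy into the one-row eigenvalues of [gz_laplace] and the correction [- b] that
    each pair contributes in [gz_carre_du_champ]. *)
Lemma energyCE m : energyC m =
  \sum_j ((m j)%:~R ^+ 2 + lam * (N%:R - 1) * (m j)%:~R)
  - 2 * lam * (\sum_(p : idx_pair N) (m (pair_snd p))%:~R) + energyC 0.
Proof.
rewrite (sum_pair_snd (fun k => (m k)%:~R)) mulr_sumr -sumrB -big_split /=.
apply: eq_bigr => j _; rewrite ffunE add0r /rho -natr1 -[_ *+ j]mulr_natl.
by field.
Qed.

Lemma Gm_shift z m p (s : int) :
  (Gm (m + posroot p *~ s)).@[z] =
  (gz (m (pair_fst p) + s)).@[z] * (gz (m (pair_snd p) - s)).@[z]
  * \prod_(i | (i != pair_fst p) && (i != pair_snd p)) (gz (m i)).@[z].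
Proof.
have [h1 h2 h3] := posrootE p.
have E l : (m + posroot p *~ s) l = m l + s * posroot p l.
  by rewrite ffunE ffunMzE mulrzz mulrC.
rewrite /Gm rmorph_prod /= (bigD1 (pair_fst p)) // (bigD1 (pair_snd p)) /=; last first.
  by rewrite eq_sym neq_pair.
rewrite !E h1 h2 mulr1 mulrN1 mulrA; congr (_ * _).
by apply: eq_bigr => i /andP [i1 i2]; rewrite E h3 // mulr0 addr0.
Qed.

(** By the Leibniz rule the first-order part acts on one factor at a time, whereas the second-order
    part also couples any two factors, through [gz_carre_du_champ]. The operator is triangular:
    every vector [m + s E_p] on the right has smaller height than [m]. *)
Lemma laplace_Gm z m B : (forall k l, k != l -> z k != z l) ->
  (forall j, (`|m j| <= B)%N) ->
  laplace z (Gm m) = energyC m * (Gm m).@[z]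
  + 2 * lam * \sum_(p : idx_pair N) \sum_(s < B)
      ((m (pair_fst p) - m (pair_snd p))%:~R + 2 * s.+1%:R)
      * (Gm (m + posroot p *~ s.+1)).@[z].
Proof.
move=> zi hB.
pose h i := (gz (m i)).@[z].
pose H j := \prod_(i | i != j) h i.
pose H2 j l := \prod_(i | (i != j) && (i != l)) h i.
have th k : (theta k (Gm m)).@[z] = \sum_j (theta k (gz (m j))).@[z] * H j.
  rewrite /Gm theta_prod rmorph_sum /=; apply: eq_bigr => j _.
  by rewrite mevalM rmorph_prod.
have th2 k : (theta k (theta k (Gm m))).@[z] =
    \sum_j (theta k (theta k (gz (m j)))).@[z] * H j
    + \sum_j \sum_(l | l != j)
        (theta k (gz (m j))).@[z] * (theta k (gz (m l))).@[z] * H2 j l.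
  rewrite /Gm theta_prod (linear_sum (theta k)) rmorph_sum /= -big_split; apply: eq_bigr => j _.
  rewrite thetaM mevalD mevalM [X in _ + X]mevalM rmorph_prod /=; congr (_ + _).
  rewrite theta_prod rmorph_sum /= mulr_sumr; apply: eq_bigr => l _.
  by rewrite mevalM rmorph_prod mulrA.
have GH j : h j * H j = (Gm m).@[z].
  by rewrite /Gm rmorph_prod [RHS](bigD1 j).
have GH2 p : h (pair_fst p) * h (pair_snd p) * H2 (pair_fst p) (pair_snd p)
     = (Gm m).@[z].
  by have := Gm_shift z m p 0; rewrite mulr0z !addr0 ?subr0 => ->.
pose w k l := (z k + z l) / (z k - z l).
have first_order : \sum_(p : idx_pair N) w (pair_fst p) (pair_snd p) *
    ((theta (pair_fst p) (Gm m)).@[z] - (theta (pair_snd p) (Gm m)).@[z])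
  = \sum_j (\sum_(p : idx_pair N) w (pair_fst p) (pair_snd p) *
    ((theta (pair_fst p) (gz (m j))).@[z] - (theta (pair_snd p) (gz (m j))).@[z])) * H j.
  under [RHS]eq_bigr do rewrite mulr_suml.
  rewrite exchange_big /=; apply: eq_bigr => p _.
  rewrite !th -sumrB mulr_sumr; apply: eq_bigr => j _.
  by rewrite -mulrA mulrBl.
have second_order : \sum_k (theta k (theta k (Gm m))).@[z] =
   \sum_j (\sum_k (theta k (theta k (gz (m j)))).@[z]) * H j
   + \sum_(p : idx_pair N) 2 * (\sum_k (theta k (gz (m (pair_fst p)))).@[z]
        * (theta k (gz (m (pair_snd p)))).@[z]) * H2 (pair_fst p) (pair_snd p).
  under eq_bigr do rewrite th2.
  rewrite big_split /=; congr (_ + _).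
    by rewrite exchange_big /=; apply: eq_bigr => j _; rewrite mulr_suml.
  rewrite exchange_big /=; under eq_bigr do rewrite exchange_big /=.
  rewrite big_offdiag; apply: eq_bigr => p _.
  rewrite mulr_natl mulr2n mulrDl !mulr_suml; congr (_ + _).
  apply: eq_bigr => k _; rewrite [X in X * _]mulrC; congr (_ * _).
  by apply: eq_bigl => i; rewrite andbC.
rewrite /laplace first_order second_order (energyCE m).
rewrite (eq_bigr (fun p => 2 * lam * (\sum_(s < B)
      ((m (pair_fst p) - m (pair_snd p))%:~R + 2 * s.+1%:R)
      * (Gm (m + posroot p *~ s.+1)).@[z])
      - 2 * lam * ((m (pair_snd p))%:~R * (Gm m).@[z]))); last first.
  move=> p _; rewrite (gz_carre_du_champ z _ (hB _)).
  rewrite -(GH2 p) -/(h _) -/(h _).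
  have -> : \sum_(s < B) ((m (pair_fst p) - m (pair_snd p))%:~R + 2 * s.+1%:R)
      * (Gm (m + posroot p *~ s.+1)).@[z] =
     (\sum_(v < B) ((m (pair_fst p) - m (pair_snd p))%:~R + 2 * v.+1%:R)
            * ((gz (m (pair_fst p) + v.+1%:Z)).@[z]
               * (gz (m (pair_snd p) - v.+1%:Z)).@[z])) * H2 (pair_fst p) (pair_snd p).
    by rewrite [RHS]mulr_suml; apply: eq_bigr => s _; rewrite Gm_shift !mulrA.
  by ring.
rewrite sumrB -mulr_sumr -mulr_sumr -mulr_suml.
have diag : \sum_j (\sum_k (theta k (theta k (gz (m j)))).@[z]) * H j +
   lam * \sum_j (\sum_(p : idx_pair N) w (pair_fst p) (pair_snd p) *
    ((theta (pair_fst p) (gz (m j))).@[z] - (theta (pair_snd p) (gz (m j))).@[z])) * H j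
  = (\sum_j ((m j)%:~R ^+ 2 + lam * (N%:R - 1) * (m j)%:~R)) * (Gm m).@[z].
  rewrite mulr_sumr -big_split /= mulr_suml; apply: eq_bigr => j _.
  by rewrite mulrA -mulrDl gz_laplace // -[LHS]mulrA; congr (_ * _); exact: GH.
move: diag; set D1 := \sum_j _ * H j; set D2 := \sum_j _ * H j.
set Q := \sum_j (_ ^+ 2 + _) => diag.
set S2 := \sum_p \sum_s _; set S3 := \sum_p _%:~R.
transitivity (D1 + lam * D2 + 2 * lam * S2
  - 2 * lam * (S3 * (Gm m).@[z])
  + energyC 0 * (Gm m).@[z]); first by ring.
by rewrite diag; ring.
Qed.

End LaplaceBeltrami.

(** * Finite sums over tuples and the calculus of shift operators *)

Section BoxSums.
Variables (I : finType) (V : nmodType).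
Implicit Types (F : {ffun I -> nat} -> V).

(** A finite stand-in for the sum over all tuples: by [boxsum_widen] its value does not depend on
    [B] once [F] vanishes outside the box. *)
Definition boxsum (B : nat) F : V :=
  \sum_(k : {ffun I -> 'I_B}) F [ffun i => val (k i)].

Definition mt_raise (k : {ffun I -> nat}) (i : I) (s : nat) : {ffun I -> nat} :=
  [ffun q => (k q + (q == i) * s)%N].

Lemma eq_boxsum B F F' : (forall k : {ffun I -> nat}, (forall i, k i < B)%N -> F k = F' k) ->
  boxsum B F = boxsum B F'.
Proof. by move=> h; apply: eq_bigr => k _; apply: h => i; rewrite ffunE ltn_ord. Qed.

Lemma boxsum_widen B B' F : (B <= B')%N ->
  (forall (k : {ffun I -> nat}) i, (B <= k i)%N -> F k = 0) -> boxsum B' F = boxsum B F.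
Proof.
move=> hB hF; rewrite /boxsum.
rewrite (bigID (fun k : {ffun I -> 'I_B'} => [forall i, (k i < B)%N])) /=.
rewrite [X in _ + X]big1 ?addr0; last first.
  by move=> k /forallPn [i]; rewrite -leqNgt => h; apply: (hF _ i); rewrite ffunE.
pose w (k : {ffun I -> 'I_B}) : {ffun I -> 'I_B'} := [ffun i => widen_ord hB (k i)].
have wI : injective w.
  move=> k k' /ffunP h; apply/ffunP => i; have := h i; rewrite !ffunE.
  by move/(congr1 val) => /= /val_inj.
rewrite (reindex_omap w (fun k => [pick j | w j == k])) /=; last first.
  move=> k /forallP hk; case: pickP => [j /= /eqP -> //|].
  move/(_ [ffun i => Ordinal (hk i)])/eqP; case.
  by apply/ffunP => i; rewrite !ffunE; apply: val_inj.
apply: eq_big => [k|k _].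
  apply/andP; split; first by apply/forallP => i; rewrite ffunE /=.
  by case: pickP => [j /= /eqP /wI -> //|/(_ k)]; rewrite eqxx.
by congr F; apply/ffunP => i; rewrite !ffunE.
Qed.

(** The change of variables [k_i -> k_i + s]; tuples pushed out of the box contribute nothing
    because [F] vanishes there. *)
Lemma boxsum_shift B i s F : (forall k : {ffun I -> nat}, (B <= k i)%N -> F k = 0) ->
  boxsum B (fun k => F (mt_raise k i s)) =
  boxsum B (fun k => if (s <= k i)%N then F k else 0).
Proof.
move=> hF; rewrite /boxsum.
pose up (k : {ffun I -> 'I_B}) : {ffun I -> 'I_B} :=
  [ffun q => if q == i then insubd (k i) (k i + s)%N else k q].
pose dn (k : {ffun I -> 'I_B}) : {ffun I -> 'I_B} :=
  [ffun q => if q == i then insubd (k i) (k i - s)%N else k q].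
have upi (k : {ffun I -> 'I_B}) : (k i + s < B)%N -> nat_of_ord (up k i) = (k i + s)%N.
  by move=> h; rewrite ffunE eqxx [LHS]val_insubd h.
have dni (k : {ffun I -> 'I_B}) : nat_of_ord (dn k i) = (k i - s)%N.
  by rewrite ffunE eqxx [LHS]val_insubd (leq_ltn_trans (leq_subr _ _) (ltn_ord (k i))).
under [RHS]eq_bigr do rewrite ffunE.
rewrite -big_mkcond /= [RHS](reindex_onto up dn) /=; last first.
  move=> k hk; apply/ffunP => q; rewrite ffunE; case: eqP => [->|/eqP qi].
    apply: val_inj; rewrite val_insubd dni subnK // ltn_ord.
    by [].
  by rewrite ffunE (negbTE qi).
rewrite (bigID (fun k : {ffun I -> 'I_B} => (k i + s < B)%N)) /=.
rewrite [X in _ + X]big1 ?addr0; last first.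
  by move=> k; rewrite -leqNgt => h; apply: hF; rewrite !ffunE eqxx mul1n.
apply: eq_big => [k|k hk]; last first.
  congr F; apply/ffunP => q; rewrite !ffunE; case: eqP => [->|_].
    by rewrite mul1n val_insubd hk.
  by rewrite mul0n addn0.
case: (ltnP (k i + s) B) => h.
  rewrite (upi _ h) leq_addl /=; apply/esym/eqP/ffunP => q.
  rewrite ffunE; case: eqP => [->|/eqP qi]; last by rewrite ffunE (negbTE qi).
  by apply: val_inj; rewrite val_insubd (upi _ h) addnK ltn_ord.
(* Outside the range [insubd] falls back to [k i]. Such a [k] fails the reindexing condition:
   [k i - s = k i] with [s <= k i] would mean [s = 0], against [B <= k i + s]. *)
have upk : up k = k.
  apply/ffunP => q; rewrite ffunE; case: eqP => [->|//].
  by apply: val_inj; rewrite val_insubd ltnNge h.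
rewrite upk; apply/esym/negbTE/negP => /andP [h1 /eqP /ffunP /(_ i) /(congr1 (@nat_of_ord _))].
rewrite dni => h2; move: h h1 h2 (ltn_ord (k i)); move: (nat_of_ord (k i)) => a.
by clear; lia.
Qed.

End BoxSums.

Section ShiftOperators.
Variables (N : nat) (C : numFieldType).
Notation ZN := {ffun 'I_N -> int}.
Implicit Types (f g h : ZN -> C) (m : ZN).

Definition ee (j k : 'I_N) : ZN := [ffun l => (j == l)%:Z - (k == l)%:Z].

Lemma height_ee j k : height (ee j k) = j%:Z - k%:Z.
Proof.
rewrite /height.
have E (i : 'I_N) : \sum_(l < N) l%:Z * (i == l)%:Z = i%:Z.
  rewrite (bigD1 i) //= eqxx mulr1 big1 ?addr0 // => l li.
  by rewrite eq_sym (negbTE li) mulr0.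
rewrite -[in RHS](E j) -[in RHS](E k) -sumrB; apply: eq_bigr => l _.
by rewrite ffunE mulrBr.
Qed.

Lemma ee_lt (j k : 'I_N) : (j < k)%N -> height (ee j k) < 0.
Proof. by rewrite height_ee; lia. Qed.

Lemma posroot_ee p : posroot p = ee (pair_fst p) (pair_snd p).
Proof. by []. Qed.

(** Functions on which every series [\sum_s c_s T_v^s] of powers of the shift
    along a vector of negative height acts by a finite sum. *)
Definition bounded f := forall m, height m < 0 -> f m = 0.

(** The operator [A_v = T_v / (1 - T_v)], where [T_v] is the shift by [v]. For [v] of negative
    height and bounded [f] the omitted terms are zero. *)
Definition geom (v : ZN) f : ZN -> C := fun m =>
  \sum_(s < `|height m|.+1) f (m + v *~ s.+1).

Lemma geom_widen v f m B : height v < 0 -> bounded f -> height m < B%:Z ->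
  geom v f m = \sum_(s < B) f (m + v *~ s.+1).
Proof.
move=> hv hf hB.
have H s : (`|height m| < s.+1)%N -> f (m + v *~ s.+1) = 0.
  move=> hs; apply: hf; rewrite raddfD raddfMz /=.
  have : height v *~ s.+1 <= - s.+1%:Z by rewrite mulrzz; nia.
  by lia.
pose M := maxn B `|height m|.+1.
have W K : (forall s, (K <= s)%N -> f (m + v *~ s.+1) = 0) -> (K <= M)%N ->
    \sum_(s < K) f (m + v *~ s.+1) = \sum_(s < M) f (m + v *~ s.+1).
  move=> hK KM; rewrite (big_ord_widen M (fun s => f (m + v *~ s.+1))) //.
  by rewrite big_mkcond; apply: eq_bigr => s _; case: ltnP => // /hK.
rewrite /geom !W ?leq_maxl ?leq_maxr // => s hs; last by apply: H; lia.
have [h0|h0] := ltP (height m) 0; last by apply: H; lia.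
apply: hf; rewrite raddfD raddfMz /=.
have : height v *~ s.+1 <= - s.+1%:Z by rewrite mulrzz; nia.
by lia.
Qed.

Lemma geom_bounded v f : height v < 0 -> bounded f -> bounded (geom v f).
Proof.
by move=> hv hf m hm; rewrite (geom_widen hv hf (B := 0)) ?big_ord0.
Qed.

Lemma shiftS (v m : ZN) (s : nat) : m + v + v *~ s.+1 = m + v *~ s.+2.
Proof. by rewrite -addrA -{1}[v]mulr1z -mulrzDr. Qed.

Lemma geom_rec v f m : height v < 0 -> bounded f ->
  geom v f m = f (m + v) + geom v f (m + v).
Proof.
move=> hv hf; set B := `|height m|.+1.
rewrite (geom_widen hv hf (B := B.+1)); last by rewrite /B; lia.
rewrite (geom_widen hv hf (m := m + v) (B := B)); last first.
  by rewrite raddfD /= /B; lia.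
rewrite big_ord_recl mulr1z; congr (_ + _); apply: eq_bigr => s _.
by rewrite shiftS.
Qed.

(** The equation [h = T_v (g + h)] expresses [h m] by values at smaller height, and bounded
    functions vanish at negative height. Most operator identities below are reduced to this
    recursion. *)
Lemma geom_unique v g h : height v < 0 -> bounded g -> bounded h ->
  (forall m, h m = g (m + v) + h (m + v)) -> h =1 geom v g.
Proof.
move=> hv hg hh H.
suff P B m : height m < B%:Z -> h m = geom v g m.
  by move=> m; apply: (P `|height m|.+1); lia.
elim: B m => [|B IH] m hm; first by rewrite hh // geom_bounded.
by rewrite H geom_rec // IH // raddfD /=; lia.
Qed.

Lemma eq_geom v f h : f =1 h -> geom v f =1 geom v h.
Proof. by move=> e m; apply: eq_bigr => s _; rewrite e. Qed.

Lemma geomD v f h m : geom v (fun m => f m + h m) m = geom v f m + geom v h m.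
Proof. by rewrite /geom big_split. Qed.

Lemma geomZ v c f m : geom v (fun m => c * f m) m = c * geom v f m.
Proof. by rewrite /geom mulr_sumr. Qed.

Lemma geom_sum v (I : finType) (F : I -> ZN -> C) m :
  geom v (fun m => \sum_i F i m) m = \sum_i geom v (F i) m.
Proof. by rewrite /geom exchange_big. Qed.

Lemma boundedD f h : bounded f -> bounded h -> bounded (fun m => f m + h m).
Proof. by move=> hf hh m hm; rewrite hf // hh // addr0. Qed.

Lemma boundedM (c : ZN -> C) f : bounded f -> bounded (fun m => c m * f m).
Proof. by move=> hf m hm; rewrite hf // mulr0. Qed.

Lemma bounded_sum (I : finType) (F : I -> ZN -> C) :
  (forall i, bounded (F i)) -> bounded (fun m => \sum_i F i m).
Proof. by move=> hF m hm; rewrite big1 // => i _; exact: hF. Qed.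

(** [A_v (1 + A_v) = T_v / (1 - T_v)^2], that is, the sum of the [s T_v^s] ([geom2E]). *)
Definition geom2 v f := geom v (fun m => f m + geom v f m).

Lemma geom2_bounded v f : height v < 0 -> bounded f -> bounded (geom2 v f).
Proof.
move=> hv hf; apply: geom_bounded => //.
by apply: boundedD => //; exact: geom_bounded.
Qed.

Lemma geom2E v f m B : height v < 0 -> bounded f -> height m < B%:Z ->
  geom2 v f m = \sum_(s < B) s.+1%:R * f (m + v *~ s.+1).
Proof.
move=> hv hf hB.
pose y m := \sum_(s < `|height m|.+1) s.+1%:R * f (m + v *~ s.+1).
have W m' B' : height m' < B'%:Z ->
    y m' = \sum_(s < B') s.+1%:R * f (m' + v *~ s.+1).
  move=> hB'.
  have H K s : height m' < K%:Z -> (K <= s)%N -> f (m' + v *~ s.+1) = 0.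
    move=> hK hs; apply: hf; rewrite raddfD raddfMz /=.
    have : height v *~ s.+1 <= - s.+1%:Z by rewrite mulrzz; nia.
    by lia.
  pose M := maxn B' `|height m'|.+1.
  have W K : height m' < K%:Z -> (K <= M)%N ->
      \sum_(s < K) s.+1%:R * f (m' + v *~ s.+1)
      = \sum_(s < M) s.+1%:R * f (m' + v *~ s.+1).
    move=> hK KM; rewrite (big_ord_widen M (fun s => s.+1%:R * f (m' + v *~ s.+1))) //.
    rewrite big_mkcond; apply: eq_bigr => s _; case: ltnP => // hs.
    by rewrite (H K) ?mulr0.
  by rewrite /y !W ?leq_maxl ?leq_maxr //; lia.
have yb : bounded y by move=> m' hm'; rewrite (W _ 0%N) ?big_ord0.
rewrite -W // /geom2; apply/esym; apply: geom_unique => //.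
  by apply: boundedD => //; exact: geom_bounded.
move=> {hB} m'; set B' := `|height m'|.+1.
rewrite (W _ B'.+1); last by rewrite /B'; lia.
have hB' : height (m' + v) < B'%:Z by rewrite raddfD /= /B'; lia.
rewrite (W _ B') // (geom_widen hv hf hB').
rewrite big_ord_recl mulr1z mul1r -addrA -big_split; congr (_ + _).
apply: eq_bigr => s _ /=; rewrite shiftS /bump /= add1n -[s.+2%:R]natr1; ring.
Qed.

Lemma geom_comm v w f : height v < 0 -> height w < 0 -> bounded f ->
  geom v (geom w f) =1 geom w (geom v f).
Proof.
move=> hv hw hf m; apply/esym; apply: geom_unique => //.
- exact: geom_bounded.
- by apply: geom_bounded => //; exact: geom_bounded.
move=> m'; set B := `|height m'|.+1.
have vb := geom_bounded hv hf.
rewrite (geom_widen hw vb (B := B)); last by rewrite /B; lia.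
rewrite (geom_widen hw vb (m := m' + v) (B := B)); last by rewrite raddfD /= /B; lia.
rewrite (geom_widen hw hf (m := m' + v) (B := B)); last by rewrite raddfD /= /B; lia.
rewrite -big_split; apply: eq_bigr => s _ /=.
by rewrite geom_rec // addrAC.
Qed.

(** [A_u A_v = A_(u+v) (1 + A_u + A_v)], because [T_(u+v) = T_u T_v]. This is the operator form of
    the addition formula of the cotangent. *)
Lemma geom_triple u v f : height u < 0 -> height v < 0 -> bounded f ->
  forall m, geom u (geom v f) m =
  geom (u + v) f m + geom (u + v) (geom u f) m + geom (u + v) (geom v f) m.
Proof.
move=> hu hv hf m.
have ub := geom_bounded hu hf; have vb := geom_bounded hv hf.
have huv : height (u + v) < 0 by rewrite raddfD /=; lia.
rewrite -!geomD; apply: geom_unique => //.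
- by move=> m' hm'; rewrite hf // ub // vb // !addr0.
- exact: geom_bounded.
move=> {}m; rewrite geom_rec // geom_comm // (geom_rec (m + u)) //.
rewrite (geom_rec (m + u) hv ub) geom_comm // !addrA.
by rewrite [in X in X + _ = _]addrAC.
Qed.

(** The commutator of [A_v] with the coordinate [m_l]: in [T_v^s] the coordinate is displaced by
    [s v_l], which gives the factor [s] of [geom2]. *)
Lemma geom_mul v f l m c : height v < 0 -> bounded f ->
  geom v (fun m => ((m l)%:~R + c) * f m) m =
  ((m l)%:~R + c) * geom v f m + (v l)%:~R * geom2 v f m.
Proof.
move=> hv hf; apply/esym.
move: m; apply: geom_unique => //; first exact: boundedM.
  apply: boundedD; first by apply: boundedM; exact: geom_bounded.
  by apply: boundedM; exact: geom2_bounded.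
move=> m; rewrite /geom2 [geom v f m]geom_rec // [geom v (fun _ => _) m]geom_rec //; last first.
  by apply: boundedD => //; exact: geom_bounded.
rewrite ffunE rmorphD /=; set X := geom v (fun _ => _) _.
by ring.
Qed.

End ShiftOperators.

(** * The three-body cancellation *)

Section ThreeBody.
Variables (N : nat) (C : numFieldType).
Notation ZN := {ffun 'I_N -> int}.

Lemma sum_pair_posroot (F : 'I_N -> 'I_N -> C) (x : 'I_N) :
  \sum_(q : idx_pair N) (posroot q x)%:~R * F (pair_fst q) (pair_snd q)
  = \sum_(d < N | (x < d)%N) F x d - \sum_(c < N | (c < x)%N) F c x.
Proof.
have E (q : idx_pair N) : (posroot q x)%:~R * F (pair_fst q) (pair_snd q) =
  F (pair_fst q) (pair_snd q) *+ (pair_fst q == x)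
  - F (pair_fst q) (pair_snd q) *+ (pair_snd q == x).
  rewrite ffunE rmorphB /= mulrBl.
  by do 2 case: (_ == x); rewrite /= ?mul1r ?mul0r.
rewrite (eq_bigr _ (fun q _ => E q)) sumrB.
rewrite (big_idx_pair (fun c d => F c d *+ (c == x))).
rewrite (big_idx_pair (fun c d => F c d *+ (d == x))); congr (_ - _).
  rewrite (bigD1 x) //= [X in _ + X]big1 ?addr0 => [|c /negbTE cx].
    by apply: eq_bigr => d _; rewrite eqxx.
  by apply: big1 => d _; rewrite cx.
rewrite [RHS]big_mkcond /=; apply: eq_bigr => c _.
case: ltnP => cx; last first.
  rewrite big1 // => d cd; case: eqP => // dx; subst d.
  by move: cd cx; lia.
rewrite (bigD1 x) //= eqxx big1 ?addr0 // => d /andP [_ /negbTE ->].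
by [].
Qed.

Let T (F : 'I_N -> 'I_N -> 'I_N -> C) : C :=
  \sum_(a < N) \sum_(b < N) \sum_(d < N) F a b d *+ ((a < b) && (b < d))%N.

(** Different pairs that share an index form triples [a < b < d], on which the addition formula for
    [A] leaves only [- 2 Z a d]; counting the intermediate [b] explains the factor
    [pair_snd - pair_fst]. Coincident pairs give the last sum, and disjoint ones have coefficient
    zero. *)
Lemma sum_pair_pair_posroot (A : 'I_N -> 'I_N -> 'I_N -> 'I_N -> C) (Z : 'I_N -> 'I_N -> C) :
  (forall a b c d : 'I_N, (a < b)%N -> (c < d)%N -> A a b c d = A c d a b) ->
  (forall a b d : 'I_N, (a < b)%N -> (b < d)%N ->
     A a b b d = Z a d + A a d a b + A a d b d) ->
  \sum_(p : idx_pair N) \sum_(q : idx_pair N)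
     ((posroot q (pair_fst p))%:~R - (posroot q (pair_snd p))%:~R)
     * A (pair_fst p) (pair_snd p) (pair_fst q) (pair_snd q)
  + 2 * \sum_(p : idx_pair N) ((pair_snd p)%:R - (pair_fst p)%:R) * Z (pair_fst p) (pair_snd p)
  = 2 * \sum_(p : idx_pair N) Z (pair_fst p) (pair_snd p)
  + 2 * \sum_(p : idx_pair N) A (pair_fst p) (pair_snd p) (pair_fst p) (pair_snd p).
Proof.
move=> AC A3.
(* The ways of sharing an index: a common first one in [S1], a common last one in [S4], and chained
   pairs in [S2] and [S3]. *)
pose S1 := \sum_(a < N) \sum_(b < N | (a < b)%N) \sum_(d < N | (a < d)%N) A a b a d.
pose S2 := \sum_(a < N) \sum_(b < N | (a < b)%N) \sum_(c < N | (c < a)%N) A a b c a.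
pose S3 := \sum_(a < N) \sum_(b < N | (a < b)%N) \sum_(d < N | (b < d)%N) A a b b d.
pose S4 := \sum_(a < N) \sum_(b < N | (a < b)%N) \sum_(c < N | (c < b)%N) A a b c b.
have -> : \sum_(p : idx_pair N) \sum_(q : idx_pair N)
     ((posroot q (pair_fst p))%:~R - (posroot q (pair_snd p))%:~R)
     * A (pair_fst p) (pair_snd p) (pair_fst q) (pair_snd q) = S1 - S2 - S3 + S4.
  under eq_bigr => p _.
    under eq_bigr do rewrite mulrBl.
    rewrite sumrB (sum_pair_posroot (A (pair_fst p) (pair_snd p)) (pair_fst p)).
    rewrite (sum_pair_posroot (A (pair_fst p) (pair_snd p)) (pair_snd p)).
    over.
  rewrite (big_idx_pair (fun a b => \sum_(d < N | (a < d)%N) A a b a d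
     - \sum_(c < N | (c < a)%N) A a b c a - (\sum_(d < N | (b < d)%N) A a b b d
     - \sum_(c < N | (c < b)%N) A a b c b))).
  rewrite /S1 /S2 /S3 /S4 -!sumrB -big_split; apply: eq_bigr => a _.
  by rewrite -!sumrB -big_split; apply: eq_bigr => b _ /=; rewrite opprB addrA addrAC.
rewrite (big_idx_pair (fun a b => A a b a b)) (big_idx_pair Z).
rewrite (big_idx_pair (fun a b => (b%:R - a%:R) * Z a b)).
set dA := \sum_a \sum_(_ | _) A _ _ _ _.
have mk (P : pred 'I_N) (F : 'I_N -> C) :
   \sum_(i < N | P i) F i = \sum_(i < N) F i *+ P i.
  by rewrite big_mkcond; apply: eq_bigr => i _; case: (P i).
have mkk (P : pred 'I_N) (Q : 'I_N -> pred 'I_N) (F : 'I_N -> 'I_N -> C) :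
   \sum_(i < N | P i) \sum_(j < N | Q i j) F i j
   = \sum_(i < N) \sum_(j < N) F i j *+ (P i && Q i j).
  rewrite mk; apply: eq_bigr => i _; rewrite mk.
  by case: (P i) => /=; rewrite ?mulr1n // mulr0n big1.
(* For [S1] and [S4]: the diagonal consists of coincident pairs, and by symmetry the rest is twice
   the ordered part. *)
have sq (P : pred 'I_N) (G : 'I_N -> 'I_N -> C) :
    (forall b d, P b -> P d -> G b d = G d b) ->
    \sum_(b < N | P b) \sum_(d < N | P d) G b d = \sum_(b < N | P b) G b b
    + 2 * \sum_(b < N) \sum_(d < N) G b d *+ [&& P b, P d & (b < d)%N].
  move=> GC; rewrite mulr_natl mulr2n.
  rewrite [X in _ + (X + _)](_ : _ =
      \sum_(b < N) \sum_(d < N) G b d *+ [&& P b, P d & (d < b)%N]); last first.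
    rewrite exchange_big /=; apply: eq_bigr => b _; apply: eq_bigr => d _.
    by case Pb: (P b); case Pd: (P d) => //=; rewrite GC.
  rewrite mkk [X in X + _]mk -!big_split; apply: eq_bigr => b _ /=.
  rewrite -big_split /= (bigD1 b) //= andbb; congr (_ + _).
  rewrite [RHS](bigD1 b) //= ltnn !andbF !mulr0n addr0 add0r.
  apply: eq_bigr => d; rewrite -val_eqE /=.
  by case: ltngtP => //= _ _; rewrite ?andbT ?andbF ?addr0 ?add0r.
have E1 : S1 = dA + 2 * T (fun a b d => A a b a d).
  rewrite /S1 /dA /T mulr_sumr -big_split /=; apply: eq_bigr => a _.
  rewrite sq => [|b d ab ad]; last exact: AC.
  congr (_ + 2 * _); apply: eq_bigr => b _; apply: eq_bigr => d _.
  by congr (_ *+ (nat_of_bool _)); apply/idP/idP; lia.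
have E4 : S4 = dA + 2 * T (fun a b d => A a d b d).
  have ex (F : 'I_N -> 'I_N -> C) : \sum_(a < N) \sum_(b < N | (a < b)%N) F a b
      = \sum_(b < N) \sum_(a < N | (a < b)%N) F a b.
    under eq_bigr do rewrite big_mkcond; rewrite exchange_big /=.
    by apply: eq_bigr => b _; rewrite -big_mkcond.
  rewrite /S4 /dA ex (ex (fun a b => A a b a b)).
  rewrite [X in 2 * X](_ : _ = \sum_(b < N) \sum_(a < N) \sum_(c < N)
      A a b c b *+ ((a < c) && (c < b))%N); last first.
    rewrite /T exchange_big /= [RHS]exchange_big /=.
    under eq_bigr do rewrite exchange_big /=.
    rewrite exchange_big /= [RHS]exchange_big /=; apply: eq_bigr => a _.
    by rewrite exchange_big.
  rewrite mulr_sumr -big_split /=; apply: eq_bigr => b _.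
  rewrite sq => [|a c ab cb]; last exact: AC.
  congr (_ + 2 * _); apply: eq_bigr => a _; apply: eq_bigr => c _.
  by congr (_ *+ (nat_of_bool _)); apply/idP/idP; lia.
have E3 : S3 = T (fun a b d => A a b b d).
  by rewrite /S3 /T; apply: eq_bigr => a _; rewrite mkk.
have E2 : S2 = T (fun a b d => A a b b d).
  rewrite /S2 /T.
  under eq_bigr do rewrite mkk.
  under eq_bigr do rewrite exchange_big /=.
  rewrite exchange_big /=; apply: eq_bigr => c _.
  apply: eq_bigr => a _; apply: eq_bigr => b _.
  by rewrite andbC; case: (boolP ((c < a) && (a < b))%N) => // /andP [h1 h2]; rewrite AC.
have tripE : T (fun a b d => A a b a d) + T (fun a b d => A a d b d)
    - T (fun a b d => A a b b d) = - T (fun a b d => Z a d).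
  rewrite /T -big_split -sumrB -sumrN; apply: eq_bigr => a _ /=.
  rewrite -big_split -sumrB -sumrN; apply: eq_bigr => b _ /=.
  rewrite -big_split -sumrB -sumrN; apply: eq_bigr => d _ /=.
  case: (boolP ((a < b) && (b < d))%N) => [/andP [ab bd]|_]; last first.
    by rewrite !mulr0n; ring.
  rewrite !mulr1n A3 // (AC a d a b) //; last by lia.
  by ring.
have TZ : T (fun a b d => Z a d) = \sum_(a < N) \sum_(d < N | (a < d)%N)
    ((d%:R - a%:R) * Z a d - Z a d).
  rewrite /T; apply: eq_bigr => a _; rewrite exchange_big /= [RHS]mk.
  apply: eq_bigr => d _.
  (* There are [d - a.+1] indices strictly between [a] and [d]; truncated subtraction also gives the
     right value when [d <= a]. *)
  have -> : \sum_(b < N) Z a d *+ ((a < b) && (b < d))%N = Z a d *+ (d - a.+1).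
    rewrite sumrMnr; congr (_ *+ _).
    rewrite -(big_mkord xpredT (fun b => nat_of_bool ((a < b) && (b < d))%N)).
    rewrite (big_cat_nat (leq0n d) (ltnW (ltn_ord d))) /=.
    rewrite [X in (_ + X)%N]big_nat [X in (_ + X)%N]big1 ?addn0 => [|b hb]; last by lia.
    have [da|ad] := leqP d a.
      by rewrite big_nat big1 => [|b hb]; lia.
    rewrite (big_cat_nat (leq0n a.+1) ad) /= big_nat big1 ?add0n => [|b hb]; last by lia.
    rewrite big_nat (eq_bigr (fun=> 1%N)) => [|b hb]; last by lia.
    by rewrite -big_nat sum_nat_const_nat muln1.
  case: ltnP => ad; last by rewrite (_ : (d - a.+1)%N = 0%N) //; lia.
  by rewrite -[_ *+ (_ - _)]mulr_natl natrB // -natr1 mulr1n; ring.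
rewrite E1 E2 E3 E4.
have TZ' : \sum_(a < N) \sum_(b < N | (a < b)%N) (b%:R - a%:R) * Z a b
  = T (fun a b d => Z a d) + \sum_(a < N) \sum_(b < N | (a < b)%N) Z a b.
  rewrite TZ -big_split; apply: eq_bigr => a _ /=.
  by rewrite -big_split; apply: eq_bigr => b _ /=; rewrite subrK.
rewrite TZ'.
have -> : T (fun a b d => A a b b d) = T (fun a b d => A a b a d)
   + T (fun a b d => A a d b d) + T (fun a b d => Z a d).
  by rewrite -[X in _ + X]opprK -tripE; ring.
by ring.
Qed.

End ThreeBody.

(** * The novel functions and their eigenvalue equation *)

Section PsiOperator.
Variables (N : nat) (C : numFieldType) (lam : C).
Notation ZN := {ffun 'I_N -> int}.
Implicit Types (f g h : ZN -> C) (m : ZN) (mu : mtuple N).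

Definition vecmu mu : ZN := \sum_(p : idx_pair N) posroot p *+ mu p.

Lemma vecmuE mu l : vecmu mu l = \sum_(p : idx_pair N) (mu p)%:Z * posroot p l.
Proof.
rewrite sum_ffunE; apply: eq_bigr => p _.
by rewrite ffunMnE -mulr_natl natz.
Qed.

Lemma vecmu_raise mu p s : vecmu (mt_raise mu p s) = vecmu mu + posroot p *+ s.
Proof.
rewrite /vecmu (bigD1 p) // [in RHS](bigD1 p) //= ffunE eqxx mul1n mulrnDr.
rewrite -!addrA; congr (_ + _); rewrite addrC; congr (_ + _).
by apply: eq_bigr => q /negbTE qp; rewrite ffunE qp mul0n addn0.
Qed.

Lemma height_vecmu_le mu p : height (vecmu mu) <= - (mu p)%:Z.
Proof.
have H q : height (posroot q *+ mu q) <= - (mu q)%:Z.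
  rewrite raddfMn /= -mulr_natl natz; have := height_posroot_le q.
  by move: (height _) => x; nia.
rewrite raddf_sum /= (bigD1 p) //=; apply: le_trans (H p).
rewrite gerDl -oppr_ge0 -sumrN sumr_ge0 // => q _.
by rewrite oppr_ge0; apply: le_trans (H q) _; rewrite oppr_le0.
Qed.

(** The coefficients of the numerator [\prod_p (1 - T_p)^lam] of the kernel, with [T_p] the shift
    along the root [p]. *)
Definition beta mu : C := \prod_(p : idx_pair N) rising (- lam) (mu p).

Lemma beta_raise mu p :
  (mu p).+1%:R * beta (mt_raise mu p 1) = ((mu p)%:R - lam) * beta mu.
Proof.
rewrite /beta (bigD1 p) // [in RHS](bigD1 p) //= ffunE eqxx mul1n addn1.
rewrite mulrA risingS [- lam + _]addrC -mulrA; congr (_ * (_ * _)).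
by apply: eq_bigr => q /negbTE qp; rewrite ffunE qp mul0n addn0.
Qed.

(** The operator [\prod_p (1 - T_p)^lam] on bounded functions; it sends [m -> Gm m] to [m -> Ppol m]
    ([meval_Ppol]). *)
Definition Psi f : ZN -> C := fun m =>
  boxsum `|height m|.+1 (fun mu => beta mu * f (m + vecmu mu)).

Lemma bounded_vecmu f m mu p B : bounded f -> height m < B%:Z ->
  (B <= mu p)%N -> f (m + vecmu mu) = 0.
Proof.
move=> hf hm hB; apply: hf; rewrite raddfD /=.
by have := height_vecmu_le mu p; lia.
Qed.

Lemma boxsum_bound (F : mtuple N -> ZN -> C) m B B' :
  (forall mu, bounded (F mu)) -> height m < B%:Z -> height m < B'%:Z ->
  boxsum B (fun mu => F mu (m + vecmu mu)) = boxsum B' (fun mu => F mu (m + vecmu mu)).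
Proof.
move=> hF; wlog hBB : B B' / (B <= B')%N => [W|] hB hB'.
  by case: (leqP B B') => [h|/ltnW h]; [exact: W | apply/esym; exact: W].
apply/esym/boxsum_widen => // mu p hp.
exact: (bounded_vecmu (hF mu) hB hp).
Qed.

Lemma Psi_widen f m B : bounded f -> height m < B%:Z ->
  Psi f m = boxsum B (fun mu => beta mu * f (m + vecmu mu)).
Proof.
move=> hf hB; apply: (boxsum_bound (F := fun mu m => beta mu * f m)) => //; last by lia.
by move=> mu; exact: (boundedM (fun=> beta mu)).
Qed.

Lemma bounded_boxsum0 f m mu : bounded f -> height m < 0 -> f (m + vecmu mu) = 0.
Proof.
move=> hf hm; have [p _|no] := pickP (@predT (idx_pair N)).
  by apply: hf; rewrite raddfD /=; have := height_vecmu_le mu p; lia.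
rewrite (_ : vecmu mu = 0) ?addr0 ?hf // /vecmu big1 // => p _.
by have := no p.
Qed.

Lemma Psi_bounded f : bounded f -> bounded (Psi f).
Proof.
move=> hf m hm; rewrite /Psi /boxsum big1 // => k _.
by rewrite (bounded_boxsum0 _ hf hm) mulr0.
Qed.

Lemma eq_Psi f g : f =1 g -> Psi f =1 Psi g.
Proof. by move=> e m; apply: eq_bigr => k _; rewrite e. Qed.

Lemma PsiD f g m : Psi (fun m => f m + g m) m = Psi f m + Psi g m.
Proof. by rewrite /Psi /boxsum -big_split; apply: eq_bigr => k _; rewrite mulrDr. Qed.

Lemma PsiZ c f m : Psi (fun m => c * f m) m = c * Psi f m.
Proof. by rewrite /Psi /boxsum mulr_sumr; apply: eq_bigr => k _; rewrite mulrCA. Qed.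

Lemma Psi_sum (I : finType) (F : I -> ZN -> C) m :
  Psi (fun m => \sum_i F i m) m = \sum_i Psi (F i) m.
Proof.
by rewrite /Psi /boxsum exchange_big; apply: eq_bigr => k _; rewrite mulr_sumr.
Qed.

Lemma Psi_geom v f : height v < 0 -> bounded f ->
  Psi (geom v f) =1 geom v (Psi f).
Proof.
move=> hv hf; have gb := geom_bounded hv hf.
apply: geom_unique => //; [exact: Psi_bounded | exact: Psi_bounded |].
move=> m; set B := `|height m|.+1.
have hB : height (m + v) < B%:Z by rewrite raddfD /= /B; lia.
rewrite (Psi_widen hf hB) (Psi_widen gb hB) (Psi_widen gb (m := m) (B := B)).
  2: by rewrite /B; lia.
rewrite /boxsum -big_split; apply: eq_bigr => k _ /=.
by rewrite geom_rec // addrAC mulrDr.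
Qed.

(** [T d/dT (1 - T)^lam = - lam (T / (1 - T)) (1 - T)^lam] in the variable [T = T_p]. The recursion
    [beta_raise] of the coefficients yields the equation that characterizes [geom]. *)
Lemma Psi_weight f p m B : bounded f -> height m < B%:Z ->
  boxsum B (fun mu => (mu p)%:R * (beta mu * f (m + vecmu mu)))
  = - lam * geom (posroot p) (Psi f) m.
Proof.
move=> hf hB.
have hp : height (posroot p) < 0 by rewrite posroot_ee ee_lt ?ltn_pair.
pose h m := boxsum `|height m|.+1 (fun mu => (mu p)%:R * (beta mu * f (m + vecmu mu))).
have hW m' B' : height m' < B'%:Z ->
   h m' = boxsum B' (fun mu => (mu p)%:R * (beta mu * f (m' + vecmu mu))).
  move=> hB'; rewrite /h.
  apply: (boxsum_bound (F := fun mu m => (mu p)%:R * (beta mu * f m))) => //; last by lia.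
  by move=> mu; do 2 apply: (boundedM (fun=> _)).
rewrite -hW // -geomZ; move: m {hB} .
apply: geom_unique => //.
- by apply: (boundedM (fun=> - lam)); exact: Psi_bounded.
- move=> m hm; rewrite /h /boxsum big1 // => k _.
  by rewrite (bounded_boxsum0 _ hf hm) !mulr0.
move=> m; set B' := `|height m|.+1.
have h1 : height (m + posroot p) < B'%:Z by rewrite raddfD /= /B'; lia.
have h2 : height m < B'%:Z by rewrite /B'; lia.
rewrite (hW _ _ h1) (hW _ _ h2) (Psi_widen hf h1).
pose G mu := (mu p)%:R * (beta mu * f (m + vecmu mu)).
have GB mu : (B' <= mu p)%N -> G mu = 0.
  by move=> hB'; rewrite /G (bounded_vecmu hf h2 hB') !mulr0.
transitivity (boxsum B' (fun mu => if (1 <= mu p)%N then G mu else 0)).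
  by apply: eq_boxsum => mu _; rewrite /G; case: (mu p) => //; rewrite mul0r.
rewrite -boxsum_shift // /boxsum mulr_sumr -big_split; apply: eq_bigr => k _ /=.
set mu := [ffun i => val (k i)].
rewrite /G vecmu_raise mulr1n addrA [mt_raise _ _ _ _]ffunE eqxx mul1n addn1.
rewrite mulrA beta_raise -[m + vecmu mu + _]addrA [vecmu mu + _]addrC addrA.
by ring.
Qed.

(** The commutator of [Psi] with the coordinate [m_l]: a term of index [mu] displaces [m_l] by the
    [l]-th entry of [vecmu mu], and [Psi_weight] sums these displacements. *)
Lemma Psi_mul f l c m : bounded f ->
  Psi (fun m => ((m l)%:~R + c) * f m) m =
  ((m l)%:~R + c) * Psi f m
  - lam * \sum_(p : idx_pair N) (posroot p l)%:~R * geom (posroot p) (Psi f) m.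
Proof.
move=> hf.
have -> : lam * (\sum_(p : idx_pair N) (posroot p l)%:~R * geom (posroot p) (Psi f) m)
  = - \sum_(p : idx_pair N) ((posroot p l)%:~R *
  boxsum `|height m|.+1 (fun mu => (mu p)%:R * (beta mu * f (m + vecmu mu)))).
  rewrite mulr_sumr -sumrN; apply: eq_bigr => p _.
  by rewrite Psi_weight //; [ring | lia].
rewrite opprK /Psi /boxsum.
under [X in _ = _ + X]eq_bigr do rewrite mulr_sumr.
rewrite exchange_big mulr_sumr -big_split; apply: eq_bigr => k _ /=.
set mu := [ffun i => val (k i)].
rewrite ffunE rmorphD /= vecmuE rmorph_sum /=.
rewrite [X in _ = _ + X](_ : _ = (\sum_(p : idx_pair N) ((mu p)%:Z * posroot p l)%:~R)
   * (beta mu * f (m + vecmu mu))); first by ring.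
rewrite mulr_suml; apply: eq_bigr => p _.
by rewrite rmorphM /= -[((mu p)%:Z)%:~R]/((mu p)%:R); ring.
Qed.

End PsiOperator.

Section NovelFunctions.
Variables (N : nat) (C : numFieldType) (lam : C).
Notation ZN := {ffun 'I_N -> int}.
Implicit Types (m : ZN) (mu : mtuple N) (z : 'I_N -> C).

(** The algebraic form of the functions of the novel algorithm; the agreement with the regularized
    integral is [P_funE]. *)
Definition Ppol m : {mpoly C[N]} :=
  boxsum `|height m|.+1 (fun mu => beta lam mu *: Gm lam (m + vecmu mu)).

Lemma laplace_is_linear z : linear_for *%R (laplace lam z).
Proof.
move=> c f g; rewrite /laplace !mevalD !mevalZ.
under eq_bigr do rewrite !linearP /=.
under [X in _ + lam * X + _]eq_bigr do rewrite !linearP /=.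
rewrite big_split /= -mulr_sumr.
rewrite [X in _ + lam * X + _](_ : _ = c * \sum_(p : idx_pair N)
      (z (pair_fst p) + z (pair_snd p)) / (z (pair_fst p) - z (pair_snd p))
      * ((theta (pair_fst p) f).@[z] - (theta (pair_snd p) f).@[z])
   + \sum_(p : idx_pair N)
      (z (pair_fst p) + z (pair_snd p)) / (z (pair_fst p) - z (pair_snd p))
      * ((theta (pair_fst p) g).@[z] - (theta (pair_snd p) g).@[z])).
  by ring.
rewrite mulr_sumr -big_split; apply: eq_bigr => p _ /=.
by ring.
Qed.
HB.instance Definition _ z := GRing.isLinear.Build C {mpoly C[N]} C _
  (laplace lam z) (laplace_is_linear z).

Lemma Ppol_sym m : Ppol m \is symmetric.
Proof. by rewrite rpred_sum // => k _; rewrite rpredZ // Gm_sym. Qed.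

Section Eigen.
Variables (z : 'I_N -> C).
Hypothesis z_inj : forall k l, k != l -> z k != z l.

Let f m := (Gm lam m).@[z].

Lemma f_bounded : bounded f.
Proof. by move=> m hm; rewrite /f Gm_height_lt0 // meval0. Qed.

Lemma meval_Ppol m : (Ppol m).@[z] = Psi lam f m.
Proof.
by rewrite /Ppol /Psi /boxsum rmorph_sum; apply: eq_bigr => k _; rewrite /= mevalZ.
Qed.

Lemma laplace_Gm_geom m : laplace lam z (Gm lam m) = energyC lam m * f m
  + 2 * lam * \sum_(p : idx_pair N)
     geom (posroot p) (fun m => (m (pair_fst p) - m (pair_snd p))%:~R * f m) m.
Proof.
(* [B] exceeds the height, for [geom_widen], and bounds every entry, for [laplace_Gm]. *)
pose B := (`|height m|.+1 + \sum_j `|m j|)%N.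
rewrite (laplace_Gm _ (B := B)) //; last first.
  by move=> j; rewrite /B (bigD1 j) //=; lia.
congr (_ + _ * _); apply: eq_bigr => p _.
have hp : height (posroot p) < 0 by rewrite posroot_ee ee_lt ?ltn_pair.
rewrite (geom_widen (B := B)) //; last by rewrite /B; lia.
  apply: eq_bigr => s _; congr (_ * _).
  have [h1 h2 _] := posrootE p.
  rewrite !ffunE !ffunMzE h1 h2 !mulrzz mul1r mulN1r opprD opprK addrACA.
  rewrite [in RHS]rmorphD /=; congr (_ + _).
  by rewrite -[_ + _ in RHS]/(s.+1%:Z + s.+1%:Z) rmorphD /= mulr_natl mulr2n.
exact: (boundedM (fun m => _%:~R)) f_bounded.
Qed.

(** [Psi] is moved through [laplace_Gm_geom]. Commuting it with the quadratic energy creates terms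
    that cancel the linear part of the off-diagonal terms of [laplace_Gm]; the double sums over
    pairs then collapse by the three-body lemma, and [2 lam - 2 lam^2] remains as coefficient. *)
Lemma laplace_Ppol m B : height m < B%:Z ->
  laplace lam z (Ppol m) = energyC lam m * (Ppol m).@[z]
  - 2 * lam * (lam - 1) * \sum_(p : idx_pair N) \sum_(s < B)
      s.+1%:R * (Ppol (m + posroot p *~ s.+1)).@[z].
Proof.
move=> hB; have fb := f_bounded.
have hp (p : idx_pair N) : height (posroot p) < 0 by rewrite posroot_ee ee_lt ?ltn_pair.
pose P := Psi lam f; have Pb : bounded P by exact: Psi_bounded.
pose Z (p : idx_pair N) := geom (posroot p) P m.
pose ZZ (p q : idx_pair N) := geom (posroot p) (geom (posroot q) P) m.
pose Y (p : idx_pair N) := geom2 (posroot p) P m.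
have YE p : Y p = Z p + ZZ p p by rewrite /Y /geom2 geomD.
pose X (l : 'I_N) : C := (m l)%:~R + lam * rho C l.
pose E (p : idx_pair N) (l : 'I_N) : C := (posroot p l)%:~R.
have sumE (F : 'I_N -> C) p : \sum_l F l * E p l = F (pair_fst p) - F (pair_snd p).
  by rewrite -(sum_posroot F); apply: eq_bigr => l _; rewrite /E mulrzr.
pose Xf l := fun m => ((m l)%:~R + lam * rho C l) * f m.
have Xfb l : bounded (Xf l) by exact: (boundedM (fun m => (m l)%:~R + lam * rho C l)).
have PXf l m' : Psi lam (Xf l) m' = ((m' l)%:~R + lam * rho C l) * P m'
    + \sum_q (- lam * E q l) * geom (posroot q) P m'.
  rewrite Psi_mul //; congr (_ + _); rewrite -mulNr mulr_sumr.
  by apply: eq_bigr => q _; rewrite mulrA.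
have ZPXf l p : geom (posroot p) (Psi lam (Xf l)) m =
    X l * Z p + E p l * Y p + \sum_q (- lam * E q l) * ZZ p q.
  rewrite (eq_geom _ (PXf l)) geomD geom_mul //; congr (_ + _).
  by rewrite geom_sum; apply: eq_bigr => q _; rewrite geomZ.
have PXX l : Psi lam (fun m => ((m l)%:~R + lam * rho C l) * Xf l m) m =
    X l * (X l * P m + \sum_q (- lam * E q l) * Z q)
    - lam * \sum_p E p l * (X l * Z p + E p l * Y p + \sum_q (- lam * E q l) * ZZ p q).
  rewrite Psi_mul // PXf; congr (_ - _ * _).
  by apply: eq_bigr => p _; rewrite ZPXf.
have PZ p : Psi lam (geom (posroot p) (fun m => (m (pair_fst p) - m (pair_snd p))%:~R * f m)) m
   = (X (pair_fst p) - X (pair_snd p) - lam * ((pair_snd p)%:R - (pair_fst p)%:R)) * Z p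
     + 2 * Y p - lam * \sum_q (E q (pair_fst p) - E q (pair_snd p)) * ZZ p q.
  rewrite Psi_geom //; last exact: (boundedM (fun m => _%:~R)).
  (* [c] is the difference of [lam * rho] at the two indices; it allows the difference of
     coordinates to be written with the functions [Xf]. *)
  pose c := lam * ((pair_snd p)%:R - (pair_fst p)%:R).
  have -> : geom (posroot p) (Psi lam (fun m => (m (pair_fst p) - m (pair_snd p))%:~R * f m)) m
     = geom (posroot p) (fun m => Psi lam (Xf (pair_fst p)) m
          + (-1 * Psi lam (Xf (pair_snd p)) m + - c * P m)) m.
    apply: eq_geom => m'; rewrite /P -!PsiZ -!PsiD; apply: eq_Psi => m''.
    by rewrite /Xf /c /rho rmorphB /= -!natr1; ring.
  rewrite !geomD !geomZ !ZPXf -/(Z p) /c.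
  have -> : \sum_q (E q (pair_fst p) - E q (pair_snd p)) * ZZ p q
    = \sum_q E q (pair_fst p) * ZZ p q - \sum_q E q (pair_snd p) * ZZ p q.
    by rewrite -sumrB; apply: eq_bigr => q _; rewrite mulrBl.
  have e l : \sum_q (- lam * E q l) * ZZ p q = - lam * \sum_q E q l * ZZ p q.
    by rewrite mulr_sumr; apply: eq_bigr => q _; rewrite mulrA.
  rewrite !e; have [h1 h2 _] := posrootE p.
  by rewrite /E h1 h2 /=; ring.
have L : laplace lam z (Ppol m) =
    \sum_l Psi lam (fun m => ((m l)%:~R + lam * rho C l) * Xf l m) m
    + \sum_p 2 * lam * Psi lam (geom (posroot p)
        (fun m => (m (pair_fst p) - m (pair_snd p))%:~R * f m)) m.
  under [X in _ = _ + X]eq_bigr do rewrite -PsiZ.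
  rewrite -!Psi_sum -PsiD /Ppol linear_sum; apply: eq_bigr => k _ /=.
  rewrite [LHS]linearZ /= laplace_Gm_geom; congr (_ * (_ + _)).
    by rewrite /energyC mulr_suml; apply: eq_bigr => l _; rewrite /Xf expr2 mulrA.
  by rewrite mulr_sumr.
(* The terms in [D] cancel, and the left-hand side becomes the diagonal part plus
   [2 lam SY - lam^2 (S4 + 2 SD)]. *)
pose D := \sum_p (X (pair_fst p) - X (pair_snd p)) * Z p.
pose SY := \sum_p Y p.
pose S4 := \sum_p \sum_q (E q (pair_fst p) - E q (pair_snd p)) * ZZ p q.
pose SD := \sum_(p : idx_pair N) ((pair_snd p)%:R - (pair_fst p)%:R) * Z p.
have i1 : \sum_l X l * (X l * P m) = energyC lam m * P m.
  by rewrite /energyC mulr_suml; apply: eq_bigr => l _; rewrite expr2 mulrA.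
have i3 : \sum_l \sum_p E p l * (X l * Z p) = D.
  rewrite exchange_big; apply: eq_bigr => p _ /=; rewrite -sumE mulr_suml.
  by apply: eq_bigr => l _; rewrite mulrA [E _ _ * _]mulrC.
have i2 : \sum_l X l * (\sum_q (- lam * E q l) * Z q) = - lam * D.
  rewrite -i3 mulr_sumr; apply: eq_bigr => l _.
  by rewrite !mulr_sumr; apply: eq_bigr => q _; ring.
have i4 : \sum_l \sum_p E p l * (E p l * Y p) = 2 * SY.
  rewrite exchange_big mulr_sumr; apply: eq_bigr => p _ /=.
  have [h1 h2 _] := posrootE p.
  have -> : 2 = E p (pair_fst p) - E p (pair_snd p) by rewrite /E h1 h2 opprK.
  by rewrite -sumE mulr_suml; apply: eq_bigr => l _; rewrite mulrA.
have i5 : \sum_l \sum_p E p l * (\sum_q (- lam * E q l) * ZZ p q) = - lam * S4.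
  rewrite exchange_big mulr_sumr; apply: eq_bigr => p _ /=.
  under eq_bigr do rewrite mulr_sumr.
  rewrite exchange_big mulr_sumr; apply: eq_bigr => q _ /=.
  by rewrite -sumE mulr_suml mulr_sumr; apply: eq_bigr => l _; ring.
(* The three-body lemma for products of two operators [geom]; its addition formula is [geom_triple]
   for [E_ab + E_bd = E_ad]. *)
have three : S4 + 2 * SD = 2 * SY.
  pose A a b c d := geom (ee a b) (geom (ee c d) P) m.
  have := @sum_pair_pair_posroot N C A (fun a b => geom (ee a b) P m).
  rewrite /SY; under [\sum_p Y p]eq_bigr do rewrite YE.
  rewrite big_split mulrDr /=; apply.
    by move=> a b c d ab cd; apply: geom_comm => //; exact: ee_lt.
  move=> a b d ab bd; rewrite /A.
  rewrite geom_triple //; try exact: ee_lt.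
  have -> // : ee a b + ee b d = ee a d.
  by apply/ffunP => l; rewrite !ffunE addrA subrK.
have fin : SY = \sum_p \sum_(s < B) s.+1%:R * (Ppol (m + posroot p *~ s.+1)).@[z].
  apply: eq_bigr => p _; rewrite /Y (geom2E _ _ hB) //.
  by apply: eq_bigr => s _; rewrite meval_Ppol.
rewrite -fin L meval_Ppol -/(P m).
under eq_bigr do rewrite PXX mulrDr.
rewrite sumrB big_split /= i1 i2 -mulr_sumr.
under [\sum_l \sum_p _]eq_bigr do (under eq_bigr do rewrite !mulrDr; rewrite !big_split /=).
rewrite !big_split /= i3 i4 i5.
under eq_bigr do rewrite PZ.
rewrite -mulr_sumr sumrB big_split /= -!mulr_sumr -/S4 -/SY.
have -> : \sum_p (X (pair_fst p) - X (pair_snd p)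
      - lam * ((pair_snd p)%:R - (pair_fst p)%:R)) * Z p = D - lam * SD.
  by rewrite mulr_sumr -sumrB; apply: eq_bigr => p _; ring.
have S4E : S4 = 2 * SY - 2 * SD by rewrite -three addrK.
by rewrite S4E; ring.
Qed.

End Eigen.

End NovelFunctions.

Section NovelEigenfunction.
Variables (N : nat) (C : numFieldType) (lam : C).
Notation ZN := {ffun 'I_N -> int}.
Implicit Types (m : ZN) (mu : mtuple N) (z : 'I_N -> C).

Lemma mt_raiseK mu p s : mt_lower (mt_raise mu p s) p s = mu.
Proof. by apply/ffunP => q; rewrite !ffunE addnK. Qed.

Variables (n : ZN) (a : mtuple N -> C).

Definition Phipol : {mpoly C[N]} :=
  boxsum `|height n|.+1 (fun mu => a mu *: Ppol lam (n + vecmu mu)).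

Lemma Phipol_sym : Phipol \is symmetric.
Proof. by rewrite rpred_sum // => k _; rewrite rpredZ // Ppol_sym. Qed.

Hypothesis a_rec : forall mu,
  (energyC lam (n + vecmu mu) - energyC lam n) * a mu =
  2 * lam * (lam - 1) * \sum_(p : idx_pair N) \sum_(s < mu p)
     s.+1%:R * a (mt_lower mu p s.+1).

(** The index shift by [s E_p] in [laplace_Ppol] is absorbed into [mu] by [boxsum_shift]; after that
    [a_rec] makes the coefficients of each [P_(n + mu)] agree separately. *)
Lemma laplace_Phipol z : (forall k l, k != l -> z k != z l) ->
  laplace lam z Phipol = energyC lam n * Phipol.@[z].
Proof.
move=> zi; set B := `|height n|.+1.
have hB : height n < B%:Z by rewrite /B; lia.
have hBmu mu : height (n + vecmu mu) < B%:Z.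
  have [p _|no] := pickP (@predT (idx_pair N)).
    by rewrite raddfD /=; have := height_vecmu_le mu p; lia.
  rewrite (_ : vecmu mu = 0) ?addr0 // /vecmu big1 // => p _.
  by have := no p.
pose P m := (Ppol lam m).@[z].
have Pb : bounded P.
  move=> m hm; rewrite /P meval_Ppol; apply: Psi_bounded => //.
  exact: f_bounded.
have PhiE : Phipol.@[z] = boxsum B (fun mu => a mu * P (n + vecmu mu)).
  by rewrite /Phipol /boxsum rmorph_sum; apply: eq_bigr => k _; rewrite /= mevalZ.
have -> : laplace lam z Phipol = boxsum B (fun mu => a mu * (energyC lam (n + vecmu mu)
     * P (n + vecmu mu) - 2 * lam * (lam - 1) * \sum_(p : idx_pair N) \sum_(s < B)
      s.+1%:R * P (n + vecmu mu + posroot p *~ s.+1))).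
  rewrite /Phipol /boxsum linear_sum; apply: eq_bigr => k _.
  by rewrite [LHS]linearZ /= (laplace_Ppol _ zi (hBmu _)).
have shiftE : boxsum B (fun mu => a mu * \sum_(p : idx_pair N) \sum_(s < B)
      s.+1%:R * P (n + vecmu mu + posroot p *~ s.+1))
  = boxsum B (fun mu => (\sum_(p : idx_pair N) \sum_(s < mu p)
       s.+1%:R * a (mt_lower mu p s.+1)) * P (n + vecmu mu)).
  transitivity (\sum_(p : idx_pair N) \sum_(s < B)
     boxsum B (fun mu => s.+1%:R * a mu * P (n + vecmu mu + posroot p *~ s.+1))).
    rewrite /boxsum; under eq_bigr do rewrite mulr_sumr.
    rewrite exchange_big; apply: eq_bigr => p _ /=.
    under eq_bigr do rewrite mulr_sumr.
    rewrite exchange_big; apply: eq_bigr => s _ /=.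
    by apply: eq_bigr => k _; rewrite mulrCA mulrA.
  transitivity (\sum_(p : idx_pair N) \sum_(s < B)
     boxsum B (fun mu => if (s.+1 <= mu p)%N then
        s.+1%:R * a (mt_lower mu p s.+1) * P (n + vecmu mu) else 0)).
    apply: eq_bigr => p _; apply: eq_bigr => s _.
    rewrite -boxsum_shift; last first.
      by move=> mu hmu; rewrite (bounded_vecmu Pb hB hmu) mulr0.
    by apply: eq_boxsum => mu _; rewrite mt_raiseK vecmu_raise addrA.
  rewrite /boxsum; under eq_bigr do rewrite exchange_big /=.
  rewrite exchange_big /=; apply: eq_bigr => k _.
  rewrite mulr_suml; apply: eq_bigr => p _; rewrite ffunE mulr_suml.
  rewrite -big_mkcond /= (big_ord_widen B (fun s => s.+1%:R *
     a (mt_lower [ffun i => val (k i)] p s.+1) * P (n + vecmu [ffun i => val (k i)]))) //.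
  exact: ltnW.
rewrite PhiE /boxsum mulr_sumr.
transitivity (boxsum B (fun mu => energyC lam (n + vecmu mu) * a mu * P (n + vecmu mu))
  - 2 * lam * (lam - 1) * boxsum B (fun mu => a mu * \sum_(p : idx_pair N) \sum_(s < B)
      s.+1%:R * P (n + vecmu mu + posroot p *~ s.+1))).
  by rewrite /boxsum mulr_sumr -sumrB; apply: eq_bigr => k _; ring.
rewrite shiftE /boxsum mulr_sumr -sumrB; apply: eq_bigr => k _.
rewrite mulrA -a_rec; ring.
Qed.

End NovelEigenfunction.

(** * Lowest monomials and uniqueness of the eigenpolynomial *)

Section LeadingTerm.
Variables (N : nat) (C : numFieldType).
Notation ZN := {ffun 'I_N -> int}.
Implicit Types (m t d : 'X_{1..N}) (p A B : {mpoly C[N]}).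

Definition mheight m : nat := (\sum_(j < N) j * m j)%N.

Lemma mheightD m m' : mheight (m + m') = (mheight m + mheight m')%N.
Proof.
by rewrite /mheight -big_split; apply: eq_bigr => j _; rewrite mnmDE mulnDr.
Qed.

Lemma mheight_U (j : 'I_N) : mheight U_(j) = j.
Proof.
rewrite /mheight (bigD1 j) //= mnm1E eqxx muln1 big1 ?addn0 // => i ij.
by rewrite mnm1E eq_sym (negbTE ij) muln0.
Qed.

(** Among the monomials of [A], [d] is the only one of least height. *)
Definition bottom A d :=
  forall m, A@_m != 0 -> (mheight d <= mheight m)%N /\ (mheight m = mheight d -> m = d).

(** Heights add in products, so a contribution to [d + t] takes a monomial of least height from both
    factors. In [A] this must be [d], which determines the monomial of [B] even if several of its
    monomials have least height. *)
Lemma mcoeffM_bottom A B d t : bottom A d ->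
  (forall m, B@_m != 0 -> (mheight t <= mheight m)%N) ->
  (A * B)@_(d + t) = A@_d * B@_t.
Proof.
move=> hA hB; rewrite mcoeffM.
have hd : (mdeg d < (mdeg (d + t)%MM).+1)%N by rewrite mdegD ltnS leq_addr.
have ht : (mdeg t < (mdeg (d + t)%MM).+1)%N by rewrite mdegD ltnS leq_addl.
rewrite (bigD1 (BMultinom hd, BMultinom ht)) //= big1 ?addr0 // => k /andP [/eqP e ne].
have [->|A0] := eqVneq (A@_(k.1)) 0; first by rewrite mul0r.
have [->|B0] := eqVneq (B@_(k.2)) 0; first by rewrite mulr0.
have [h1 h2] := hA _ A0; have h3 := hB _ B0.
have hh : (mheight d + mheight t = mheight k.1 + mheight k.2)%N.
  by have := congr1 mheight e; rewrite !mheightD.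
have e1 : k.1 = d :> 'X_{1..N} by apply: h2; lia.
case/negP: ne; apply/eqP; case: k e1 e {A0 B0 h1 h2 h3 hh} => k1 k2 /= e1 e.
congr (_, _); apply: val_inj => //=.
by move: e; rewrite e1 => /addmI.
Qed.

Lemma bottomM A B d t : bottom A d -> bottom B t -> bottom (A * B) (d + t).
Proof.
move=> hA hB m; rewrite -mcoeff_msupp => /msuppM_le /allpairsP [[k1 k2]] /= [].
rewrite !mcoeff_msupp => /hA [a1 a2] /hB [b1 b2] ->.
rewrite !mheightD; split; first by rewrite leq_add.
move=> e; have e1 : mheight k1 = mheight d by move: a1 b1 e; clear; lia.
have e2 : mheight k2 = mheight t by move: b1 e e1; clear; lia.
by rewrite (a2 e1) (b2 e2).
Qed.

Lemma bottom1 : bottom 1 0.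
Proof.
move=> m; rewrite mcoeff1; case: (m =P 0%MM) => [-> _|_]; last by rewrite eqxx.
by split.
Qed.

Lemma bottom_prod (I : finType) (P : pred I) (F : I -> {mpoly C[N]}) (d : I -> 'X_{1..N}) :
  (forall i, P i -> bottom (F i) (d i) /\ (F i)@_(d i) = 1) ->
  bottom (\prod_(i | P i) F i) (\sum_(i | P i) d i)%MM /\
  (\prod_(i | P i) F i)@_(\sum_(i | P i) d i)%MM = 1.
Proof.
move=> H; elim/big_rec2: _ => [|i q A Pi [h1 h2]].
  by split; [exact: bottom1 | rewrite mcoeff1 eqxx].
have [h3 h4] := H i Pi; split; first exact: bottomM.
by rewrite mcoeffM_bottom // ?h2 ?h4 ?mulr1 // => m /h1 [].
Qed.

(** Used with [e = -1] for the Vandermonde product and with [e = 1] for the numerators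
    [z_j + z_k]. *)
Lemma bottom_linear (e : C) (q : idx_pair N) :
  bottom ('X_(pair_fst q) + e *: 'X_(pair_snd q)) U_(pair_fst q) /\
  ('X_(pair_fst q) + e *: 'X_(pair_snd q))@_(U_(pair_fst q)) = 1.
Proof.
split.
  move=> m; rewrite mcoeffD mcoeffZ !mcoeffX.
  case: (U_(pair_fst q)%MM =P m) => [<- _|_]; first by split.
  case: (U_(pair_snd q)%MM =P m) => [<- _|_]; last by rewrite mulr0 addr0 eqxx.
  rewrite !mheight_U; have := ltn_pair q; split; first lia.
  by move=> h; lia.
rewrite mcoeffD mcoeffZ !mcoeffX eqxx [in X in _ + X]eq_mnm1 eq_sym.
by rewrite (negbTE (neq_pair q)) mulr0 addr0.
Qed.

End LeadingTerm.

Section EigenpolynomialUniqueness.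
Variables (N : nat) (C : numFieldType) (lam : C).
Notation ZN := {ffun 'I_N -> int}.
Implicit Types (m t : 'X_{1..N}) (p : {mpoly C[N]}) (z : 'I_N -> C).

Definition zof m : ZN := [ffun j => (m j)%:Z].

Definition zariski_dense (S : ('I_N -> C) -> Prop) :=
  forall p, (forall z, S z -> p.@[z] = 0) -> p = 0.

(** [laplace] contains the quotients by [z_j - z_k], so the equation is imposed at points with
    distinct coordinates only. *)
Definition eigenpoly (S : ('I_N -> C) -> Prop) (E : C) p :=
  forall z, S z -> (forall k l, k != l -> z k != z l) -> laplace lam z p = E * p.@[z].

(** The form of the energy that a lowest coefficient produces: for [j < k] both [z_j + z_k] and
    [z_j - z_k] have lowest term [z_j], so their quotient counts as [1]. *)
Lemma energyC_diff (n : ZN) : energyC lam n =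
  \sum_j (n j)%:~R ^+ 2
  + lam * (\sum_(q : idx_pair N) ((n (pair_fst q))%:~R - (n (pair_snd q))%:~R))
  + energyC lam (0 : ZN).
Proof.
rewrite energyCE big_split /= -mulr_sumr sumrB.
have H : \sum_(q : idx_pair N) ((n (pair_fst q))%:~R + (n (pair_snd q))%:~R)
     = (N%:R - 1) * \sum_j (n j)%:~R :> C.
  rewrite -(big_offdiag (fun k l => (n k)%:~R : C)) mulr_sumr; apply: eq_bigr => k _.
  rewrite sumr_const -(addrK ((n k)%:~R) (_ *+ _)) -mulrSr.
  have -> : #|(fun i : 'I_N => i != k)|.+1 = N.
    have := cardC1 k; rewrite card_ord => /= ->.
    by rewrite prednK // (leq_ltn_trans _ (ltn_ord k)).
  by rewrite mulrBl mul1r mulr_natl.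
rewrite big_split /= in H.
have -> : \sum_(q : idx_pair N) (n (pair_fst q))%:~R =
  (N%:R - 1) * \sum_j (n j)%:~R - \sum_(q : idx_pair N) (n (pair_snd q))%:~R :> C.
  by rewrite -H addrK.
by ring.
Qed.

Definition vandermonde (P : pred (idx_pair N)) : {mpoly C[N]} :=
  \prod_(q | P q) ('X_(pair_fst q) + -1 *: 'X_(pair_snd q)).

Lemma meval_vandermonde P z :
  (vandermonde P).@[z] = \prod_(q | P q) (z (pair_fst q) - z (pair_snd q)).
Proof.
rewrite /vandermonde rmorph_prod; apply: eq_bigr => q _ /=.
by rewrite mevalD mevalZ !mevalXU mulN1r.
Qed.

Lemma vandermonde_inj z : (vandermonde predT).@[z] != 0 ->
  forall k l, k != l -> z k != z l.
Proof.
rewrite meval_vandermonde => /prodf_neq0 H.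
have W (k l : 'I_N) : (k < l)%N -> z k != z l.
  by move=> kl; have := H (Sub (k, l) kl) isT; rewrite /pair_fst /pair_snd SubK subr_eq0.
move=> k l; rewrite -val_eqE /= neq_ltn => /orP [/W //|/W].
by rewrite eq_sym.
Qed.

Section FixedEigenpolynomial.
Variables (S : ('I_N -> C) -> Prop) (E : C) (p : {mpoly C[N]}).
Hypotheses (Sd : zariski_dense S) (pE : eigenpoly S E p).

(** The eigenvalue equation multiplied by the Vandermonde product. *)
Lemma eigenpoly_cleared :
  vandermonde predT * (\sum_k theta k (theta k p) + (energyC lam (0 : ZN) - E) *: p)
  + \sum_(q : idx_pair N) (vandermonde (predC1 q) * ('X_(pair_fst q) + 1 *: 'X_(pair_snd q)))
      * (lam *: (theta (pair_fst q) p - theta (pair_snd q) p)) = 0.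
Proof.
set W := (X in X = 0).
have V0 : vandermonde predT != 0.
  have [_ h] := bottom_prod (fun (q : idx_pair N) (_ : predT q) => bottom_linear (-1 : C) q).
  by apply/eqP => e; move: h; rewrite -/(vandermonde _) e mcoeff0 => /eqP; rewrite eq_sym oner_eq0.
(* A further Vandermonde factor makes the identity trivial where two coordinates coincide; elsewhere
   it is the eigenvalue equation. It can be cancelled in the domain of polynomials. *)
suff : vandermonde predT * W = 0 by move/eqP; rewrite mulf_eq0 (negbTE V0) => /eqP.
apply: Sd => z Sz; rewrite mevalM.
have [->|Vz] := eqVneq (vandermonde predT).@[z] 0; first by rewrite mul0r.
have zi := vandermonde_inj Vz.
suff -> : W.@[z] = (vandermonde predT).@[z] * (laplace lam z p - E * p.@[z]).
  by rewrite (pE Sz zi) subrr !mulr0.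
rewrite /W /laplace mevalD mevalM mevalD rmorph_sum mevalZ /= rmorph_sum /=.
set T := \sum_k _; set U := \sum_(q : idx_pair N) _; set U' := \sum_(q : idx_pair N) _.
have -> : U = (vandermonde predT).@[z] * (lam * U').
  rewrite /U /U' !mulr_sumr; apply: eq_bigr => q _.
  rewrite mevalM mevalZ mevalB [X in X * _ = _]mevalM mevalD mevalZ !mevalXU !meval_vandermonde mul1r.
  rewrite [in RHS](bigD1 q) //=.
  have hq : z (pair_fst q) - z (pair_snd q) != 0 by rewrite subr_eq0 zi // neq_pair.
  by field.
by ring.
Qed.

(** At the lowest monomial each [theta k] acts by the scalar [t k] and each linear factor
    contributes the coefficient [1], so the cleared equation reads: energy difference times [p_t] is
    zero. *)
Lemma eigenpoly_bottom t : p@_t != 0 ->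
  (forall m, p@_m != 0 -> (mheight t <= mheight m)%N) -> energyC lam (zof t) = E.
Proof.
move=> pt hm; have := eigenpoly_cleared.
move/(congr1 (fun f => f@_((\sum_(q : idx_pair N) U_(pair_fst q)) + t)%MM)).
have hB (B : {mpoly C[N]}) : (forall m, p@_m = 0 -> B@_m = 0) ->
    forall m, B@_m != 0 -> (mheight t <= mheight m)%N.
  by move=> h m Bm; apply: hm; apply: contra_neq Bm; exact: h.
rewrite mcoeff0 mcoeffD.
have [b1 b2] := bottom_prod (fun (q : idx_pair N) (_ : predT q) => bottom_linear (-1 : C) q).
rewrite mcoeffM_bottom //; last first.
  apply: hB => m pm; rewrite mcoeffD mcoeffZ raddf_sum pm mulr0 addr0 big1 // => k _.
  by rewrite /= !mcoeff_theta pm !mulr0.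
rewrite b2 mul1r raddf_sum /=.
rewrite [X in _ + X](eq_bigr (fun q => lam * ((zof t (pair_fst q))%:~R
    - (zof t (pair_snd q))%:~R) * p@_t)); last first.
  move=> q _.
  have [b3 b4] := bottom_prod (fun (q' : idx_pair N) (_ : predC1 q q') => bottom_linear (-1 : C) q').
  have [b5 b6] := bottom_linear (1 : C) q.
  have -> : (\sum_(q : idx_pair N) U_(pair_fst q))%MM =
     ((\sum_(q' | predC1 q q') U_(pair_fst q')) + U_(pair_fst q))%MM :> 'X_{1..N}.
    by rewrite (bigD1 q) //= addmC.
  rewrite mcoeffM_bottom; last first.
  - apply: hB => m pm; rewrite mcoeffZ mcoeffB !mcoeff_theta pm !mulr0 subrr mulr0 //.
  - exact: bottomM.
  rewrite mcoeffM_bottom //; last by move=> m /b5 [].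
  rewrite b4 b6 mcoeffZ mcoeffB !mcoeff_theta !ffunE.
  by rewrite -![((_ _)%:Z)%:~R]/(_%:R); ring.
rewrite mcoeffD mcoeffZ raddf_sum /=.
rewrite (eq_bigr (fun k => (zof t k)%:~R ^+ 2 * p@_t)); last first.
  by move=> k _; rewrite /= !mcoeff_theta ffunE -[((_ _)%:Z)%:~R]/(_%:R); ring.
rewrite -!mulr_suml -mulr_sumr -mulrDl -mulrDl => /eqP.
rewrite mulf_eq0 (negbTE pt) orbF => /eqP h.
rewrite energyC_diff; apply/eqP; rewrite -subr_eq0; apply/eqP.
by rewrite -[RHS]h; ring.
Qed.

Hypothesis p_sym : p \is symmetric.

(** Exchanging two exponents that are in the wrong order lowers [mheight], and a symmetric
    polynomial contains the exchanged monomial as well. *)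
Lemma symmetric_bottom_sorted t : p@_t != 0 ->
  (forall m, p@_m != 0 -> (mheight t <= mheight m)%N) ->
  forall j k : 'I_N, (j <= k)%N -> (t k <= t j)%N.
Proof.
move=> pt hm j k; rewrite leq_eqVlt => /orP [/eqP/val_inj -> //|jk].
have := hm [multinom t (tperm j k i) | i < N].
rewrite msym_coeff // => /(_ pt).
have kj : k != j by rewrite -val_eqE /= gtn_eqF.
rewrite /mheight (bigD1 j) // (bigD1 k) //= [X in (_ <= X)%N](bigD1 j) // (bigD1 k) //=.
rewrite !mnmE tpermL tpermR.
rewrite [X in (_ <= _ + (_ + X))%N -> _](eq_bigr (fun i : 'I_N => (i * t i)%N)).
  by rewrite !addnA leq_add2r; nia.
by move=> i /andP [h1 h2]; rewrite mnmE tpermD // eq_sym.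
Qed.

Variable nu : 'X_{1..N}.
Hypothesis nondegenerate : forall m,
  (forall j k : 'I_N, (j <= k)%N -> (m k <= m j)%N) -> energyC lam (zof m) = E -> m = nu.

Lemma eigenpoly_leading : p != 0 -> p@_nu != 0 /\
  forall m, p@_m != 0 -> m != nu -> (mheight nu < mheight m)%N.
Proof.
move=> p0.
have ex : exists k, has (fun m => mheight m == k) (msupp p).
  have := p0; rewrite -msupp_eq0; case E0 : (msupp p) => [|m s] // _.
  by exists (mheight m); rewrite /= eqxx.
have [k /hasP [t tp /eqP tk] kmin] := ex_minnP ex.
rewrite mcoeff_msupp in tp.
have hm m : p@_m != 0 -> (k <= mheight m)%N.
  by move=> pm; apply: kmin; apply/hasP; exists m; rewrite ?mcoeff_msupp.
have uniq_t t' : p@_t' != 0 -> mheight t' = k -> t' = nu.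
  move=> pt' ht'; have hm' m : p@_m != 0 -> (mheight t' <= mheight m)%N by rewrite ht'; exact: hm.
  apply: nondegenerate; first exact: symmetric_bottom_sorted pt' hm'.
  exact: eigenpoly_bottom pt' hm'.
have tn := uniq_t _ tp tk; subst t; split => // m pm mn.
rewrite tk ltn_neqAle hm // andbT.
by apply: contraNneq mn => e; apply/eqP/uniq_t.
Qed.

End FixedEigenpolynomial.

(** With [c] chosen to cancel the coefficient at [nu], the difference [q - c p] is again a symmetric
    eigenpolynomial; by [eigenpoly_leading] a non-zero one could not vanish at [nu]. *)
Lemma eigenpoly_unique (S : ('I_N -> C) -> Prop) (E : C) (p q : {mpoly C[N]}) nu :
  zariski_dense S -> eigenpoly S E p -> eigenpoly S E q ->
  p \is symmetric -> q \is symmetric ->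
  (forall m, (forall j k : 'I_N, (j <= k)%N -> (m k <= m j)%N) ->
     energyC lam (zof m) = E -> m = nu) ->
  p != 0 -> q != 0 -> exists2 c : C, c != 0 & q = c *: p.
Proof.
move=> Sd pE qE ps qs nd p0 q0.
have [pn _] := eigenpoly_leading Sd pE ps nd p0.
have [qn _] := eigenpoly_leading Sd qE qs nd q0.
exists (q@_nu / p@_nu); first by rewrite mulf_neq0 // invr_neq0.
set c := _ / _.
have rE : eigenpoly S E (q - c *: p).
  move=> z Sz zi; rewrite -scaleNr linearD [X in _ + X]linearZ /= qE // pE //.
  by rewrite mevalD mevalZ; ring.
have rs : q - c *: p \is symmetric by rewrite rpredB // rpredZ.
apply/eqP; rewrite -subr_eq0; apply/negPn/negP => r0.
have [] := eigenpoly_leading Sd rE rs nd r0.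
by rewrite mcoeffB mcoeffZ /c divfK // subrr eqxx.
Qed.

End EigenpolynomialUniqueness.

(** * Partitions, the exponential formula and the Cauchy identity *)

Section IntegerPartitions.
Variable d : nat.
Implicit Types (kappa rho : intpart d) (s : seq nat).

Definition all_parts kappa : seq nat := [seq part_nth kappa i | i <- enum 'I_d].

Lemma size_all_parts kappa : size (all_parts kappa) = d.
Proof. by rewrite size_map size_enum_ord. Qed.

Lemma nth_all_parts kappa (i : 'I_d) : nth 0%N (all_parts kappa) i = part_nth kappa i.
Proof. by rewrite (nth_map i) ?size_enum_ord // nth_ord_enum. Qed.

Lemma part_nth_mono kappa (i j : 'I_d) : (i <= j)%N -> (part_nth kappa j <= part_nth kappa i)%N.
Proof.
by case/andP: (valP kappa) => /forallP /(_ i) /forallP /(_ j) /implyP.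
Qed.

Lemma sum_part_nth kappa : (\sum_(i < d) part_nth kappa i = d)%N.
Proof. by case/andP: (valP kappa) => _ /eqP. Qed.

Lemma sumn_nz_parts s : sumn (nz_parts s) = sumn s.
Proof. by elim: s => //= -[|x] s IH //=; rewrite IH. Qed.

Lemma sumn_parts_of kappa : sumn (parts_of kappa) = d.
Proof.
rewrite sumn_nz_parts -[RHS](sum_part_nth kappa) sumnE big_map.
by rewrite big_enum.
Qed.

Lemma nz_parts_gt0 s : all (leq 1) (nz_parts s).
Proof. by rewrite all_filter; apply/allP => x _ /=; rewrite lt0n implybb. Qed.

Lemma perm_nz_parts s : perm_eq s (nz_parts s ++ nseq (size s - size (nz_parts s)) 0%N).
Proof.
have -> : (size s - size (nz_parts s))%N = count (fun i => ~~ (i != 0%N)) s.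
  by rewrite size_filter -(count_predC (fun i => i != 0%N) s) addKn.
rewrite -(perm_filterC (fun i => i != 0%N) s) perm_cat2l.
rewrite -size_filter (_ : filter _ s = nseq (size [seq i <- s | ~~ (i != 0%N)]) 0%N) ?size_nseq //.
by apply/all_pred1P; rewrite all_filter; apply/allP => x _ /=; rewrite negbK implybb.
Qed.

Lemma size_le_sumn s : all (leq 1) s -> (size s <= sumn s)%N.
Proof. by elim: s => //= x s IH /andP [hx /IH]; lia. Qed.

Lemma le_sumn s x : x \in s -> (x <= sumn s)%N.
Proof.
elim: s => //= y s IH; rewrite inE => /orP [/eqP ->|/IH]; first exact: leq_addr.
by lia.
Qed.

Lemma perm_sumn s s' : perm_eq s s' -> sumn s = sumn s'.
Proof. by move=> h; rewrite !sumnE (perm_big _ h). Qed.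

(** The list is padded to length [d], so the non-zero parts fix the number of zeros, and
    monotonicity fixes the order. *)
Lemma intpart_eqP kappa rho :
  perm_eq (parts_of kappa) (parts_of rho) -> kappa = rho.
Proof.
move=> h.
have p : perm_eq (all_parts kappa) (all_parts rho).
  rewrite (perm_trans (perm_nz_parts _)) //  perm_sym (perm_trans (perm_nz_parts _)) //.
  by rewrite !size_all_parts (perm_size h) perm_sym perm_cat2r.
have so kappa' : sorted geq (all_parts kappa').
  rewrite /all_parts sorted_map.
  have : sorted ltn (map val (enum 'I_d)) by rewrite val_enum_ord iota_ltn_sorted.
  rewrite sorted_map; apply: sub_sorted => i j /= /ltnW.
  exact: part_nth_mono.
have e : all_parts kappa = all_parts rho.
  apply: (sorted_eq _ _ (so kappa) (so rho) p) => [a b c /= h1 h2|a b /= /andP [h1 h2]].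
    exact: leq_trans h2 h1.
  by apply/eqP; rewrite eqn_leq h1 h2.
apply: val_inj; apply/ffunP => i; apply: val_inj => /=.
by rewrite -[LHS]/(part_nth kappa i) -[RHS]/(part_nth rho i) -!nth_all_parts e.
Qed.

Lemma intpart_of s : sumn s = d -> {kappa : intpart d | perm_eq (parts_of kappa) (nz_parts s)}.
Proof.
move=> sd.
pose t := sort geq (nz_parts s).
have pt : perm_eq t (nz_parts s) by rewrite /t perm_sort.
have st : sumn t = d by rewrite (perm_sumn pt) sumn_nz_parts.
have tp : all (leq 1) t by rewrite (perm_all _ pt) nz_parts_gt0.
have sz : (size t <= d)%N by rewrite -st size_le_sumn.
have tle i : (nth 0%N t i < d.+1)%N.
  rewrite ltnS -st; have [hi|hi] := ltnP i (size t); last by rewrite nth_default.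
  exact/le_sumn/mem_nth.
have ts : sorted geq t by apply: sort_sorted => a b; exact: leq_total.
pose k : {ffun 'I_d -> 'I_d.+1} := [ffun i : 'I_d => Ordinal (tle i)].
have mk : [seq nat_of_ord (k i) | i <- enum 'I_d] = t ++ nseq (d - size t) 0%N.
  apply: (@eq_from_nth _ 0%N).
    by rewrite size_map size_enum_ord size_cat size_nseq subnKC.
  rewrite size_map size_enum_ord => i hi.
  rewrite (nth_map (Ordinal hi)) ?size_enum_ord // (nth_ord_enum (Ordinal hi) (Ordinal hi)).
  rewrite ffunE /= nth_cat; case: ltnP => // h.
  by rewrite nth_nseq nth_default // if_same.
have kP : is_intpart k.
  apply/andP; split.
    apply/forallP => i; apply/forallP => j; apply/implyP => ij; rewrite !ffunE /=.
    have [hj|hj] := ltnP j (size t); last by rewrite nth_default.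
    have tr : transitive geq by move=> a b c h1 h2; exact: leq_trans h2 h1.
    have hi := leq_ltn_trans ij hj.
    by have := sorted_leq_nth tr leqnn 0%N ts; move=> H; apply: (H i j hi hj ij).
  apply/eqP; rewrite -[RHS]st.
  have -> : sumn t = sumn [seq nat_of_ord (k i) | i <- enum 'I_d].
    by rewrite mk sumn_cat sumn_nseq addn0.
  by rewrite sumnE big_map big_enum.
exists (Sub k kP); rewrite /parts_of.
have -> : [seq part_nth (Sub k kP : intpart d) i | i <- enum 'I_d] = t ++ nseq (d - size t) 0%N.
  by rewrite -mk; apply: eq_map => i; rewrite /part_nth SubK.
rewrite /nz_parts filter_cat (_ : filter _ (nseq _ _) = [::]) ?cats0.
  rewrite (_ : filter _ t = t) //; apply/all_filterP; apply: sub_all tp => x.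
  by rewrite lt0n.
by elim: (d - size t)%N.
Qed.

End IntegerPartitions.

Section ExponentialFormula.
Variables (C : numFieldType) (A : comAlgType C) (D : nat) (x : nat -> A).
Implicit Types (k : {ffun 'I_D -> nat}).

Definition cyc_weight k : nat := (\sum_(i < D) i.+1 * k i)%N.

Definition cyc_term k : A := \prod_(i < D) ((k i)`!%:R^-1 *: x i ^+ k i).

(** The coefficient of [t^d] in [exp (\sum_i x_i t^(i+1))]. *)
Definition cyc_sum (d : nat) : A :=
  boxsum D.+1 (fun k => if cyc_weight k == d then cyc_term k else 0).

Lemma cyc_weight_raise k i : cyc_weight (mt_raise k i 1) = (cyc_weight k + i.+1)%N.
Proof.
rewrite /cyc_weight (bigD1 i) // [in RHS](bigD1 i) //= ffunE eqxx mul1n mulnDr muln1.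
rewrite addnAC; congr (_ + _ + _)%N.
by apply: eq_bigr => j /negbTE ji; rewrite ffunE ji addn0.
Qed.

Lemma cyc_term_raise k i :
  (k i).+1%:R *: cyc_term (mt_raise k i 1) = x i * cyc_term k.
Proof.
rewrite /cyc_term (bigD1 i) // [in RHS](bigD1 i) //= ffunE eqxx mul1n addn1.
rewrite scalerAl mulrA; congr (_ * _); last first.
  by apply: eq_bigr => j /negbTE ji; rewrite ffunE ji mul0n addn0.
rewrite scalerA exprS -scalerAr; congr (_ *: _).
by rewrite factS natrM invfM mulrA divff ?mul1r // pnatr_eq0.
Qed.

(** [t d/dt exp(S) = (t dS/dt) exp(S)] for [S = \sum_i x_i t^(i+1)], at degree [d]. The bound on [d]
    ensures that the box contains all exponents of weight [d] and that all relevant variables are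
    present. *)
Lemma cyc_sum_rec d : (d <= D)%N ->
  d%:R *: cyc_sum d =
  \sum_(i < D | (i < d)%N) i.+1%:R *: (x i * cyc_sum (d - i.+1)).
Proof.
move=> dD.
pose T k : A := if cyc_weight k == d then cyc_term k else 0.
have big_k k i : (D.+1 <= k i)%N -> (k i)%:R *: T k = 0.
  move=> h; rewrite /T; case: eqP => [e|]; last by rewrite scaler0.
  have : (i.+1 * k i <= cyc_weight k)%N by rewrite /cyc_weight (bigD1 i) //= leq_addr.
  by nia.
transitivity (\sum_(i < D) i.+1%:R *: boxsum D.+1 (fun k => (k i)%:R *: T k)).
  rewrite /cyc_sum /boxsum scaler_sumr; under [RHS]eq_bigr do rewrite scaler_sumr.
  rewrite exchange_big; apply: eq_bigr => c _ /=.
  under eq_bigr do rewrite scalerA.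
  rewrite -scaler_suml /T; case: eqP => [{1}<-|]; last by rewrite !scaler0.
  by rewrite /cyc_weight natr_sum; congr (_ *: _); apply: eq_bigr => i _; rewrite natrM.
rewrite [RHS]big_mkcond; apply: eq_bigr => i _.
have -> : boxsum D.+1 (fun k => (k i)%:R *: T k)
   = boxsum D.+1 (fun k => if (1 <= k i)%N then (k i)%:R *: T k else 0).
  by apply: eq_boxsum => k _; case: (k i) => //; rewrite scale0r.
rewrite -boxsum_shift; last by move=> k; exact: big_k.
case: ltnP => id.
  congr (_ *: _); rewrite /boxsum mulr_sumr; apply: eq_bigr => c _.
  set k := [ffun _ => _]; rewrite /T cyc_weight_raise.
  have -> : (cyc_weight k == d - i.+1)%N = (cyc_weight k + i.+1 == d)%N.
    by rewrite -[RHS](eqn_add2r 0) addn0 -[LHS](eqn_add2r i.+1) subnK // addn0.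
  case: eqP => _; last by rewrite scaler0 mulr0.
  by rewrite [mt_raise _ _ _ _]ffunE eqxx mul1n addn1 cyc_term_raise.
rewrite /boxsum big1 ?scaler0 // => c _.
rewrite /T cyc_weight_raise; case: eqP => [e|]; last by rewrite scaler0.
by exfalso; lia.
Qed.

Lemma cyc_sum0 : cyc_sum 0 = 1.
Proof.
rewrite /cyc_sum /boxsum (bigD1 [ffun=> ord0]) //= big1 ?addr0.
  rewrite /cyc_weight big1 => [|i _]; last by rewrite !ffunE muln0.
  by rewrite eqxx /cyc_term big1 // => i _; rewrite !ffunE expr0 fact0 invr1 scale1r.
move=> k k0; case: eqP => // e; case/eqP: k0; apply/ffunP => i; apply: val_inj.
rewrite !ffunE /=; apply/eqP; move: e; rewrite /cyc_weight (bigD1 i) //= ffunE.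
by move/eqP; rewrite addn_eq0 muln_eq0 /= => /andP [].
Qed.

End ExponentialFormula.

Section CycleTypes.
Variables (C : numFieldType) (A : comAlgType C) (d : nat).

Lemma big_count_parts (B : comNzRingType) (s : seq nat) (f : nat -> B) :
  all (fun r => (0 < r <= d)%N) s ->
  \prod_(r <- s) f r = \prod_(i < d) f i.+1 ^+ count_mem i.+1 s.
Proof.
elim: s => [|r s IH] /=; first by rewrite big_nil big1 // => i _; rewrite expr0.
case/andP => /andP [r0 rd] /IH {}IH; rewrite big_cons IH.
have hr : (r.-1 < d)%N by rewrite prednK.
rewrite (bigD1 (Ordinal hr)) // [in RHS](bigD1 (Ordinal hr)) //= prednK // eqxx.
rewrite mulrA -exprS; congr (_ * _); apply: eq_bigr => i.
rewrite -val_eqE /= => ir; case: eqP => // e; move: ir.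
by rewrite e eqxx.
Qed.

Lemma parts_of_range (rho : intpart d) : all (fun r => (0 < r <= d)%N) (parts_of rho).
Proof.
apply/allP => r hr; apply/andP; split.
  by have /allP := nz_parts_gt0 (all_parts rho); apply.
by rewrite -[X in (_ <= X)%N](sumn_parts_of rho) le_sumn.
Qed.

Definition cycle_type (rho : intpart d) : {ffun 'I_d -> nat} :=
  [ffun i : 'I_d => count_mem i.+1 (parts_of rho)].

Lemma sumn_count (s : seq nat) : all (fun r => (0 < r <= d)%N) s ->
  sumn s = (\sum_(i < d) i.+1 * count_mem i.+1 s)%N.
Proof.
elim: s => [|r s IH] /=; first by rewrite big1 // => i _; rewrite muln0.
case/andP => /andP [r0 rd] /IH {}IH; rewrite IH.
have hr : (r.-1 < d)%N by rewrite prednK.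
under [RHS]eq_bigr do rewrite mulnDr.
rewrite [RHS]big_split /=; congr (_ + _)%N.
rewrite (bigD1 (Ordinal hr)) //= prednK // eqxx muln1 big1 ?addn0 // => i.
rewrite -val_eqE /= => ir; case: eqP => [e|]; last by rewrite muln0.
by move: ir; rewrite e eqxx.
Qed.

Lemma cyc_weight_cycle_type rho : cyc_weight (cycle_type rho) = d.
Proof.
rewrite -[RHS](sumn_parts_of rho) (sumn_count (parts_of_range rho)).
by apply: eq_bigr => i _; rewrite ffunE.
Qed.

Lemma cycle_type_inj : injective cycle_type.
Proof.
move=> rho rho' /ffunP h; apply: intpart_eqP; apply/allP => r _ /=.
have [/andP [r0 rd]|hr] := boolP (0 < r <= d)%N.
  have hr : (r.-1 < d)%N by rewrite prednK.
  by have := h (Ordinal hr); rewrite !ffunE /= prednK // => ->.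
have H (rho'' : intpart d) : count_mem r (parts_of rho'') = 0%N.
  apply/count_memPn; apply: contra hr => hr.
  by have /allP := parts_of_range rho''; apply.
by rewrite !H.
Qed.

Lemma cycle_type_surj (k : {ffun 'I_d -> nat}) : cyc_weight k = d ->
  exists rho, cycle_type rho = k.
Proof.
move=> hk.
pose s := flatten [seq nseq (k i) i.+1 | i : 'I_d <- enum 'I_d].
have cs (i : 'I_d) : count_mem i.+1 s = k i.
  rewrite /s count_flatten -map_comp sumnE big_map big_enum /= (bigD1 i) //=.
  rewrite count_nseq /= eqxx mul1n big1 ?addn0 // => j ji.
  by rewrite count_nseq /= eqSS val_eqE (negbTE ji).
have ra : all (fun r => (0 < r <= d)%N) s.
  apply/allP => r /flattenP [t /mapP [i _ ->]] /nseqP [-> _].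
  by rewrite /= ltn_ord.
have sd : sumn s = d.
  rewrite sumn_count // -[RHS]hk; apply: eq_bigr => i _.
  by rewrite cs.
have [rho hrho] := intpart_of sd; exists rho.
have nzs : nz_parts s = s.
  by apply/all_filterP; apply: sub_all ra => r /andP []; rewrite lt0n.
apply/ffunP => i; rewrite ffunE -cs.
by move: hrho; rewrite nzs => /seq.permP ->.
Qed.

(** Exponents of weight [d] are exactly the multiplicity vectors of partitions of [d]; their
    factorials, with the powers of [i + 1] from [x i], assemble into [zee]. *)
Lemma cyc_sum_intpart (f : nat -> A) (l : C) (x : nat -> A) :
  (forall i, x i = (l / i.+1%:R) *: f i.+1) ->
  cyc_sum d x d = \sum_(rho : intpart d)
    (l ^+ size (parts_of rho) / (zee rho)%:R) *: \prod_(r <- parts_of rho) f r.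
Proof.
move=> xE; rewrite /cyc_sum /boxsum -big_mkcond /=.
have bnd (rho : intpart d) i : (cycle_type rho i < d.+1)%N.
  rewrite ltnS -[X in (_ <= X)%N](cyc_weight_cycle_type rho) /cyc_weight (bigD1 i) //=.
  by rewrite mulSn -addnA leq_addr.
pose h (rho : intpart d) : {ffun 'I_d -> 'I_d.+1} := [ffun i => Ordinal (bnd rho i)].
have hv rho : [ffun i => val (h rho i)] = cycle_type rho.
  by apply/ffunP => i; rewrite !ffunE.
have hI : injective h.
  by move=> rho rho' e; apply: cycle_type_inj; rewrite -!hv e.
rewrite (reindex_omap h (fun k => [pick rho | h rho == k])) /=; last first.
  move=> k /eqP hk; case: pickP => [rho /= /eqP -> //|].
  have [rho hrho] := cycle_type_surj hk.
  move/(_ rho)/eqP; case; apply/ffunP => i; apply: val_inj.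
  by have := congr1 (fun g : {ffun 'I_d -> nat} => g i) hrho; rewrite -hv [LHS]ffunE [RHS]ffunE.
apply: eq_big => [rho|rho _].
  rewrite hv cyc_weight_cycle_type eqxx /=.
  by case: pickP => [rho' /= /eqP /hI -> //|/(_ rho)]; rewrite eqxx.
rewrite hv /cyc_term; have ra := parts_of_range rho.
rewrite (big_count_parts f ra).
under eq_bigr do rewrite xE exprZn scalerA.
rewrite scaler_prod; congr (_ *: _); last by apply: eq_bigr => i _; rewrite ffunE.
have -> : l ^+ size (parts_of rho) = \prod_(i < d) l ^+ cycle_type rho i.
  have := big_count_parts (fun=> l) ra; rewrite big_const_seq count_predT iter_mulr_1 => ->.
  by apply: eq_bigr => i _; rewrite ffunE.
rewrite /zee natr_prod big_add1 /= big_mkord -prodf_div; apply: eq_bigr => i _.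
rewrite !ffunE natrM natrX expr_div_n invfM mulrCA; congr (_ * _); exact: mulrC.
Qed.

End CycleTypes.

Section CauchyIdentity.
Variables (N : nat) (C : numFieldType) (lam : C).
Implicit Types (m : 'X_{1..N}) (z : 'I_N -> C).

Definition psum (r : nat) : {mpoly C[N]} := \sum_(j < N) 'X_j ^+ r.

Definition psum_prod (s : seq nat) : {mpoly C[N]} := \prod_(r <- s) psum r.

(** The part of degree [d] in [w] of [\prod_(j, k) (1 - z_k w_j)^(- lam)]. *)
Definition Kpol (d : nat) z : {mpoly C[N]} :=
  \sum_(m : 'X_{1..N < d.+1})
     ((mdeg m == d)%:R * \prod_j (gpol N lam (m j)).@[z]) *: 'X_[m].

Lemma mcoeff_Kpol d z m :
  (Kpol d z)@_m = (mdeg m == d)%:R * \prod_j (gpol N lam (m j)).@[z].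
Proof.
case: (ltnP (mdeg m) d.+1) => h.
  by rewrite /Kpol (@mcoeff_mpoly _ _
      (fun m => (mdeg m == d)%:R * \prod_j (gpol N lam (m j)).@[z])).
rewrite gtn_eqF // mul0r /Kpol raddf_sum big1 // => -[i /= hi] _.
rewrite mcoeffZ mcoeffX; case: (i =P m) => [e|]; last by rewrite mulr0.
by move: hi; rewrite e ltnS leqNgt h.
Qed.

Lemma zetaE (z : C) f r : zeta z f r = \sum_(i < r) z ^+ i.+1 * f (r - i.+1)%N.
Proof.
elim: r => [|r IH] /=; first by rewrite big_ord0.
rewrite IH big_ord_recl /= expr1 subSS subn0 mulrDr mulr_sumr addrC; congr (_ + _).
by apply: eq_bigr => i _; rewrite /bump /= add1n subSS mulrA -exprS.
Qed.

Lemma meval_psum r z : (psum r).@[z] = \sum_j z j ^+ r.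
Proof.
by rewrite rmorph_sum; apply: eq_bigr => j _; rewrite /= rmorphXn /= mevalXU.
Qed.

Lemma gpol_newton r z : r%:R * (gpol N lam r).@[z] =
  lam * \sum_(i < r) (psum i.+1).@[z] * (gpol N lam (r - i.+1)).@[z].
Proof.
rewrite euler_gpol_zeta; congr (_ * _).
under eq_bigr do rewrite zetaE.
rewrite exchange_big; apply: eq_bigr => i _ /=.
by rewrite meval_psum mulr_suml.
Qed.

Lemma mcoeff_psumM r p m :
  (psum r * p)@_m = \sum_(j < N) (if (r <= m j)%N then p@_(m - U_(j) *+ r) else 0).
Proof.
rewrite mulr_suml raddf_sum; apply: eq_bigr => j _ /=.
rewrite mpolyXn mcoeffXM; congr (if _ then _ else _).
apply/mnm_lepP/idP => [/(_ j)|h i]; first by rewrite mulmnE mnm1E eqxx mul1n.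
by rewrite mulmnE mnm1E; case: eqP => [<-|]; rewrite ?mul1n ?mul0n.
Qed.

(** The recursion of the exponential series of [lam \sum_r p_r(z) p_r(w) / r]. It is Newton's
    identity [gpol_newton] for each exponent [m j], summed over [j]. *)
Lemma Kpol_rec d z : d%:R *: Kpol d z =
  \sum_(i < d) (lam * (psum i.+1).@[z]) *: (psum i.+1 * Kpol (d - i.+1) z).
Proof.
apply/mpolyP => m; rewrite mcoeffZ [RHS]raddf_sum /=.
under [RHS]eq_bigr do rewrite mcoeffZ mcoeff_psumM.
have mB (i : nat) (j : 'I_N) : (i < m j)%N ->
   mdeg (m - U_(j) *+ i.+1)%MM = (mdeg m - i.+1)%N.
  move=> h; apply/eqP; rewrite -(eqn_add2r i.+1) subnK; last first.
    by rewrite (leq_trans h) // mdegE (bigD1 j) //= leq_addr.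
  rewrite -[X in (_ + X)%N](mul1n i.+1) -(mdeg1 j) -mdegMn -mdegD submK //.
  apply/mnm_lepP => k; rewrite mulmnE mnm1E; case: eqP => [<-|]; rewrite ?mul1n ?mul0n //.
rewrite mcoeff_Kpol; have [md|md] := eqVneq (mdeg m) d; last first.
  rewrite mul0r mulr0 big1 // => i _; rewrite big1 ?mulr0 // => j _.
  case: ltnP => // h; rewrite mcoeff_Kpol (mB _ _ h).
  rewrite (_ : _ == _ = false) ?mul0r //; apply/negbTE; apply: contra md => /eqP e.
  have : (m j <= mdeg m)%N by rewrite mdegE (bigD1 j) //= leq_addr.
  by have := ltn_ord i; move: e h; clear; lia.
rewrite mul1r -{1}md mdegE natr_sum mulr_suml.
have E (j : 'I_N) : (m j)%:R * \prod_(k < N) (gpol N lam (m k)).@[z] =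
  \sum_(i < d) (lam * (psum i.+1).@[z]) * (if (i < m j)%N then
     (Kpol (d - i.+1) z)@_(m - U_(j) *+ i.+1) else 0).
  rewrite (bigD1 j) //= mulrA gpol_newton.
  have mj : (m j <= d)%N by rewrite -md mdegE (bigD1 j) //= leq_addr.
  rewrite (big_ord_widen d (fun i => (psum i.+1).@[z] * (gpol N lam (m j - i.+1)).@[z])) //.
  rewrite big_mkcond mulr_sumr mulr_suml; apply: eq_bigr => i _ /=.
  case: ltnP => h; last by rewrite !mulr0 mul0r.
  rewrite mcoeff_Kpol (mB _ _ h) md eqxx mul1r [in RHS](bigD1 j) //=.
  rewrite mnmBE mulmnE mnm1E eqxx mul1n -!mulrA; do 3 congr (_ * _).
  apply: eq_bigr => k kj; rewrite mnmBE mulmnE mnm1E eq_sym (negbTE kj) mul0n subn0 //.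
rewrite (eq_bigr _ (fun j _ => E j)) exchange_big; apply: eq_bigr => i _ /=.
by rewrite -mulr_sumr.
Qed.

Lemma Kpol0 z : Kpol 0 z = 1.
Proof.
apply/mpolyP => m; rewrite mcoeff_Kpol mcoeff1 mdeg_eq0.
case: eqP => [->|]; last by rewrite mul0r.
by rewrite mul1r big1 // => j _; rewrite mnm0E gpol0 meval1.
Qed.

Lemma Kpol_cauchy d z : Kpol d z = \sum_(rho : intpart d)
  (lam ^+ size (parts_of rho) / (zee rho)%:R * (psum_prod (parts_of rho)).@[z])
    *: psum_prod (parts_of rho).
Proof.
pose f r := (psum r).@[z] *: psum r.
pose x i := (lam / i.+1%:R) *: f i.+1.
suff -> : Kpol d z = cyc_sum d x d.
  rewrite (@cyc_sum_intpart _ _ d f lam x) //; apply: eq_bigr => rho _.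
  rewrite /f scaler_prod scalerA; congr (_ *: _); congr (_ * _).
  by rewrite /psum_prod rmorph_prod.
suff H e : (e <= d)%N -> Kpol e z = cyc_sum d x e by exact: H.
have [k] := ubnP e; elim: k e => // k IH e; rewrite ltnS => ek ed.
case: e ek ed => [|e] ek ed; first by rewrite Kpol0 cyc_sum0.
have e0 : e.+1%:R != 0 :> C by rewrite pnatr_eq0.
apply: (scalerI e0); rewrite Kpol_rec cyc_sum_rec //.
rewrite (big_ord_widen d (fun i => (lam * (psum i.+1).@[z]) *: (psum i.+1 * Kpol (e.+1 - i.+1) z))) //.
apply: eq_bigr => i ie; rewrite IH; last 2 first.
- by rewrite subSS (leq_ltn_trans _ ek) // leq_subr.
- by rewrite (leq_trans (leq_subr _ _)).
rewrite /x /f scalerA -scalerAl scalerA; congr (_ *: _).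
by rewrite mulrA mulrCA divff ?pnatr_eq0 // mulr1.
Qed.

End CauchyIdentity.

(** * The coefficient functional *)

Section LeadingFunctional.
Variables (N : nat) (C : numFieldType) (lam : C).
Notation ZN := {ffun 'I_N -> int}.
Variables (nn : 'X_{1..N}) (a : mtuple N -> C).
Implicit Types (m : 'X_{1..N}) (mu nu : mtuple N) (z : 'I_N -> C).

Let n : ZN := zof nn.
Let d : nat := mdeg nn.

(** The value [0] at vectors with a negative entry agrees with the convention of [gz], which
    [coefz_Kpol] needs. *)
Definition coefz (q : {mpoly C[N]}) (v : ZN) : C :=
  if [forall j, 0 <= v j] then q@_([multinom `|v j|%N | j < N]) else 0.

(** Coefficient extraction in [w]: it turns the Cauchy kernel into the novel
    eigenfunction. *)
Definition Lfun (q : {mpoly C[N]}) : C :=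
  boxsum `|height n|.+1 (fun mu => a mu *
    boxsum `|height n|.+1 (fun nu => beta lam nu * coefz q (n + vecmu mu + vecmu nu))).

Lemma coefz_is_linear v : linear_for *%R (coefz^~ v).
Proof.
move=> c p q; rewrite /coefz; case: ifP => _; last by rewrite mulr0 addr0.
by rewrite mcoeffD mcoeffZ.
Qed.

Lemma Lfun_is_linear : linear_for *%R Lfun.
Proof.
move=> c p q; rewrite /Lfun /boxsum mulr_sumr -big_split; apply: eq_bigr => k _ /=.
rewrite mulrCA -mulrDr; congr (_ * _).
rewrite mulr_sumr -big_split; apply: eq_bigr => k' _ /=.
by rewrite coefz_is_linear mulrDr mulrCA.
Qed.
HB.instance Definition _ :=
  GRing.isLinear.Build C {mpoly C[N]} C _ Lfun Lfun_is_linear.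

Lemma sum_vecmu mu : \sum_j vecmu mu j = 0.
Proof.
under eq_bigr do rewrite vecmuE.
rewrite exchange_big big1 // => p _; rewrite -mulr_sumr.
have := sum_posroot (fun=> 1 : int) p; rewrite subrr => H.
rewrite (_ : \sum_j _ = 0) ?mulr0 // -[RHS]H; apply: eq_bigr => l _.
by rewrite intz.
Qed.

Lemma coefz_Kpol z (v : ZN) : \sum_j v j = d%:Z ->
  coefz (Kpol lam d z) v = (Gm lam v).@[z].
Proof.
move=> vd; rewrite /coefz; case: ifP => [/forallP h|/negbT/forallPn [j]]; last first.
  by rewrite -ltNge => /(Gm_lt0 lam) ->; rewrite meval0.
rewrite mcoeff_Kpol (_ : mdeg _ == d); last first.
  rewrite -(eqr_nat int) !natz -vd mdegE -[X in X == _]natz natr_sum; apply/eqP.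
  by apply: eq_bigr => j _; rewrite mnmE natz gez0_abs.
rewrite mul1r /Gm rmorph_prod; apply: eq_bigr => j _.
by rewrite mnmE /gz; have := h j; case: (v j).
Qed.

Lemma sum_n : \sum_j n j = d%:Z.
Proof.
by rewrite /d mdegE -[RHS]natz natr_sum; apply: eq_bigr => j _; rewrite ffunE natz.
Qed.

Lemma sum_n_vecmu mu nu : \sum_j (n + vecmu mu + vecmu nu) j = d%:Z.
Proof.
under eq_bigr do rewrite ffunE [X in X + _]ffunE.
by rewrite !big_split /= !sum_vecmu !addr0 sum_n.
Qed.

Lemma height_n_vecmu mu : height (n + vecmu mu) < `|height n|.+1%:Z.
Proof.
have [p _|no] := pickP (@predT (idx_pair N)).
  by rewrite raddfD /=; have := height_vecmu_le mu p; lia.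
rewrite (_ : vecmu mu = 0) ?addr0 /vecmu; first by lia.
by rewrite big1 // => p _; have := no p.
Qed.

Lemma meval_Phipol z : (Phipol lam n a).@[z] = Lfun (Kpol lam d z).
Proof.
rewrite /Phipol /Lfun /boxsum rmorph_sum; apply: eq_bigr => k _ /=.
rewrite mevalZ; congr (_ * _); rewrite meval_Ppol.
rewrite (Psi_widen _ (@f_bounded _ _ lam z) (height_n_vecmu _)).
by apply: eq_bigr => k' _; rewrite coefz_Kpol ?sum_n_vecmu.
Qed.

Lemma meval_Phipol_cauchy z : (Phipol lam n a).@[z] =
  \sum_(rho : intpart d) (lam ^+ size (parts_of rho) / (zee rho)%:R
     * (psum_prod N C (parts_of rho)).@[z]) * Lfun (psum_prod N C (parts_of rho)).
Proof.
rewrite meval_Phipol Kpol_cauchy linear_sum; apply: eq_bigr => rho _.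
by rewrite [LHS]linearZ.
Qed.

Lemma coefzX m (v : ZN) : coefz 'X_[m] v = (v == zof m)%:R.
Proof.
rewrite /coefz; case: ifP => [/forallP h|h].
  rewrite mcoeffX; congr (_ %:R); congr nat_of_bool; apply/eqP/eqP => [->|->].
    by apply/ffunP => j; rewrite ffunE mnmE gez0_abs.
  by apply/mnmP => j; rewrite mnmE ffunE.
case: eqP => // e; move/negP: h; case; apply/forallP => j.
by rewrite e ffunE.
Qed.

(** The functional sees only [n] plus sums of positive roots. Combined with the height and with the
    Euclidean norm, this controls the monomials that contribute. *)
Lemma Lfun_support m : Lfun 'X_[m] != 0 ->
  exists mu nu, zof m = n + vecmu mu + vecmu nu.
Proof.
pose B := `|height n|.+1.
pose v (k : {ffun idx_pair N -> 'I_B}) := vecmu [ffun i => val (k i)].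
have [/existsP [k /existsP [k' /eqP e]] _|/existsPn no] :=
    boolP [exists k, [exists k', zof m == n + v k + v k']].
  by exists [ffun i => val (k i)], [ffun i => val (k' i)].
case/eqP; rewrite /Lfun /boxsum big1 // => k _; rewrite big1 ?mulr0 // => k' _.
rewrite coefzX; case: eqP => [e|]; last by rewrite mulr0.
by have /existsPn /(_ k') := no k; rewrite eq_sym => /eqP.
Qed.

Lemma height_zof m : height (zof m) = (mheight m)%:Z.
Proof.
rewrite /height /mheight -[RHS]natz natr_sum; apply: eq_bigr => j _.
by rewrite ffunE natrM !natz.
Qed.

Lemma vecmu_height0 mu nu : height (vecmu mu + vecmu nu) = 0 -> mu = mt0 N /\ nu = mt0 N.
Proof.
rewrite raddfD /= => h.
have H p : mu p = 0%N /\ nu p = 0%N.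
  by have := height_vecmu_le mu p; have := height_vecmu_le nu p; move: h; clear; lia.
by split; apply/ffunP => p; rewrite ffunE; have [] := H p.
Qed.

Lemma Lfun_height m : Lfun 'X_[m] != 0 ->
  (mheight m <= mheight nn)%N /\ (mheight m = mheight nn -> m = nn).
Proof.
move=> /Lfun_support [mu [nu e]].
have := congr1 (@height N) e; rewrite -addrA raddfD /= /n !height_zof => h.
have le0 : height (vecmu mu + vecmu nu) <= 0.
  have [p _|no] := pickP (@predT (idx_pair N)).
    by rewrite raddfD /=; have := height_vecmu_le mu p; have := height_vecmu_le nu p; clear; lia.
  by rewrite /vecmu !big1 ?addr0 ?raddf0 // => p _; have := no p.
split; first by rewrite -lez_nat h gerDl.
move=> hm; have h0 : height (vecmu mu + vecmu nu) = 0 by apply: (addrI (mheight nn)%:Z); rewrite addr0 -h hm.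
have [m0 n0] := vecmu_height0 h0.
apply/mnmP => j; move: e; rewrite m0 n0.
have v0 : vecmu (mt0 N) = 0 by rewrite /vecmu big1 // => p _; rewrite ffunE.
by rewrite v0 !addr0 => /ffunP /(_ j); rewrite !ffunE => -[].
Qed.

Hypothesis a0 : a (mt0 N) = 1.

Lemma vecmu0 : vecmu (mt0 N) = 0.
Proof. by rewrite /vecmu big1 // => p _; rewrite ffunE. Qed.

Lemma Lfun_nn : Lfun 'X_[nn] = 1.
Proof.
rewrite /Lfun /boxsum.
pose k0 : {ffun idx_pair N -> 'I_(`|height n|.+1)} := [ffun=> ord0].
have k0E : [ffun i => val (k0 i)] = mt0 N by apply/ffunP => i; rewrite !ffunE.
have vk (k : {ffun idx_pair N -> 'I_(`|height n|.+1)}) :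
    [ffun i => val (k i)] = mt0 N -> k = k0.
  by move=> /ffunP h; apply/ffunP => i; apply: val_inj; have := h i; rewrite !ffunE.
have z0 (k k' : {ffun idx_pair N -> 'I_(`|height n|.+1)}) :
    n + vecmu [ffun i => val (k i)] + vecmu [ffun i => val (k' i)] = n ->
    k = k0 /\ k' = k0.
  rewrite -addrA => /eqP; rewrite -subr_eq0 addrAC subrr add0r => /eqP /(congr1 (@height N)).
  by rewrite raddf0 => /vecmu_height0 [/vk -> /vk ->].
rewrite (bigD1 k0) //= [X in _ + X]big1 ?addr0 => [|k kk]; last first.
  rewrite big1 ?mulr0 // => k' _; rewrite coefzX; case: eqP => [/z0 [e _]|]; last by rewrite mulr0.
  by rewrite e eqxx in kk.
rewrite (bigD1 k0) //= [X in _ + X]big1 ?addr0 => [|k kk]; last first.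
  rewrite coefzX; case: eqP => [/z0 [_ e]|]; last by rewrite mulr0.
  by rewrite e eqxx in kk.
rewrite k0E a0 mul1r coefzX vecmu0 !addr0 eqxx mulr1 /beta big1 // => p _.
by rewrite ffunE rising0.
Qed.

Hypothesis nn_sorted : forall j k : 'I_N, (j <= k)%N -> (nn k <= nn j)%N.

Lemma vecmu_dot mu : 0 <= \sum_j n j * vecmu mu j.
Proof.
under eq_bigr do rewrite vecmuE mulr_sumr.
rewrite exchange_big sumr_ge0 // => p _.
rewrite (_ : \sum_j _ = (mu p)%:Z * (n (pair_fst p) - n (pair_snd p))).
  rewrite mulr_ge0 // subr_ge0 /n !ffunE lez_nat nn_sorted // ltnW //.
  exact: ltn_pair.
rewrite -(sum_posroot n) mulr_sumr; apply: eq_bigr => j _.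
by rewrite mulrzz mulrCA.
Qed.

(** A rearrangement has the norm of [nn], whereas adding a sum of positive roots to the
    non-increasing vector [nn] strictly increases the norm unless the sum is zero ([vecmu_dot]). *)
Lemma Lfun_perm (s : 'S_N) : Lfun 'X_[[multinom nn (s i) | i < N]] != 0 ->
  [multinom nn (s i) | i < N] = nn.
Proof.
set m := [multinom _ | i < N] => /Lfun_support [mu [nu e]].
have sq : \sum_j zof m j ^+ 2 = \sum_j n j ^+ 2.
  rewrite [RHS](reindex_inj (@perm_inj _ s)) /=; apply: eq_bigr => j _.
  by rewrite /n !ffunE mnmE.
pose v := vecmu mu + vecmu nu.
have sqE : \sum_j zof m j ^+ 2 = \sum_j n j ^+ 2 + 2 * (\sum_j n j * vecmu mu j
    + \sum_j n j * vecmu nu j) + \sum_j v j ^+ 2.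
  rewrite -big_split mulr_sumr -!big_split; apply: eq_bigr => j _ /=.
  by rewrite e /v !ffunE; ring.
have v0 : \sum_j v j ^+ 2 = 0.
  have h1 := vecmu_dot mu; have h2 := vecmu_dot nu.
  have h3 : 0 <= \sum_j v j ^+ 2 by apply: sumr_ge0 => j _; exact: sqr_ge0.
  by move: h1 h2 h3 sq; rewrite sqE; clear; lia.
have vj j : v j = 0.
  apply/eqP; rewrite -sqrf_eq0; apply/eqP; move: j isT.
  by apply: (psumr_eq0P _ v0) => j _; exact: sqr_ge0.
apply/mnmP => j; have := congr1 (fun w : ZN => w j) e.
by rewrite -addrA -/v [RHS]ffunE vj addr0 /n !ffunE => -[].
Qed.

Section Nonvanishing.
Hypotheses (lam_gt0 : 0 < lam) (a_real : forall mu, a mu \is Num.real).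
Hypothesis Phi0 : forall z, (Phipol lam n a).@[z] = 0.
Variable S : ('I_N -> C) -> Prop.
Hypothesis Sd : zariski_dense S.

Lemma rising_real (s : C) k : s \is Num.real -> rising s k \is Num.real.
Proof.
move=> sr; rewrite /rising rpredM ?rpredV ?realn //.
by apply: rpred_prod => i _; rewrite rpredD // realn.
Qed.

Lemma Lfun_real q : (forall m, q@_m \is Num.real) -> Lfun q \is Num.real.
Proof.
move=> qr; rewrite /Lfun /boxsum; apply: rpred_sum => k _; rewrite rpredM //.
apply: rpred_sum => k' _; rewrite rpredM //.
  apply: rpred_prod => p _; apply: rising_real.
  by rewrite rpredN ger0_real // ltW.
by rewrite /coefz; case: ifP => // _; exact: real0.
Qed.

Lemma psum_prod_real s m : (psum_prod N C s)@_m \is Num.real.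
Proof.
move: m; apply/mpolyOverP; rewrite /psum_prod rpred_prod // => r _.
rewrite rpred_sum // => j _; rewrite rpredX // mpolyOverX //.
Qed.

(** Under [Phi0] the expansion [meval_Phipol_cauchy] is a vanishing combination of power sum
    products. Its coefficients contain the numbers [Lfun p_rho], with positive factors [c rho], and
    these numbers are real. *)
Lemma Lfun_psum_prod (rho : intpart d) : Lfun (psum_prod N C (parts_of rho)) = 0.
Proof.
pose c (rho : intpart d) : C := lam ^+ size (parts_of rho) / (zee rho)%:R.
have zee_gt0 (rho' : intpart d) : (0 < zee rho')%N.
  rewrite /zee big_nat_cond prodn_cond_gt0 // => i /andP [/andP [i0 _] _].
  by rewrite muln_gt0 expn_gt0 i0 fact_gt0.
have c_gt0 rho' : 0 < c rho' by rewrite /c divr_gt0 ?exprn_gt0 // ltr0n zee_gt0.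
have PE : \sum_(rho : intpart d) (c rho * Lfun (psum_prod N C (parts_of rho)))
     *: psum_prod N C (parts_of rho) = 0.
  apply: Sd => z _; rewrite -[RHS](Phi0 z) meval_Phipol_cauchy rmorph_sum.
  by apply: eq_bigr => rho' _; rewrite /= mevalZ mulrAC.
(* Applying the functional a second time, now in [z], turns the expansion into a sum of squares with
   positive weights. *)
have := congr1 Lfun PE; rewrite linear0 linear_sum => H.
have {}H : \sum_(rho : intpart d) c rho * Lfun (psum_prod N C (parts_of rho)) ^+ 2 = 0.
  rewrite -[RHS]H; apply: eq_bigr => rho' _.
  by rewrite [RHS]linearZ /= expr2 mulrA.
have Lr rho' : Lfun (psum_prod N C (parts_of rho')) \is Num.real.
  by apply: Lfun_real => m; exact: psum_prod_real.
have := psumr_eq0P _ H => /(_ _ rho isT) /eqP; rewrite mulf_eq0 gt_eqF //= sqrf_eq0.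
move/(_ _)/eqP; apply => i _; apply: mulr_ge0; first exact/ltW.
by rewrite -realEsqr.
Qed.

End Nonvanishing.

End LeadingFunctional.

(** * Power sums span the symmetric polynomials, and the novel eigenfunction is non-zero *)

Section MonomialRearrangement.
Variable N : nat.
Implicit Types (m : 'X_{1..N}) (f : {ffun 'I_N -> 'I_N}).

Definition exponents m : seq nat := [seq m j | j <- enum 'I_N].

Lemma sumn_exponents m : sumn (exponents m) = mdeg m.
Proof. by rewrite sumnE big_map big_enum mdegE. Qed.

Lemma perm_exponents m m' : perm_eq (nz_parts (exponents m)) (nz_parts (exponents m')) ->
  exists s : 'S_N, m' = [multinom m (s i) | i < N].
Proof.
move=> h.
have p : perm_eq [tuple m' i | i < N] [tuple m i | i < N].
  have -> : [tuple m' i | i < N] = exponents m' :> seq nat by [].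
  have -> : [tuple m i | i < N] = exponents m :> seq nat by [].
  rewrite perm_sym (perm_trans (perm_nz_parts _)) // perm_sym.
  rewrite (perm_trans (perm_nz_parts _)) // perm_sym.
  by rewrite !size_map (perm_size h) perm_cat2r.
have /tuple_permP [s hs] := p; exists s; apply/mnmP => i.
rewrite mnmE; have := congr1 (fun t => nth 0%N t i) hs.
by rewrite -!tnth_nth !tnth_mktuple.
Qed.

(** The exponent of [\prod_j z_(f j)^(m j)], a term in the expansion of [\prod_j p_(m j)]. *)
Definition push m f : 'X_{1..N} := (\sum_(j < N) U_(f j) *+ m j)%MM.

Lemma pushE m f i : push m f i = (\sum_(j < N | f j == i) m j)%N.
Proof.
rewrite /push mnm_sumE [RHS]big_mkcond; apply: eq_bigr => j _.
by rewrite mulmnE mnm1E; case: (f j == i); rewrite ?mul1n ?mul0n.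
Qed.

Lemma mdeg_push m f : mdeg (push m f) = mdeg m.
Proof.
rewrite /push mdeg_sum mdegE; apply: eq_bigr => j _.
by rewrite mdegMn mdeg1 mul1n.
Qed.

Lemma push_perm m f (s : 'S_N) : [multinom push m f (s i) | i < N] =
  push m [ffun j => (s^-1)%g (f j)].
Proof.
apply/mnmP => i; rewrite mnmE !pushE; apply: eq_bigl => j; rewrite ffunE.
by apply/eqP/eqP => [->|<-]; rewrite ?permK ?permKV.
Qed.

Definition msupport m : {set 'I_N} := [set j | m j != 0%N].

Lemma msupport_push m f : msupport (push m f) = [set f j | j in msupport m].
Proof.
apply/setP => i; rewrite inE pushE; apply/idP/imsetP => [|[j]].
  have [/existsP [j /andP [/eqP ji mj]] _|/existsPn no /eqP[]] :=
    boolP [exists j, (f j == i) && (m j != 0%N)]; last first.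
    by rewrite big1 // => j fj; have := no j; rewrite fj /= negbK => /eqP.
  by exists j; rewrite ?inE.
rewrite inE => mj ->; rewrite (bigD1 j) //=.
by rewrite addn_eq0 (negbTE mj).
Qed.

Lemma push_inj m f : {in msupport m &, injective f} ->
  exists s : 'S_N, push m f = [multinom m (s i) | i < N].
Proof.
move=> fi; apply: perm_exponents.
have nzE m' : nz_parts (exponents m') = [seq m' j | j <- enum (msupport m')].
  rewrite /nz_parts /exponents filter_map enumT; congr map.
  rewrite {1}/enum_mem -enumT; apply: eq_filter => j /=.
  by rewrite [RHS]inE.
rewrite !nzE msupport_push.
have -> : [seq m j | j <- enum (msupport m)]
        = [seq push m f i | i <- [seq f j | j <- enum (msupport m)]].
  rewrite -map_comp; apply/eq_in_map => j; rewrite mem_enum => hj /=.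
  rewrite pushE (bigD1 j) //= big1 ?addn0 // => i /andP [/eqP fij ij].
  have [//|mi] := eqVneq (m i) 0%N; move/eqP: ij; case; apply: fi => //.
  by rewrite inE.
apply: perm_map; apply: uniq_perm; rewrite ?enum_uniq //.
  by rewrite map_inj_in_uniq ?enum_uniq // => j j'; rewrite !mem_enum; exact: fi.
move=> i; rewrite mem_enum; apply/mapP/imsetP => -[j].
  by rewrite mem_enum => h ->; exists j.
by move=> h ->; exists j; rewrite ?mem_enum.
Qed.

End MonomialRearrangement.

Section PowerSumSpan.
Variables (N : nat) (C : numFieldType) (L : {linear {mpoly C[N]} -> C^o}).
Implicit Types (m : 'X_{1..N}).

Lemma psum_prod_nz s : exists c : C, psum_prod N C s = c *: psum_prod N C (nz_parts s).
Proof.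
elim: s => [|r s [c IH]]; first by exists 1; rewrite scale1r.
rewrite /psum_prod big_cons -/(psum_prod N C s) IH /=.
case: eqP => [->|_] /=.
  exists (N%:R * c); rewrite /psum.
  rewrite (eq_bigr (fun=> 1)) => [|j _]; last by rewrite expr0.
  by rewrite sumr_const card_ord [LHS]mulr_natl -[RHS]scalerA scaler_nat.
by exists c; rewrite big_cons scalerAr.
Qed.

Lemma prod_psum_push m : \prod_j psum N C (m j) =
  \sum_(f : {ffun 'I_N -> 'I_N}) 'X_[push m f].
Proof.
rewrite /psum bigA_distr_bigA; apply: eq_bigr => f _.
by rewrite /push -mprodXE; apply: eq_bigr => j _; rewrite mpolyXn.
Qed.

Definition sym_value m : C := \sum_(s : 'S_N) L 'X_[[multinom m (s i) | i < N]].

Lemma sym_value_perm m (s : 'S_N) : sym_value [multinom m (s i) | i < N] = sym_value m.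
Proof.
rewrite /sym_value [RHS](reindex_inj (mulIg s)) /=; apply: eq_bigr => t _.
congr (L 'X_[_]); apply/mnmP => i; rewrite !mnmE permM.
by [].
Qed.

(** In the expansion of [\prod_j p_(m j)], a map [f] that identifies two elements of the support of
    [m] yields a smaller support, where induction applies; the others yield rearrangements of [m]. A
    positive multiple of [sym_value m] is left. *)
Lemma sym_value_eq0 d : (forall rho : intpart d, L (psum_prod N C (parts_of rho)) = 0) ->
  forall m, mdeg m = d -> sym_value m = 0.
Proof.
move=> L0 m; have [k] := ubnP #|msupport m|; elim: k m => // k IH m; rewrite ltnS => mk md.
have H : \sum_(f : {ffun 'I_N -> 'I_N}) L 'X_[push m f] = 0.
  rewrite -linear_sum -prod_psum_push.
  have [rho hrho] : {rho : intpart d | perm_eq (parts_of rho) (nz_parts (exponents m))}.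
    by apply: intpart_of; rewrite sumn_exponents.
  have -> : \prod_j psum N C (m j) = psum_prod N C (exponents m).
    by rewrite /psum_prod big_map big_enum.
  have [c ->] := psum_prod_nz (exponents m).
  rewrite linearZ /= (_ : psum_prod N C (nz_parts (exponents m)) = psum_prod N C (parts_of rho)).
    by rewrite L0 scaler0.
  by rewrite /psum_prod -(perm_big _ hrho).
(* A permutation of the variables only permutes the maps [f], so the symmetrized sum vanishes
   too. *)
have {}H : \sum_(f : {ffun 'I_N -> 'I_N}) sym_value (push m f) = 0.
  rewrite /sym_value exchange_big big1 // => s _ /=.
  rewrite -[RHS]H; under eq_bigr do rewrite push_perm.
  pose c (t : 'S_N) (f : {ffun 'I_N -> 'I_N}) : {ffun 'I_N -> 'I_N} := [ffun j => t (f j)].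
  rewrite [RHS](reindex (c s^-1%g)) //=.
  by exists (c s) => f _; apply/ffunP => j; rewrite !ffunE ?permK ?permKV.
rewrite (bigID (fun f : {ffun 'I_N -> 'I_N} => #|[set f j | j in msupport m]| == #|msupport m|)) /= in H.
rewrite [X in _ + X]big1 ?addr0 in H; last first.
  move=> f hf; apply: IH; last by rewrite mdeg_push.
  rewrite msupport_push (leq_trans _ mk) // ltn_neqAle hf /=.
  exact: leq_imset_card.
rewrite (eq_bigr (fun=> sym_value m)) in H; last first.
  by move=> f /imset_injP /push_inj [s ->]; exact: sym_value_perm.
move: H; rewrite sumr_const => /eqP; rewrite mulrn_eq0 => /orP [/eqP h0|/eqP //].
(* The identity is among the maps counted, hence the multiplicity is not zero. *)
have : [ffun j => j] \in [pred f : {ffun 'I_N -> 'I_N} | #|[set f j | j in msupport m]| == #|msupport m|].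
  by rewrite inE; apply/imset_injP => j j' _ _; rewrite !ffunE.
by move/card0_eq: h0 => h0; have := h0 [ffun j => j]; rewrite !inE => ->.
Qed.

End PowerSumSpan.

Section NovelNonzero.
Variables (N : nat) (C : numFieldType) (lam : C) (nn : 'X_{1..N}) (a : mtuple N -> C).
Variable S : ('I_N -> C) -> Prop.
Hypothesis Sd : zariski_dense S.
Hypothesis nn_sorted : forall j k : 'I_N, (j <= k)%N -> (nn k <= nn j)%N.
Hypotheses (lam_gt0 : 0 < lam) (a_real : forall mu, a mu \is Num.real).
Hypothesis a0 : a (mt0 N) = 1.

(** Otherwise the functional kills all power sum products of this degree, hence [sym_value nn]. By
    [Lfun_perm] that value is the number of permutations fixing [nn], which is positive. *)
Lemma Phipol_neq0 : Phipol lam (zof nn) a != 0.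
Proof.
apply/eqP => P0.
have Phi0 z : (Phipol lam (zof nn) a).@[z] = 0 by rewrite P0 meval0.
have L0 := Lfun_psum_prod lam_gt0 a_real Phi0 Sd.
have := @sym_value_eq0 N C (Lfun lam nn a) _ L0 nn erefl.
rewrite /sym_value (eq_bigr (fun s : 'S_N => ([multinom nn (s i) | i < N] == nn)%:R)); last first.
  move=> s _; case: eqP => [->|ne]; first exact: Lfun_nn.
  have [//|h] := eqVneq (Lfun lam nn a 'X_[[multinom nn (s i) | i < N]]) 0.
  by case: ne; exact: Lfun_perm nn_sorted _ h.
rewrite -natr_sum => /eqP; rewrite pnatr_eq0 sum_nat_eq0 => /forallP /(_ 1%g) /=.
rewrite (_ : [multinom _ | i < N] = nn) ?eqxx //.
by apply/mnmP => i; rewrite mnmE perm1.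
Qed.

End NovelNonzero.

(** * Dominance order and heights of monomials *)

Section DominanceHeight.
Variable d : nat.
Implicit Types (kappa rho : intpart d).

(** The statistic usually written [n(kappa)]; it is the least height among the monomials of shape
    [kappa] ([pheight_le_mheight]). *)
Definition pheight kappa : nat := (\sum_(i < d) i * part_nth kappa i)%N.

Lemma pheightE kappa : pheight kappa =
  (\sum_(r < d) (d - \sum_(i < d | (i <= r)%N) part_nth kappa i))%N.
Proof.
transitivity (\sum_(r < d) \sum_(i < d | (r < i)%N) part_nth kappa i)%N.
  rewrite /pheight; under [RHS]eq_bigr do rewrite big_mkcond; rewrite exchange_big /=.
  apply: eq_bigr => i _; rewrite -big_mkcond /= -(big_ord_widen d (fun=> part_nth kappa i)).
    by rewrite sum_nat_const card_ord.
  exact: ltnW.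
apply: eq_bigr => r _; rewrite -[X in (X - _)%N](sum_part_nth kappa).
rewrite [X in (X - _)%N](bigID (fun i : 'I_d => (i <= r)%N)) /= addKn.
by apply: eq_bigl => i; rewrite ltnNge.
Qed.

Lemma partial_sum_le kappa r : (\sum_(i < d | (i <= r)%N) part_nth kappa i <= d)%N.
Proof.
rewrite -[X in (_ <= X)%N](sum_part_nth kappa) [X in (_ <= X)%N](bigID (fun i : 'I_d => (i <= r)%N)) /=.
exact: leq_addr.
Qed.

(** By [pheightE] the statistic adds up the defects of the partial sums from [d], so it decreases
    towards the dominating partition. If all partial sums agreed, the parts would agree one after
    the other. *)
Lemma dominated_pheight rho kappa : dominated rho kappa -> (pheight kappa < pheight rho)%N.
Proof.
case/andP => ne /forallP dom; rewrite !pheightE.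
have le r : (d - \sum_(i < d | (i <= r)%N) part_nth kappa i
      <= d - \sum_(i < d | (i <= r)%N) part_nth rho i)%N -> true by [].
rewrite ltn_neqAle; apply/andP; split; last by apply: leq_sum => r _; rewrite leq_sub2l.
apply: contra ne => /eqP e.
have e' (r : 'I_d) : (\sum_(i < d | (i <= r)%N) part_nth kappa i =
    \sum_(i < d | (i <= r)%N) part_nth rho i)%N.
  move: e; rewrite (bigD1 r) //= [RHS](bigD1 r) //=.
  set A := (\sum_(i < d | i != r) _)%N; set B := (\sum_(i < d | i != r) _)%N.
  have AB : (A <= B)%N by apply: leq_sum => i _; rewrite leq_sub2l.
  have := dom r; have := partial_sum_le kappa r; have := partial_sum_le rho r.
  move: A B AB (\sum_(i < d | (i <= r)%N) part_nth kappa i)%N (\sum_(i < d | (i <= r)%N) part_nth rho i)%N => A B AB x y.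
  by move: AB; clear; lia.
apply/eqP/val_inj/ffunP => i; apply: val_inj; apply/esym.
change (part_nth kappa i = part_nth rho i).
have [k] := ubnP (i : nat); elim: k i => // k IH i; rewrite ltnS => ik.
have := e' i; rewrite (bigD1 i) //= [X in _ = X -> _](bigD1 i) //=.
rewrite [X in (_ + X)%N = _ -> _](eq_bigr (fun j => part_nth rho j)); first by move/addIn.
move=> j /andP [ji jne]; apply: IH; rewrite (leq_trans _ ik) //.
by rewrite ltn_neqAle ji andbT.
Qed.

End DominanceHeight.

Section PartitionMonomials.
Variables (N d : nat).
Implicit Types (kappa rho : intpart d) (m t : 'X_{1..N}).

Lemma mheight_swap t (j k : 'I_N) : (j < k)%N -> (t j < t k)%N ->
  (mheight [multinom t (tperm j k i) | i < N] < mheight t)%N.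
Proof.
move=> jk tjk; have kj : k != j by rewrite -val_eqE /= gtn_eqF.
rewrite /mheight (bigD1 j) // (bigD1 k) //= [X in (_ < X)%N](bigD1 j) // (bigD1 k) //=.
rewrite !mnmE tpermL tpermR.
rewrite [X in (_ + (_ + X) < _)%N](eq_bigr (fun i : 'I_N => (i * t i)%N)).
  by rewrite !addnA ltn_add2r; move: jk tjk; clear; nia.
by move=> i /andP [h1 h2]; rewrite mnmE tpermD // eq_sym.
Qed.

Definition msorted t := forall j k : 'I_N, (j <= k)%N -> (t k <= t j)%N.

Lemma msorted_exponents t : msorted t -> sorted geq (exponents t).
Proof.
move=> ts; rewrite /exponents sorted_map.
have : sorted ltn (map val (enum 'I_N)) by rewrite val_enum_ord iota_ltn_sorted.
by rewrite sorted_map; apply: sub_sorted => i j /= /ltnW; exact: ts.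
Qed.

Lemma perm_exponents_perm t (s : 'S_N) : perm_eq (exponents [multinom t (s i) | i < N]) (exponents t).
Proof.
have -> : exponents [multinom t (s i) | i < N] = [seq t j | j <- [seq s i | i <- enum 'I_N]].
  by rewrite -map_comp; apply: eq_map => i /=; rewrite mnmE.
apply: perm_map; apply: uniq_perm; last 1 first.
2: by rewrite map_inj_uniq ?enum_uniq //; exact: perm_inj.
2: by rewrite enum_uniq.
move=> i; rewrite mem_enum; apply/mapP; exists (s^-1 i)%g; rewrite ?mem_enum //.
by rewrite permKV.
Qed.

(** A rearrangement of least height is sorted, by [mheight_swap], and two sorted rearrangements
    coincide. *)
Lemma mheight_rearrange t (s : 'S_N) : msorted t ->
  (mheight t <= mheight [multinom t (s i) | i < N])%N.
Proof.
move=> ts.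
pose s0 := [arg min_(s < 1%g : 'S_N) mheight [multinom t (s i) | i < N]].
have hmin (s' : 'S_N) : (mheight [multinom t (s0 i) | i < N] <= mheight [multinom t (s' i) | i < N])%N.
  by rewrite /s0; case: arg_minnP => // x _ h; exact: h.
suff e : [multinom t (s0 i) | i < N] = t by move: (hmin s); rewrite e.
have so : msorted [multinom t (s0 i) | i < N].
  move=> j k; rewrite leq_eqVlt => /orP [/eqP/val_inj -> //|jk].
  rewrite leqNgt; apply/negP => /(mheight_swap jk).
  rewrite ltnNge; case/negP; have := hmin (tperm j k * s0)%g.
  congr (_ <= mheight _)%N; apply/mnmP => i; rewrite !mnmE permM //.
have ee : exponents [multinom t (s0 i) | i < N] = exponents t.
  apply: (sorted_eq _ _ (msorted_exponents so) (msorted_exponents ts)).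
  - by move=> a b c /= h1 h2; exact: leq_trans h2 h1.
  - by move=> a b /= /andP [h1 h2]; apply/eqP; rewrite eqn_leq h1 h2.
  - exact: perm_exponents_perm.
apply/mnmP => i; have := congr1 (fun q => nth 0%N q i) ee.
by rewrite /exponents !(nth_map i) -?enumT ?size_enum_ord // -?enumT nth_ord_enum.
Qed.

Definition fits kappa := [forall i : 'I_d, (N <= i)%N ==> (part_nth kappa i == 0%N)].

Definition pmonomial kappa : 'X_{1..N} := [multinom nth 0%N (all_parts kappa) i | i < N].

Lemma pmonomial_sorted kappa : msorted (pmonomial kappa).
Proof.
move=> j k jk; rewrite !mnmE.
have [kd|kd] := ltnP k d; last by rewrite [X in (X <= _)%N]nth_default ?size_all_parts.
have jd := leq_ltn_trans jk kd.
rewrite (nth_all_parts kappa (Ordinal kd)) (nth_all_parts kappa (Ordinal jd)).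
exact: part_nth_mono.
Qed.

Lemma nz_parts_cat s s' : nz_parts (s ++ s') = nz_parts s ++ nz_parts s'.
Proof. exact: filter_cat. Qed.

Lemma nz_parts0 s : all (pred1 0%N) s -> nz_parts s = [::].
Proof. by elim: s => //= x s IH /andP [/eqP -> /IH]. Qed.

Lemma nz_parts_mkseq s K : (forall i, (K <= i)%N -> nth 0%N s i = 0%N) ->
  nz_parts [seq nth 0%N s i | i <- iota 0 K] = nz_parts s.
Proof.
elim: K s => [|K IH] s h.
  rewrite [RHS]nz_parts0 //; apply/allP => x /(nthP 0%N) [i _ <-].
  by rewrite /= h.
case: s h => [|x s] h.
  by apply: nz_parts0; apply/allP => x /mapP [i _ ->]; rewrite nth_nil.
have {}IH := IH s (fun i hi => h i.+1 hi).
rewrite /= -[1%N]/(1 + 0)%N iotaDl -map_comp.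
by rewrite -[RHS]/(nz_parts ([:: x] ++ s)) -[LHS]/(nz_parts ([:: x] ++ _)) !nz_parts_cat -IH.
Qed.

Lemma nz_pmonomial kappa : fits kappa -> nz_parts (exponents (pmonomial kappa)) = parts_of kappa.
Proof.
move=> /forallP fk.
have -> : exponents (pmonomial kappa) = [seq nth 0%N (all_parts kappa) i | i <- iota 0 N].
  rewrite -val_enum_ord -map_comp; apply: eq_map => i.
  by rewrite /= mnmE.
rewrite nz_parts_mkseq // => i Ni.
have [id|id] := ltnP i d; last by rewrite nth_default ?size_all_parts.
rewrite (nth_all_parts kappa (Ordinal id)); apply/eqP.
by have /implyP := fk (Ordinal id); apply.
Qed.

Lemma mheight_pmonomial kappa : fits kappa -> mheight (pmonomial kappa) = pheight kappa.
Proof.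
move=> /forallP fk; rewrite /mheight /pheight.
pose g i := (i * nth 0%N (all_parts kappa) i)%N.
have e1 : (\sum_(j < N) j * pmonomial kappa j = \sum_(j < maxn N d) g j)%N.
  rewrite (eq_bigr (fun j : 'I_N => g j)) => [|j _]; last by rewrite /g mnmE.
  rewrite (big_ord_widen _ g (leq_maxl N d)) [RHS](bigID (fun i : 'I_(maxn N d) => (i < N)%N)) /=.
  rewrite [X in (_ + X)%N]big1 ?addn0 //.
  move=> i; rewrite -leqNgt => Ni; rewrite /g.
  have [id|id] := ltnP i d; last by rewrite nth_default ?size_all_parts // muln0.
  rewrite (nth_all_parts kappa (Ordinal id)).
  by have /implyP /(_ Ni) /eqP -> := fk (Ordinal id); rewrite muln0.
have e2 : (\sum_(j < d) j * part_nth kappa j = \sum_(j < maxn N d) g j)%N.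
  rewrite (eq_bigr (fun j : 'I_d => g j)) => [|j _]; last by rewrite /g nth_all_parts.
  rewrite (big_ord_widen _ g (leq_maxr N d)) [RHS](bigID (fun i : 'I_(maxn N d) => (i < d)%N)) /=.
  rewrite [X in (_ + X)%N]big1 ?addn0 //.
  by move=> i; rewrite -leqNgt => di; rewrite /g nth_default ?size_all_parts // muln0.
by rewrite e1 e2.
Qed.

Lemma monomial_fits m kappa : perm_eq (nz_parts (exponents m)) (parts_of kappa) -> fits kappa.
Proof.
move=> h; apply/forallP => i; apply/implyP => Ni; apply/negPn/negP => ki.
have : (size (parts_of kappa) <= N)%N.
  rewrite -(perm_size h) size_filter (leq_trans (count_size _ _)) //.
  by rewrite size_map size_enum_ord.
rewrite leqNgt => /negP; apply; apply: (@leq_trans i.+1); first by rewrite ltnS.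
rewrite /parts_of size_filter count_map -size_filter.
rewrite -[X in (X <= _)%N](size_iota 0) -[X in (_ <= X)%N](size_map val).
apply: uniq_leq_size; first exact: iota_uniq.
move=> j; rewrite mem_iota add0n ltnS /= => ji.
have jd := leq_ltn_trans ji (ltn_ord i).
apply/mapP; exists (Ordinal jd) => //; rewrite mem_filter mem_enum andbT /=.
rewrite -lt0n (leq_trans _ (part_nth_mono kappa (ji : (Ordinal jd <= i)%N))) //.
by rewrite lt0n.
Qed.

(** The first [N] parts of [rho] already exhaust [d]; by dominance so do those of [kappa], which
    leaves nothing for later parts. *)
Lemma fits_dominated rho kappa : dominated rho kappa -> fits rho -> fits kappa.
Proof.
case/andP => _ /forallP dom /forallP fr; apply/forallP => i; apply/implyP => Ni.
case: (posnP N) => [N0|N0].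
  have r0 j : part_nth rho j = 0%N.
    by have /implyP := fr j; rewrite N0 => /(_ isT) /eqP.
  have := sum_part_nth rho; rewrite big1 // => d0.
  by have := ltn_ord i; rewrite -[X in (_ < X)%N]d0.
have hr : (N.-1 < d)%N by rewrite (leq_ltn_trans _ (leq_ltn_trans Ni (ltn_ord i))) // leq_pred.
have full : (\sum_(j < d | (j <= N.-1)%N) part_nth rho j = d)%N.
  rewrite -[RHS](sum_part_nth rho) [RHS](bigID (fun j : 'I_d => (j <= N.-1)%N)) /=.
  rewrite [X in (_ + X)%N]big1 ?addn0 // => j; rewrite -ltnNge prednK // => Nj.
  by have /implyP /(_ Nj) /eqP := fr j.
have := dom (Ordinal hr); rewrite /= full => hk.
have := sum_part_nth kappa; rewrite (bigID (fun j : 'I_d => (j <= N.-1)%N)) /=.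
rewrite [X in (_ + X)%N](bigD1 i) /=; last by rewrite -ltnNge prednK.
move: hk; set A := (\sum_(_ < _ | _) _)%N; set B := (\sum_(_ < _ | _) _)%N.
by clear; lia.
Qed.

Lemma pheight_le_mheight m kappa : perm_eq (nz_parts (exponents m)) (parts_of kappa) ->
  (pheight kappa <= mheight m)%N.
Proof.
move=> h; have fk := monomial_fits h.
have [s ->] : exists s : 'S_N, m = [multinom pmonomial kappa (s i) | i < N].
  by apply: perm_exponents; rewrite nz_pmonomial // perm_sym.
by rewrite -mheight_pmonomial // mheight_rearrange //; exact: pmonomial_sorted.
Qed.

Lemma msorted_pmonomial m kappa : msorted m ->
  perm_eq (nz_parts (exponents m)) (parts_of kappa) -> mheight m = pheight kappa.
Proof.
move=> ms h; apply/eqP; rewrite eqn_leq pheight_le_mheight // andbT.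
have fk := monomial_fits h.
have [s ms'] : exists s : 'S_N, pmonomial kappa = [multinom m (s i) | i < N].
  by apply: perm_exponents; rewrite nz_pmonomial.
by rewrite -mheight_pmonomial // ms' mheight_rearrange.
Qed.

End PartitionMonomials.

Import reals complex.

(** * Jack polynomials and the expansion of the Cauchy kernel *)

Section JackPolynomials.
Local Open Scope complex_scope.
Variables (R : realType) (lam : R).
Hypothesis lam_gt0 : 0 < lam.
(** Supplied later by [zariski_dense_full], from Fourier analysis on the torus. All [M] occur
    because Jack identities hold in every number of variables. *)
Hypothesis full_dense : forall M, @zariski_dense M R[i] (fun _ => True).

Section MonomialPolynomials.
Variables (M d : nat).
Implicit Types (kappa rho : intpart d).

Definition msympol kappa : {mpoly R[i][M]} :=
  \sum_(beta : {ffun 'I_M -> 'I_d.+1}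
        | perm_eq (nz_parts [seq nat_of_ord (beta j) | j <- enum 'I_M])
                  (parts_of kappa)) 'X_[[multinom nat_of_ord (beta j) | j < M]].

Lemma meval_msympol kappa z : (msympol kappa).@[z] = monomial_sym kappa z.
Proof.
rewrite rmorph_sum; apply: eq_bigr => b _; rewrite /= mevalX.
by apply: eq_bigr => j _; rewrite mnmE.
Qed.

Lemma mcoeff_msympol kappa m :
  (msympol kappa)@_m = (perm_eq (nz_parts (exponents m)) (parts_of kappa))%:R.
Proof.
rewrite raddf_sum /=.
have expE (b : {ffun 'I_M -> 'I_d.+1}) :
    exponents [multinom nat_of_ord (b j) | j < M] = [seq nat_of_ord (b j) | j <- enum 'I_M].
  by apply: eq_map => j; rewrite mnmE.
case: (boolP (perm_eq _ _)) => h; last first.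
  rewrite big1 // => b hb; rewrite mcoeffX; case: eqP => // e.
  by case/negP: h; rewrite -e expE.
have mj j : (m j < d.+1)%N.
  rewrite ltnS -[X in (_ <= X)%N](sumn_parts_of kappa) -(perm_sumn h) sumn_nz_parts.
  by rewrite sumn_exponents mdegE (bigD1 j) //= leq_addr.
pose b0 : {ffun 'I_M -> 'I_d.+1} := [ffun j => Ordinal (mj j)].
have b0E : [multinom nat_of_ord (b0 j) | j < M] = m.
  by apply/mnmP => j; rewrite mnmE ffunE.
rewrite (bigD1 b0) /=; last by rewrite -expE b0E.
rewrite mcoeffX b0E eqxx big1 ?addr0 // => b /andP [_ bb].
rewrite mcoeffX; case: eqP => // e; case/eqP: bb; apply/ffunP => j; apply: val_inj.
by rewrite ffunE /= -e mnmE.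
Qed.

Definition jackpol (F : intpart d -> R) : {mpoly R[i][M]} :=
  \sum_rho (F rho)%:C *: psum_prod M R[i] (parts_of rho).

Lemma meval_jackpol F z : (jackpol F).@[z] = symfun_eval F z.
Proof.
rewrite rmorph_sum; apply: eq_bigr => rho _; rewrite /= mevalZ; congr (_ * _).
by rewrite /psum_prod rmorph_prod; apply: eq_bigr => r _; rewrite /= meval_psum.
Qed.

End MonomialPolynomials.

Variables (d : nat) (P : intpart d -> intpart d -> R).
Hypothesis jackP : is_jack_family lam^-1 P.
Implicit Types (kappa rho : intpart d).

(** Identities of values become identities of polynomials by density, with coefficients [u] common
    to all numbers of variables. *)
Lemma jackpol_triangular kappa : exists u : intpart d -> R, forall M,
  jackpol M (P kappa) = msympol M kappa
    + \sum_(rho | dominated rho kappa) (u rho)%:C *: msympol M rho.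
Proof.
have [u hu] := jackP.1 kappa; exists u => M; apply/eqP; rewrite -subr_eq0; apply/eqP.
apply: full_dense => z _; rewrite mevalB meval_jackpol hu mevalD meval_msympol rmorph_sum /=.
apply/eqP; rewrite subr_eq0; apply/eqP; congr (_ + _); apply: eq_bigr => rho _.
by rewrite mevalZ meval_msympol.
Qed.

Lemma dominated_neq kappa rho : dominated rho kappa -> rho != kappa.
Proof. by case/andP. Qed.

Lemma mcoeff_msympol_pmonomial M kappa rho : fits M rho ->
  (msympol M kappa)@_(pmonomial M rho) = (kappa == rho)%:R.
Proof.
move=> fr; rewrite mcoeff_msympol nz_pmonomial //; congr (_ %:R); congr nat_of_bool.
by apply/idP/eqP => [/intpart_eqP ->|->].
Qed.

Lemma jackpol_coeff kappa M : fits M kappa -> (jackpol M (P kappa))@_(pmonomial M kappa) = 1.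
Proof.
move=> fk; have [u ->] := jackpol_triangular kappa.
rewrite mcoeffD mcoeff_msympol_pmonomial // eqxx raddf_sum big1 ?addr0 // => rho hr.
by rewrite /= mcoeffZ mcoeff_msympol_pmonomial // (negbTE (dominated_neq hr)) mulr0.
Qed.

Lemma jackpol_coeff_dominated kappa rho M : fits M rho -> rho != kappa ->
  (jackpol M (P kappa))@_(pmonomial M rho) != 0 -> dominated rho kappa.
Proof.
rewrite eq_sym => fr /negbTE rk; have [u ->] := jackpol_triangular kappa.
rewrite mcoeffD mcoeff_msympol_pmonomial // rk add0r raddf_sum /=.
apply: contraR => nd; rewrite big1 // => rho' hr.
rewrite /= mcoeffZ mcoeff_msympol_pmonomial //; case: eqP => [e|]; last by rewrite mulr0.
by move: nd; rewrite -e hr.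
Qed.

Lemma fits_self kappa : fits d kappa.
Proof. by apply/forallP => i; apply/implyP; rewrite leqNgt ltn_ord. Qed.

(** Monomial symmetric polynomials with more than [M] parts vanish, and partitions dominated by
    [kappa] have at least as many parts. *)
Lemma jackpol_fits M kappa : ~~ fits M kappa -> jackpol M (P kappa) = 0.
Proof.
move=> nf; have m0 rho : ~~ fits M rho -> msympol M rho = 0.
  move=> h; apply/mpolyP => m; rewrite mcoeff_msympol mcoeff0.
  by case: (boolP (perm_eq _ _)) => // /monomial_fits; rewrite (negbTE h).
have [u ->] := jackpol_triangular kappa.
rewrite m0 // add0r big1 // => rho hr; rewrite m0 ?scaler0 //.
by apply: contra nf => fr; exact: fits_dominated hr fr.
Qed.

Let Z rho : R := (zee rho)%:R * lam^-1 ^+ size (parts_of rho).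
Let D kappa : R := \sum_rho P kappa rho ^+ 2 * Z rho.

Lemma zee_gt0 rho : (0 < zee rho)%N.
Proof.
rewrite /zee big_nat_cond prodn_cond_gt0 // => i /andP [/andP [i0 _] _].
by rewrite muln_gt0 expn_gt0 i0 fact_gt0.
Qed.

Lemma Z_gt0 rho : 0 < Z rho.
Proof. by rewrite mulr_gt0 ?ltr0n ?zee_gt0 // exprn_gt0 // invr_gt0. Qed.

(** [D kappa] is the squared norm of [P kappa]. In [d] variables the leading coefficient [1]
    prevents the power sum coefficients from all being zero. *)
Lemma D_gt0 kappa : 0 < D kappa.
Proof.
rewrite lt_neqAle sumr_ge0 => [|rho _]; last first.
  by rewrite mulr_ge0 ?sqr_ge0 // ltW // Z_gt0.
rewrite andbT eq_sym; apply/eqP => D0.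
have P0 rho : P kappa rho = 0.
  have := psumr_eq0P _ D0 => /(_ _ rho isT) /eqP.
  rewrite mulf_eq0 (gt_eqF (Z_gt0 _)) orbF sqrf_eq0 => /(_ _)/eqP; apply => i _.
  by rewrite mulr_ge0 ?sqr_ge0 // ltW // Z_gt0.
have := jackpol_coeff (fits_self kappa).
rewrite /jackpol big1 ?mcoeff0 => [|rho _]; last by rewrite P0 scale0r.
by move/eqP; rewrite eq_sym oner_eq0.
Qed.

(** Orthogonality gives a right inverse of the matrix of power sum coefficients; the matrix is
    square, so this is also a left inverse, which is the completeness relation. *)
Lemma jack_dual rho rho' :
  \sum_kappa P kappa rho * P kappa rho' / D kappa = (rho == rho')%:R / Z rho.
Proof.
pose n := #|intpart d|; pose ev (i : 'I_n) : intpart d := enum_val i.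
pose A : 'M[R]_n := \matrix_(i, j) P (ev i) (ev j).
pose B : 'M[R]_n := \matrix_(j, i) (Z (ev j) * P (ev i) (ev j) / D (ev i)).
have big_ev (F : intpart d -> R) : \sum_i F (ev i) = \sum_kappa F kappa.
  by rewrite [RHS](reindex ev) //=; exact: onW_bij (enum_val_bij _).
have AB : A *m B = 1%:M.
  apply/matrixP => i k; rewrite !mxE.
  under eq_bigr do rewrite !mxE.
  rewrite (big_ev (fun rho => P (ev i) rho * (Z rho * P (ev k) rho / D (ev k)))).
  have -> : \sum_rho P (ev i) rho * (Z rho * P (ev k) rho / D (ev k))
     = jack_scalar lam^-1 (P (ev i)) (P (ev k)) / D (ev k).
    rewrite /jack_scalar mulr_suml; apply: eq_bigr => r _; rewrite /Z.
    by rewrite !mulrA; congr (_ / _); ring.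
  have [->|ik] := eqVneq i k.
    have -> : jack_scalar lam^-1 (P (ev k)) (P (ev k)) = D (ev k).
      by apply: eq_bigr => r _; rewrite /Z expr2 !mulrA.
    by rewrite divff // gt_eqF // D_gt0.
  rewrite jackP.2 ?mul0r //; apply: contra ik => /eqP h; apply/eqP.
  exact: enum_val_inj h.
have := mulmx1C AB => /matrixP /(_ (enum_rank rho) (enum_rank rho')).
rewrite !mxE; under eq_bigr do rewrite !mxE /ev !enum_rankK.
rewrite (big_ev (fun k => Z rho * P k rho / D k * P k rho')) => H.
have Z0 : Z rho != 0 by rewrite gt_eqF // Z_gt0.
apply: (mulfI Z0); rewrite mulrCA divff // mulr1 mulr_sumr.
have -> : (rho == rho')%:R = (enum_rank rho == enum_rank rho')%:R :> R.
  by rewrite (inj_eq enum_rank_inj).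
by rewrite -H; apply: eq_bigr => k _; ring.
Qed.

(** Completeness replaces the diagonal expansion in power sums by a diagonal one in the orthogonal
    basis. *)
Lemma Kpol_jack N (z : 'I_N -> R[i]) : Kpol lam%:C d z =
  \sum_kappa ((D kappa)^-1%:C * (jackpol N (P kappa)).@[z]) *: jackpol N (P kappa).
Proof.
rewrite Kpol_cauchy.
transitivity (\sum_rho \sum_rho' \sum_kappa ((P kappa rho * P kappa rho' / D kappa)%:C
     * (psum_prod N R[i] (parts_of rho)).@[z]) *: psum_prod N R[i] (parts_of rho')).
  apply: eq_bigr => rho _; rewrite (bigD1 rho) //= [X in _ + X]big1 ?addr0.
    rewrite -scaler_suml -mulr_suml -rmorph_sum jack_dual eqxx /Z.
    congr ((_ * _) *: _); rewrite div1r invfM exprVn invrK mulrC.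
    by rewrite rmorphM fmorphV rmorphXn rmorph_nat.
  move=> rho' hr; rewrite -scaler_suml -mulr_suml -rmorph_sum jack_dual.
  by rewrite eq_sym (negbTE hr) mul0r rmorph0 mul0r scale0r.
rewrite exchange_big /=; under eq_bigr do rewrite exchange_big /=.
rewrite exchange_big /=; apply: eq_bigr => kappa _.
rewrite {2}/jackpol scaler_sumr; apply: eq_bigr => rho' _.
rewrite scalerA {1}/jackpol rmorph_sum /= mulr_sumr mulr_suml scaler_suml.
apply: eq_bigr => rho _; congr (_ *: _).
by rewrite mevalZ !rmorphM /=; ring.
Qed.

End JackPolynomials.

Section NovelIsJack.
Local Open Scope complex_scope.
Variables (R : realType) (lam : R) (N : nat).
Hypothesis lam_gt0 : 0 < lam.
Hypothesis full_dense : forall M, @zariski_dense M R[i] (fun _ => True).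
Variables (nn : 'X_{1..N}) (a : mtuple N -> R[i]).
Hypothesis nn_sorted : forall j k : 'I_N, (j <= k)%N -> (nn k <= nn j)%N.
Hypothesis a0 : a (mt0 N) = 1.

Let d := mdeg nn.
Implicit Types (kappa rho : intpart d).

Variables (P : intpart d -> intpart d -> R).
Hypothesis jackP : is_jack_family lam^-1 P.
Variable kn : intpart d.
Hypothesis knP : perm_eq (parts_of kn) (nz_parts (exponents nn)).

Let Phi := Phipol lam%:C (zof nn) a.
Let L := Lfun lam%:C nn a.

Hypothesis Phi_leading : forall m, Phi@_m != 0 -> m != nn -> (mheight nn < mheight m)%N.

Lemma pheight_kn : mheight nn = pheight kn.
Proof. by apply: msorted_pmonomial => //; rewrite perm_sym. Qed.

Lemma L_msympol rho : L (msympol R N rho) != 0 -> rho = kn \/ (pheight rho < pheight kn)%N.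
Proof.
move=> h.
have [m [hm Lm]] : exists m, perm_eq (nz_parts (exponents m)) (parts_of rho) /\ L 'X_[m] != 0.
  pose X (b : {ffun 'I_N -> 'I_d.+1}) : 'X_{1..N} := [multinom nat_of_ord (b j) | j < N].
  have expE b : exponents (X b) = [seq nat_of_ord (b j) | j <- enum 'I_N].
    by apply: eq_map => j; rewrite mnmE.
  have [/existsP [b /andP [h1 h2]]|/existsPn no] :=
      boolP [exists b, (perm_eq (nz_parts (exponents (X b))) (parts_of rho)) && (L 'X_[X b] != 0)].
    by exists (X b).
  case/eqP: h; rewrite /msympol [LHS]linear_sum big1 // => b hb.
  have := no b; rewrite expE hb /= negbK => /eqP; exact.
have [h1 h2] := Lfun_height Lm.
have h3 := pheight_le_mheight hm.
move: h1; rewrite pheight_kn leq_eqVlt => /orP [/eqP e|h1]; last first.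
  by right; exact: leq_ltn_trans h1.
left; apply: intpart_eqP; rewrite -(perm_sym (parts_of kn)).
have em : m = nn by apply: h2; rewrite e pheight_kn.
by move: hm; rewrite em => hm; apply: perm_trans hm.
Qed.

(** Among the rearrangements of [nn] in this sum, the functional sees only [nn] itself, by
    [Lfun_perm]. *)
Lemma L_msympol_kn : L (msympol R N kn) = 1.
Proof.
have knN := nn_sorted.
pose b0 : {ffun 'I_N -> 'I_d.+1} := [ffun j => inord (nn j)].
have b0E : [multinom nat_of_ord (b0 j) | j < N] = nn.
  apply/mnmP => j; rewrite mnmE ffunE inordK // ltnS /d mdegE (bigD1 j) //=.
  exact: leq_addr.
have expE (b : {ffun 'I_N -> 'I_d.+1}) :
    exponents [multinom nat_of_ord (b j) | j < N] = [seq nat_of_ord (b j) | j <- enum 'I_N].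
  by apply: eq_map => j; rewrite mnmE.
rewrite /msympol [LHS]linear_sum (bigD1 b0) /=; last by rewrite -expE b0E perm_sym.
rewrite b0E Lfun_nn // big1 ?addr0 // => b /andP [hb bb].
apply/eqP/negPn/negP => h.
have [s hs] : exists s : 'S_N, [multinom nat_of_ord (b j) | j < N] = [multinom nn (s i) | i < N].
  apply: perm_exponents; rewrite expE perm_sym; apply: perm_trans hb _.
  exact: knP.
move: h; rewrite hs => /(Lfun_perm nn_sorted); rewrite -hs => e.
case/eqP: bb; apply/ffunP => j; apply: val_inj => /=.
have := congr1 (fun m : 'X_{1..N} => m j) e; rewrite -[in RHS]b0E !mnmE //.
Qed.

Let D kappa : R := \sum_rho P kappa rho ^+ 2 * ((zee rho)%:R * lam^-1 ^+ size (parts_of rho)).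
Let f kappa : R[i] := (D kappa)^-1%:C * L (jackpol N (P kappa)).

Lemma Phi_jack : Phi = \sum_kappa f kappa *: jackpol N (P kappa).
Proof.
apply/eqP; rewrite -subr_eq0; apply/eqP; apply: full_dense => z _.
rewrite mevalB meval_Phipol (Kpol_jack lam_gt0 full_dense jackP) linear_sum rmorph_sum /=.
apply/eqP; rewrite subr_eq0; apply/eqP; apply: eq_bigr => kappa _.
by rewrite [LHS]linearZ /= mevalZ /f /L mulrAC.
Qed.

(** Besides [kappa], its Jack polynomial contains only dominated partitions, of larger [pheight],
    while the functional sees only [kn] and partitions of smaller [pheight]. *)
Lemma f_neq0 kappa : f kappa != 0 -> kappa = kn \/ (pheight kappa < pheight kn)%N.
Proof.
move=> h.
have Lk : L (jackpol N (P kappa)) != 0 by apply: contraNneq h => e; rewrite /f e mulr0.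
have [u uE] := jackpol_triangular full_dense jackP kappa.
have [h0|/L_msympol //] := eqVneq (L (msympol R N kappa)) 0.
right; move: Lk; rewrite uE [L _]linearD /= -/L h0 add0r => Lk.
have [/existsP [rho /andP [dr Lr]]|/existsPn no] :=
    boolP [exists rho, dominated rho kappa && (L (msympol R N rho) != 0)].
  have hr := dominated_pheight dr.
  case: (L_msympol Lr) => [e|h1]; first by move: hr; rewrite e.
  exact: ltn_trans hr h1.
case/eqP: Lk; rewrite [LHS]linear_sum big1 // => rho dr.
have := no rho; rewrite dr /= negbK => /eqP Lr.
by rewrite [LHS]linearZ /= -/L Lr mulr0.
Qed.

Lemma f_kn : f kn != 0.
Proof.
rewrite /f mulf_neq0 //.
  by rewrite fmorph_eq0 invr_eq0 gt_eqF // (D_gt0 lam_gt0 full_dense jackP).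
have [u uE] := jackpol_triangular full_dense jackP kn.
rewrite uE [L _]linearD /= -/L L_msympol_kn [L _]linear_sum big1 ?addr0 ?oner_neq0 // => rho dr.
have hr := dominated_pheight dr.
have [Lr|/L_msympol [e|h]] := eqVneq (L (msympol R N rho)) 0.
- by rewrite [LHS]linearZ /= -/L Lr mulr0.
- by move: (dominated_neq dr); rewrite e eqxx.
- by move: (ltn_trans hr h); rewrite ltnn.
Qed.

(** Two opposite triangularities: a non-zero [f kappa] with [kappa] other than [kn] would have
    [pheight kappa < pheight kn] and would show up as a monomial of [Phi] lower than [nn], against
    [Phi_leading]. *)
Lemma Phi_jackpol : Phi = f kn *: jackpol N (P kn).
Proof.
rewrite Phi_jack (bigD1 kn) //= big1 ?addr0 // => kappa kk.
have [fk|fk] := boolP (fits N kappa); last first.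
  by rewrite (jackpol_fits full_dense jackP fk) scaler0.
suff -> : f kappa = 0 by rewrite scale0r.
have [k] := ubnP (pheight kappa); elim: k kappa kk fk => // k IH kappa kk fk; rewrite ltnS => hk.
apply/eqP/negPn/negP => f0.
case: (f_neq0 f0) => [e|lt_kn]; first by rewrite e eqxx in kk.
(* The other Jack polynomials that contain this monomial belong to dominating partitions, of smaller
   [pheight], whose coefficients vanish by induction. *)
have : Phi@_(pmonomial N kappa) = f kappa.
  rewrite Phi_jack raddf_sum (bigD1 kappa) //= mcoeffZ.
  rewrite (jackpol_coeff full_dense jackP fk) mulr1 big1 ?addr0 // => kappa' kk'.
  rewrite mcoeffZ.
  have [->|c0] := eqVneq ((jackpol N (P kappa'))@_(pmonomial N kappa)) 0; first by rewrite mulr0.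
  rewrite eq_sym in kk'.
  have dom := jackpol_coeff_dominated full_dense jackP fk kk' c0.
  have lt' := dominated_pheight dom.
  rewrite IH ?mul0r //.
  - by apply: contraTneq (ltn_trans lt' lt_kn) => ->; rewrite ltnn.
  - exact: fits_dominated dom fk.
  - exact: leq_trans lt' hk.
move=> e; have Phi0 : Phi@_(pmonomial N kappa) != 0 by rewrite e.
have mh := mheight_pmonomial fk.
have ne : pmonomial N kappa != nn.
  by apply/eqP => e'; move: lt_kn; rewrite -mh e' pheight_kn ltnn.
have := Phi_leading Phi0 ne; rewrite mh pheight_kn => h.
by move: (ltn_trans h lt_kn); rewrite ltnn.
Qed.

Lemma Phipol_proportional_jack : exists2 c : R[i], c != 0 &
  forall z, Phi.@[z] = c * symfun_eval (P kn) z.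
Proof.
exists (f kn); first exact: f_kn.
by move=> z; rewrite Phi_jackpol mevalZ meval_jackpol.
Qed.

End NovelIsJack.

(** * Explicit sums for the values of the polynomials *)

Section PolynomialValues.
Variables (N : nat) (C : numFieldType) (lam : C) (z : 'I_N -> C).
Implicit Types (m : {ffun 'I_N -> int}).

Lemma meval_gpol_ord r M : (r < M)%N -> (gpol N lam r).@[z] =
  \sum_(k : {ffun 'I_N -> 'I_M} | (\sum_i k i)%N == r)
    \prod_i (rising lam (k i) * z i ^+ k i).
Proof.
move=> rM.
pose G (m : 'X_{1..N}) := \prod_i (rising lam (m i) * z i ^+ m i).
have -> : (gpol N lam r).@[z] = \sum_(m : 'X_{1..N < r.+1} | mdeg m == r) G m.
  rewrite /gpol rmorph_sum [RHS]big_mkcond; apply: eq_bigr => m _ /=.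
  have -> : G m = \prod_i rising lam (m i) * \prod_i z i ^+ m i by rewrite /G -big_split.
  rewrite mevalZ mevalX.
  by case: eqP => _; rewrite ?mul1r ?mul0r.
have hd (k : {ffun 'I_N -> 'I_M}) : (\sum_i k i)%N == r ->
    (mdeg [multinom nat_of_ord (k i) | i < N] < r.+1)%N.
  by move/eqP => h; rewrite mdegE (eq_bigr (fun i => nat_of_ord (k i))) ?h // => i _; rewrite mnmE.
pose h (m : 'X_{1..N < r.+1}) : {ffun 'I_N -> 'I_M} := [ffun i => insubd (Ordinal rM) (m i)].
have hv (m : 'X_{1..N < r.+1}) i : h m i = m i :> nat.
  rewrite ffunE val_insubd; case: ltnP => // Mi; have := bmdeg m.
  rewrite mdegE (bigD1 i) //=; move=> hdd; exfalso; move: (rM) hdd Mi; clear; lia.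
pose h' (k : {ffun 'I_N -> 'I_M}) : option 'X_{1..N < r.+1} :=
  insub [multinom nat_of_ord (k i) | i < N].
rewrite [RHS](reindex_omap h h') /=; last first.
  move=> k hk; rewrite /h' insubT ?hd //= => H.
  by congr Some; apply/ffunP => i; apply: val_inj; rewrite /= hv /= mnmE.
apply: eq_big => [m|m _]; last by apply: eq_bigr => i _; rewrite hv.
have -> : (\sum_i h m i)%N = mdeg m.
  by rewrite mdegE; apply: eq_bigr => i _; rewrite hv.
have e : [multinom nat_of_ord (h m i) | i < N] = m.
  by apply/mnmP => i; rewrite mnmE hv.
by rewrite /h' e valK eqxx andbT.
Qed.

Lemma meval_Gm_ord m M : (forall j, m j < M%:Z) -> (Gm lam m).@[z] =
  \sum_(nu : {ffun 'I_N -> {ffun 'I_N -> 'I_M}}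
       | [forall j, (\sum_i nu j i)%N%:Z == m j])
     \prod_j \prod_i (rising lam (nu j i) * z i ^+ nu j i).
Proof.
move=> hm; rewrite /Gm rmorph_prod /=.
transitivity (\prod_j \sum_(k : {ffun 'I_N -> 'I_M} | (\sum_i k i)%N%:Z == m j)
    \prod_i (rising lam (k i) * z i ^+ k i)).
  apply: eq_bigr => j _; have := hm j; case: (m j) => r hr /=.
    by rewrite (@meval_gpol_ord _ M) //; apply: eq_bigl => k; rewrite eqz_nat.
  by rewrite meval0 big_pred0.
rewrite (bigA_distr_big_dep (fun j (k : {ffun 'I_N -> 'I_M}) => (\sum_i k i)%N%:Z == m j)).
by apply: eq_bigl => nu; apply/familyP/forallP => h j; exact: h.
Qed.

(** The shape in which the truncated kernel is expanded: [mu] holds the exponents of the numerator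
    factors and [nu] those of the denominator factors. The two bounds on [M] make room for all
    exponents that contribute. *)
Lemma meval_Ppol_ord m M : (`|height m| < M)%N -> (`|(\sum_j m j)%R| < M)%N ->
  (Ppol lam m).@[z] =
  \sum_(mu : {ffun idx_pair N -> 'I_M}) \sum_(nu : {ffun 'I_N -> {ffun 'I_N -> 'I_M}}
       | [forall j, (\sum_i nu j i)%N%:Z == m j + vecmu [ffun p => val (mu p)] j])
    (\prod_p rising (- lam) (mu p)) *
     \prod_j \prod_i (rising lam (nu j i) * z i ^+ nu j i).
Proof.
move=> hM1 hM2; rewrite meval_Ppol (@Psi_widen _ _ _ _ _ M); last by lia.
  apply: eq_bigr => mu _.
  set v := vecmu _; rewrite -mulr_sumr; congr (_ * _).
    by rewrite /beta; apply: eq_bigr => p _; rewrite ffunE.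
  have [/existsP [j hj]|/existsPn H] := boolP [exists j, (m + v) j < 0].
    rewrite (Gm_lt0 _ hj) meval0 big_pred0 // => nu; apply/negbTE/negP => /forallP /(_ j) /eqP e.
    by move: hj; rewrite ffunE -e.
  have hs : \sum_j (m + v) j = \sum_j m j.
    under eq_bigr do rewrite ffunE.
    by rewrite big_split /= sum_vecmu addr0.
  rewrite (@meval_Gm_ord _ M); first by apply: eq_bigl => nu; apply: eq_forallb => j; rewrite ffunE.
  move=> j; apply: (@le_lt_trans _ _ (\sum_j m j)); last by move: hM2; clear; lia.
  rewrite -hs (bigD1 j) //= lerDl sumr_ge0 // => i _.
  by rewrite leNgt H.
exact: f_bounded.
Qed.

(** The reason for the regulators [(k - j) eps] and [j eps]: the change of weight caused by [mu] in
    the denominators is compensated by the numerators. *)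
Lemma sum_weight_vecmu (mu : mtuple N) :
  \sum_(j : 'I_N) (j.+1)%:Z * vecmu mu j
  = - \sum_(p : idx_pair N) ((pair_snd p - pair_fst p)%N * mu p)%N%:Z.
Proof.
under eq_bigr do rewrite vecmuE mulr_sumr.
rewrite exchange_big -sumrN; apply: eq_bigr => p _ /=.
have := sum_posroot (fun j : 'I_N => (j.+1)%:Z) p => h.
rewrite PoszM -subzn 1?ltnW ?ltn_pair // -mulNr opprB.
have -> : (pair_fst p)%:Z - (pair_snd p)%:Z = (pair_fst p).+1%:Z - (pair_snd p).+1%:Z by lia.
rewrite -h mulr_suml; apply: eq_bigr => l _.
by rewrite -mulrzr !intz; ring.
Qed.

End PolynomialValues.

Section SymmetrizedMonomial.
Variables (N : nat) (C : comNzRingType).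
Implicit Types m : 'X_{1..N}.

Definition symmetrized_monomial m : {mpoly C[N]} :=
  \sum_(s : 'S_N) 'X_[[multinom m (s i) | i < N]].

Lemma symmetrized_monomial_sym m : symmetrized_monomial m \is symmetric.
Proof.
apply/issymP => t; rewrite /symmetrized_monomial rmorph_sum /=.
rewrite [RHS](reindex_inj (mulgI (t^-1)%g)); apply: eq_bigr => s _ /=.
by rewrite msymX; congr 'X_[_]; apply/mnmP => i; rewrite !mnmE permM.
Qed.

Lemma meval_symmetrized_monomial m z :
  (symmetrized_monomial m).@[z] = \sum_(s : 'S_N) \prod_j z (s j) ^+ m j.
Proof.
rewrite /symmetrized_monomial rmorph_sum (reindex_inj invg_inj) /=; apply: eq_bigr => s _.
rewrite mevalX (reindex_inj (@perm_inj _ s)); apply: eq_bigr => j _.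
by rewrite mnmE permK.
Qed.

End SymmetrizedMonomial.

End MultivariatePolynomials.

From mathcomp Require Import all_classical all_reals all_analysis.
From mathcomp Require Import complex.
From mathcomp Require Import lra.

Import Order.TTheory GRing.Theory Num.Theory.
Import numFieldNormedType.Exports.
Import -(notations) mpoly.
Local Open Scope classical_set_scope.
Local Open Scope ring_scope.
Local Open Scope complex_scope.

(** * Complex calculus with geometric error bounds *)

Section GeometricTail.
Variable R : realType.

Lemma big_nat_shift_ord (F : nat -> R) M k :
  \sum_(M <= i < M + k) F i = \sum_(i < k) F (M + i)%N.
Proof.
elim: k => [|k IH]; first by rewrite addn0 big_geq // big_ord0.
by rewrite addnS big_nat_recr ?leq_addr //= IH big_ord_recr.
Qed.

Lemma sum_geom_le (r : R) M k : 0 <= r -> r < 1 ->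
  \sum_(M <= i < M + k) r ^+ i <= r ^+ M / (1 - r).
Proof.
move=> r0 r1; have h : 0 < 1 - r by rewrite subr_gt0.
rewrite ler_pdivlMr //.
suff -> : (\sum_(M <= i < M + k) r ^+ i) * (1 - r) = r ^+ M - r ^+ (M + k).
  by rewrite gerBl exprn_ge0.
elim: k => [|k IH]; first by rewrite addn0 big_geq // mul0r subrr.
rewrite addnS big_nat_recr ?leq_addr //= mulrDl IH exprS; ring.
Qed.

Lemma geom_dominated_series (u : nat -> R) (A r : R) : 0 <= r -> r < 1 ->
  (forall k, `|u k| <= A * r ^+ k) ->
  forall M, `|lim ((fun n => \sum_(k < n) u k) @ \oo) - \sum_(k < M) u k| <= A * r ^+ M / (1 - r).
Proof.
move=> r0 r1 hu M.
have A0 : 0 <= A by have := hu 0%N; rewrite expr0 mulr1; apply: le_trans.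
have SE : (fun n => \sum_(k < n) u k) = series u.
  by apply/funext => n; rewrite /series /= big_mkord.
rewrite SE.
have cv : cvgn (series u).
  apply: normed_cvg; apply: (@series_le_cvg _ _ (geometric A r)) => [n|n|n|] //=.
  - by rewrite mulr_ge0 // exprn_ge0.
  - by apply: is_cvg_geometric_series; rewrite ger0_norm.
have cvM : (fun n => `|series u n - \sum_(k < M) u k|) @ \oo -->
    `|limn (series u) - \sum_(k < M) u k|.
  by apply: cvg_norm; apply: cvgB => //; exact: cvg_cst.
rewrite -(cvg_lim _ cvM) //; apply: limr_le; first exact: cvgP cvM.
exists M => // n /= Mn; rewrite -SE -(subnKC Mn) big_split_ord /= addrAC subrr add0r.
apply: le_trans (ler_norm_sum _ _ _) _.
apply: (@le_trans _ _ (\sum_(M <= i < M + (n - M)) A * r ^+ i)).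
  by rewrite big_nat_shift_ord; apply: ler_sum.
by rewrite -mulr_sumr -mulrA ler_wpM2l // sum_geom_le.
Qed.

(** Ratio test: the ratio of consecutive terms is [|s - k| q / (k + 1)], eventually at most
    [r = (1 + q) / 2]; [A] also covers the finitely many earlier terms. *)
Lemma gbinom_geom (s q : R) : 0 <= q -> q < 1 ->
  exists A r : R, [/\ 0 <= r, r < 1 & forall k, `|gbinom s k| * q ^+ k <= A * r ^+ k].
Proof.
move=> q0 q1; pose a k := `|gbinom s k| * q ^+ k.
pose r := (1 + q) / 2; have r0 : 0 < r by rewrite /r; lra.
have r1 : r < 1 by rewrite /r; lra.
have qr : q < r by rewrite /r; lra.
have aS k : a k.+1 = a k * (`|s - k%:R| * q / k.+1%:R).
  rewrite /a /gbinom big_ord_recr /= factS natrM !normrM exprS.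
  rewrite !normfV normrM !normr_nat invfM; ring.
have a_ge0 k : 0 <= a k by rewrite mulr_ge0 ?exprn_ge0.
(* This choice means [|s| q <= K (r - q)], whence [(|s| + k) q <= (k + 1) r] for [k >= K]. *)
have [K hK] : exists K : nat, `|s| * q / (r - q) <= K%:R.
  exists (Num.bound (`|s| * q / (r - q))); apply: ltW; apply: archi_boundP.
  by rewrite divr_ge0 ?mulr_ge0 // subr_ge0 ltW.
have step k : (K <= k)%N -> a k.+1 <= a k * r.
  move=> Kk; rewrite aS; apply: ler_wpM2l => //.
  rewrite ler_pdivrMr ?ltr0n //.
  have h1 : `|s - k%:R| <= `|s| + k%:R.
    by apply: le_trans (ler_normB _ _) _; rewrite normr_nat.
  have h2 : `|s| * q <= k%:R * (r - q).
    rewrite -ler_pdivrMr ?subr_gt0 //; apply: le_trans hK _.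
    by rewrite ler_nat.
  apply: le_trans (ler_wpM2r q0 h1) _.
  by rewrite -natr1; lra.
have tail i : a (K + i)%N <= a K * r ^+ i.
  elim: i => [|i IH]; first by rewrite addn0 mulr1.
  rewrite addnS; apply: le_trans (step _ (leq_addr _ _)) _.
  rewrite exprSr [leRHS]mulrA; apply: (@ler_wpM2r _ r) IH; exact: ltW.
pose A := (\sum_(k < K.+1) a k) / r ^+ K.
have S_ge k : (k <= K)%N -> a k <= \sum_(k < K.+1) a k.
  by move=> kK; rewrite (bigD1 (Ordinal (kK : (k < K.+1)%N))) //= lerDl sumr_ge0.
exists A, r; split => // [|k]; first exact: ltW.
have rK : 0 < r ^+ K by rewrite exprn_gt0.
rewrite -/(a k) /A mulrAC ler_pdivlMr //.
case: (leqP k K) => [kK|/ltnW Kk].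
  apply: (ler_pM (a_ge0 k) (ltW rK) (S_ge k kK)).
  by rewrite -(subnKC kK) exprD ler_piMr ?exprn_ile1 ?exprn_ge0 ?(ltW r0) ?(ltW r1).
rewrite -{1}(subnKC Kk); apply: le_trans (ler_wpM2r (ltW rK) (tail _)) _.
rewrite -mulrA -exprD subnK //; apply: ler_wpM2r; first by rewrite exprn_ge0 // ltW.
exact: S_ge.
Qed.

End GeometricTail.

Section AbsoluteNorm.
Variable R : realType.
Implicit Types (z w : R[i]) (t : R).

(** A submultiplicative norm suited to limits and integrals that are taken on real and imaginary
    parts. *)
Definition N1 z : R := `|complex.Re z| + `|complex.Im z|.

Lemma N1_ge0 z : 0 <= N1 z. Proof. by rewrite addr_ge0. Qed.

Lemma creD z w : complex.Re (z + w) = complex.Re z + complex.Re w.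
Proof. by case: z; case: w. Qed.
Lemma cimD z w : complex.Im (z + w) = complex.Im z + complex.Im w.
Proof. by case: z; case: w. Qed.
Lemma creM z w : complex.Re (z * w) = complex.Re z * complex.Re w - complex.Im z * complex.Im w.
Proof. by case: z; case: w. Qed.
Lemma cimM z w : complex.Im (z * w) = complex.Re z * complex.Im w + complex.Im z * complex.Re w.
Proof. by case: z; case: w. Qed.
Lemma creN z : complex.Re (- z) = - complex.Re z. Proof. by case: z. Qed.
Lemma cimN z : complex.Im (- z) = - complex.Im z. Proof. by case: z. Qed.

Lemma cre_sum (I : Type) (s : seq I) (P : pred I) (F : I -> R[i]) :
  complex.Re (\sum_(i <- s | P i) F i) = \sum_(i <- s | P i) complex.Re (F i).
Proof. by apply: (big_morph (@complex.Re R) creD). Qed.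
Lemma cim_sum (I : Type) (s : seq I) (P : pred I) (F : I -> R[i]) :
  complex.Im (\sum_(i <- s | P i) F i) = \sum_(i <- s | P i) complex.Im (F i).
Proof. by apply: (big_morph (@complex.Im R) cimD). Qed.

Lemma complex_eqP z w : complex.Re z = complex.Re w -> complex.Im z = complex.Im w -> z = w.
Proof. by case: z; case: w => /= ? ? ? ? -> ->. Qed.

Lemma N1_0 : N1 0 = 0. Proof. by rewrite /N1 /= normr0 addr0. Qed.

Lemma N1_eq0 z : N1 z = 0 -> z = 0.
Proof.
move/eqP; rewrite paddr_eq0 // !normr_eq0 => /andP [/eqP h1 /eqP h2].
exact: complex_eqP.
Qed.

Lemma N1_real t : N1 t%:C = `|t|.
Proof. by rewrite /N1 /= normr0 addr0. Qed.

Lemma N1N z : N1 (- z) = N1 z.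
Proof. by rewrite /N1 creN cimN !normrN. Qed.

Lemma N1D z w : N1 (z + w) <= N1 z + N1 w.
Proof. by rewrite /N1 creD cimD addrACA lerD // ler_normD. Qed.

Lemma N1M z w : N1 (z * w) <= N1 z * N1 w.
Proof.
rewrite /N1 creM cimM mulrDl !mulrDr.
apply: le_trans (lerD (ler_normB _ _) (ler_normD _ _)) _.
by rewrite !normrM; lra.
Qed.

Lemma N1_sum (I : Type) (s : seq I) (P : pred I) (F : I -> R[i]) :
  N1 (\sum_(i <- s | P i) F i) <= \sum_(i <- s | P i) N1 (F i).
Proof.
elim/big_rec2: _ => [|i x y _ h]; first by rewrite N1_0.
by apply: le_trans (N1D _ _) _; rewrite lerD2l.
Qed.

Lemma expiD (s t : R) : expi (s + t) = expi s * expi t.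
Proof.
by apply: complex_eqP; rewrite ?creM ?cimM /= ?cosD ?sinD //; ring.
Qed.

Lemma expi0 : expi 0 = 1 :> R[i].
Proof. by apply: complex_eqP; rewrite /= ?cos0 ?sin0. Qed.

Lemma expi_neq0 t : expi t != 0.
Proof.
apply/eqP => h; have := expiD t (- t); rewrite subrr expi0 h mul0r.
by move/eqP; rewrite oner_eq0.
Qed.

Lemma expiN t : expi (- t) = (expi t)^-1.
Proof.
apply: (mulfI (expi_neq0 t)); rewrite -expiD subrr expi0 divff //.
exact: expi_neq0.
Qed.

Lemma expiMn t k : expi (k%:R * t) = expi t ^+ k.
Proof.
elim: k => [|k IH]; first by rewrite mul0r expi0.
by rewrite -natr1 mulrDl mul1r expiD IH exprSr.
Qed.

Lemma expi_sum (I : Type) (s : seq I) (P : pred I) (F : I -> R) :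
  expi (\sum_(i <- s | P i) F i) = \prod_(i <- s | P i) expi (F i).
Proof. exact: (big_morph _ expiD expi0). Qed.

Lemma N1_expi t : N1 (expi t) <= 2.
Proof.
rewrite /N1 /=; have h1 := cos_le1 t; have h2 := cos_geN1 t.
have h3 := sin_le1 t; have h4 := sin_geN1 t.
rewrite -[2]/(1 + 1) lerD // ler_norml; apply/andP; split; lra.
Qed.

Lemma real_complexM (x y : R) : (x * y)%:C = x%:C * y%:C.
Proof. by rewrite rmorphM. Qed.

Lemma real_complexX (x : R) k : (x ^+ k)%:C = x%:C ^+ k.
Proof. exact: rmorphXn. Qed.

Lemma real_complexN (x : R) : (- x)%:C = - x%:C.
Proof. by rewrite rmorphN. Qed.

(** Uniform approximation of [(1 - q e^(it))^s] by its binomial partial sums. *)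
Lemma one_sub_pow_approx (s q : R) : 0 <= q -> q < 1 ->
  exists A r : R, [/\ 0 <= r, r < 1, 0 <= A & forall M t,
    N1 (one_sub_pow s (q%:C * expi t)
        - \sum_(k < M) (gbinom s k)%:C * (- (q%:C * expi t)) ^+ k) <= A * r ^+ M].
Proof.
move=> q0 q1; have [A [r [r0 r1 hA]]] := gbinom_geom s q0 q1.
have A0 : 0 <= A by have := hA 0%N; rewrite !expr0 !mulr1; apply: le_trans.
exists (A * 2 / (1 - r) + A * 2 / (1 - r)), r; split => //.
  by rewrite addr_ge0 // divr_ge0 ?mulr_ge0 // subr_ge0 ltW.
move=> M t.
pose u k := complex.Re ((gbinom s k)%:C * (- (q%:C * expi t)) ^+ k).
pose v k := complex.Im ((gbinom s k)%:C * (- (q%:C * expi t)) ^+ k).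
have hN k : N1 ((gbinom s k)%:C * (- (q%:C * expi t)) ^+ k) <= A * 2 * r ^+ k.
  rewrite -mulN1r !exprMn -rmorphXn -expiMn.
  have -> : (gbinom s k)%:C * ((-1) ^+ k * ((q ^+ k)%:C * expi (k%:R * t)))
     = ((-1) ^+ k * (gbinom s k * q ^+ k))%:C * expi (k%:R * t).
    have -> : ((-1) ^+ k * (gbinom s k * q ^+ k))%:C = (-1) ^+ k * ((gbinom s k)%:C * (q ^+ k)%:C).
      by rewrite !real_complexM !real_complexX real_complexN.
    by ring.
  apply: le_trans (N1M _ _) _; rewrite N1_real normrM normrX normrN1 expr1n mul1r.
  rewrite normrM [`|q ^+ k|]ger0_norm ?exprn_ge0 // [leRHS]mulrAC.
  by rewrite ler_pM ?mulr_ge0 ?N1_ge0 ?exprn_ge0 ?N1_expi.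
have hu k : `|u k| <= A * 2 * r ^+ k.
  by apply: le_trans (hN k); rewrite /N1 lerDl.
have hv k : `|v k| <= A * 2 * r ^+ k.
  by apply: le_trans (hN k); rewrite /N1 lerDr.
have h1 := geom_dominated_series r0 r1 hu M.
have h2 := geom_dominated_series r0 r1 hv M.
rewrite /N1 creD cimD creN cimN cre_sum cim_sum /one_sub_pow /clim_seq /=.
have eRe : (fun k : nat => complex.Re (\sum_(k0 < k) (gbinom s k0)%:C * (- (q%:C * expi t)) ^+ k0))
    = (fun n => \sum_(k < n) u k) by apply/funext => n; rewrite cre_sum.
have eIm : (fun k : nat => complex.Im (\sum_(k0 < k) (gbinom s k0)%:C * (- (q%:C * expi t)) ^+ k0))
    = (fun n => \sum_(k < n) v k) by apply/funext => n; rewrite cim_sum.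
rewrite eRe eIm mulrDl; apply: lerD.
  by apply: le_trans h1 _; rewrite mulrAC.
by apply: le_trans h2 _; rewrite mulrAC.
Qed.

End AbsoluteNorm.

Section ComplexContinuous.
Variable R : realType.
Implicit Types (g h : R -> R[i]) (t : R).

Definition ccontinuous g : Prop :=
  continuous (fun t => complex.Re (g t)) /\ continuous (fun t => complex.Im (g t)).

Lemma ccontinuous_cst (c : R[i]) : ccontinuous (fun=> c).
Proof. by split => t; apply: cvg_cst. Qed.

Lemma ccontinuousD g h : ccontinuous g -> ccontinuous h ->
  ccontinuous (fun t => g t + h t).
Proof.
move=> [g1 g2] [h1 h2]; split => t.
  under eq_fun do rewrite creD.
  by apply: continuousD; [exact: g1|exact: h1].
under eq_fun do rewrite cimD.
by apply: continuousD; [exact: g2|exact: h2].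
Qed.

Lemma ccontinuousM g h : ccontinuous g -> ccontinuous h ->
  ccontinuous (fun t => g t * h t).
Proof.
move=> [g1 g2] [h1 h2]; split => t.
  under eq_fun do rewrite creM.
  apply: cvgB; apply: cvgM; [exact: g1|exact: h1|exact: g2|exact: h2].
under eq_fun do rewrite cimM.
apply: cvgD; apply: cvgM; [exact: g1|exact: h2|exact: g2|exact: h1].
Qed.

Lemma ccontinuous_expi (k : R) : ccontinuous (fun t => expi (k * t)).
Proof.
have h t : {for t, continuous (fun s => k * s)}.
  by apply: continuousM; [exact: cvg_cst|exact: cvg_id].
split => t /=.
  by apply: continuous_comp; [exact: h|exact: continuous_cos].
by apply: continuous_comp; [exact: h|exact: continuous_sin].
Qed.

Lemma ccontinuous_sum (I : Type) (s : seq I) (F : I -> R -> R[i]) :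
  (forall i, ccontinuous (F i)) -> ccontinuous (fun t => \sum_(i <- s) F i t).
Proof.
move=> hF; elim: s => [|i s IH].
  by under eq_fun do rewrite big_nil; exact: ccontinuous_cst.
by under eq_fun do rewrite big_cons; exact: ccontinuousD.
Qed.

(** Uniform limits preserve continuity; the [e / 3] argument is made once, for a projection [p] that
    is the real or the imaginary part. *)
Lemma ccontinuous_approx g :
  (forall e, 0 < e -> exists2 h, ccontinuous h & forall t, N1 (g t - h t) <= e) ->
  ccontinuous g.
Proof.
move=> hg.
have aux (p : R[i] -> R) : (forall z, `|p z| <= N1 z) ->
    (forall z w, p (z - w) = p z - p w) ->
    (forall h, ccontinuous h -> continuous (fun t => p (h t))) ->
    continuous (fun t => p (g t)).
  move=> p1 p2 p3 t; apply/cvgrPdist_le => e e0.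
  have e3 : 0 < e / 3 by rewrite divr_gt0.
  have [h hc hh] := hg _ e3.
  have /cvgrPdist_le/(_ _ e3) := p3 _ hc t.
  apply: filterS => s hs.
  have b u : `|p (g u) - p (h u)| <= e / 3.
    by rewrite -p2; apply: le_trans (p1 _) (hh u).
  have -> : p (g t) - p (g s) = (p (g t) - p (h t)) + (p (h t) - p (h s)) - (p (g s) - p (h s)) by ring.
  apply: le_trans (ler_normB _ _) _; apply: le_trans (lerD (ler_normD _ _) (lexx _)) _.
  have := b t; have := b s; move: hs; lra.
split.
  by apply: aux => [z|z w|h []//]; [rewrite /N1 lerDl|rewrite creD creN].
by apply: aux => [z|z w|h []//]; [rewrite /N1 lerDr|rewrite cimD cimN].
Qed.

Lemma ccontinuous_integrable g (a b : R) : ccontinuous g ->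
  lebesgue_measure.-integrable `[a, b] (EFin \o (fun t => complex.Re (g t))) /\
  lebesgue_measure.-integrable `[a, b] (EFin \o (fun t => complex.Im (g t))).
Proof.
move=> [h1 h2]; split; apply: continuous_compact_integrable;
  (exact: segment_compact || exact: continuous_subspaceT).
Qed.

Lemma cintegralD a b g h : ccontinuous g -> ccontinuous h ->
  cintegral a b (fun t => g t + h t) = cintegral a b g + cintegral a b h.
Proof.
move=> /(ccontinuous_integrable a b)[g1 g2] /(ccontinuous_integrable a b)[h1 h2].
rewrite /cintegral; apply: complex_eqP; rewrite ?creD ?cimD /=.
  by under eq_Rintegral do rewrite creD; rewrite RintegralD.
by under eq_Rintegral do rewrite cimD; rewrite RintegralD.
Qed.

Lemma cintegralZ a b (c : R[i]) g : ccontinuous g ->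
  cintegral a b (fun t => c * g t) = c * cintegral a b g.
Proof.
move=> /(ccontinuous_integrable a b)[g1 g2].
have Z (r : R) (f : R -> R) : lebesgue_measure.-integrable `[a, b] (EFin \o f) ->
    lebesgue_measure.-integrable `[a, b] (EFin \o (fun t => r * f t)).
  move=> hf; have := @integrableZl _ _ _ (@lebesgue_measure R) _ (measurable_itv `[a, b]) r _ hf; exact: eq_integrable.
rewrite /cintegral; apply: complex_eqP; rewrite ?creM ?cimM /=.
  under eq_Rintegral do rewrite creM.
  by rewrite RintegralB ?RintegralZl //; exact: Z.
under eq_Rintegral do rewrite cimM.
by rewrite RintegralD ?RintegralZl //; exact: Z.
Qed.

Lemma cintegral_sum a b (I : Type) (s : seq I) (F : I -> R -> R[i]) :
  (forall i, ccontinuous (F i)) ->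
  cintegral a b (fun t => \sum_(i <- s) F i t) = \sum_(i <- s) cintegral a b (F i).
Proof.
move=> hF; elim: s => [|i s IH].
  rewrite big_nil /cintegral; apply: complex_eqP => /=.
    by under eq_Rintegral do rewrite big_nil; rewrite Rintegral_cst ?mul0r.
  by under eq_Rintegral do rewrite big_nil; rewrite Rintegral_cst ?mul0r.
rewrite big_cons -IH -cintegralD //; last exact: ccontinuous_sum.
by congr cintegral; apply/funext => t; rewrite big_cons.
Qed.

Lemma N1_cintegral a b g e : a <= b -> ccontinuous g -> (forall t, N1 (g t) <= e) ->
  N1 (cintegral a b g) <= 2 * (b - a) * e.
Proof.
move=> ab /(ccontinuous_integrable a b)[g1 g2] he.
have aux (f : R -> R) : lebesgue_measure.-integrable `[a, b] (EFin \o f) ->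
    (forall t, `|f t| <= e) -> `|\int[lebesgue_measure]_(t in `[a, b]) f t|%R <= (b - a) * e.
  move=> hf hb; apply: le_trans (le_normr_Rintegral _ hf) _ => //.
  have hI : lebesgue_measure.-integrable `[a, b] (EFin \o (fun=> e)).
    by apply: continuous_compact_integrable; [exact: segment_compact|apply: continuous_subspaceT => ?; exact: cvg_cst].
  apply: le_trans (le_Rintegral _ _ hI (fun t _ => hb t)) _ => //.
    exact: integrable_norm.
  rewrite Rintegral_cst //= lebesgue_measure_itv /= lte_fin.
  case: ltgtP ab => //= [ab _|-> _]; first by rewrite mulrC.
  by rewrite subrr mulr0 mul0r.
have h1 : `|complex.Re (cintegral a b g)| <= (b - a) * e.
  by apply: aux => // t; apply: le_trans (he t); rewrite /N1 lerDl.
have h2 : `|complex.Im (cintegral a b g)| <= (b - a) * e.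
  by apply: aux => // t; apply: le_trans (he t); rewrite /N1 lerDr.
by rewrite /N1 -mulrA mulr2n mulrDl !mul1r lerD.
Qed.

Lemma cintegral_expi (k : int) :
  cintegral (- pi) pi (fun t => ((2 * pi)^-1)%:C * expi (k%:~R * t)) = (k == 0)%:R.
Proof.
rewrite cintegralZ; last exact: ccontinuous_expi.
have pi0 := pi_gt0 R; have pipi : - pi < pi :> R by lra.
case: eqP => [->|/eqP k0].
  have -> : cintegral (- pi) pi (fun t : R => expi (0%:~R * t)) = (2 * pi)%:C.
    rewrite /cintegral; apply: complex_eqP => /=.
      under eq_Rintegral do rewrite mulr0z mul0r cos0.
      rewrite Rintegral_cst // mul1r /= lebesgue_measure_itv /= lte_fin pipi /=; ring.
    under eq_Rintegral do rewrite mulr0z mul0r sin0.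
    by rewrite Rintegral_cst // mul0r.
  by rewrite -real_complexM mulVf // mulf_neq0 // gt_eqF.
have kR : k%:~R != 0 :> R by rewrite intr_eq0.
have sin_kpi : sin (k%:~R * pi) = 0 :> R.
  have hn (j : nat) : sin (j%:R * pi) = 0 :> R.
    elim: j => [|j IH]; first by rewrite mul0r sin0.
    by rewrite -natr1 mulrDl mul1r sinDpi IH oppr0.
  case: k {k0 kR} => j; first exact: hn.
  by rewrite NegzE mulrNz mulNr sinN hn oppr0.
have FTC (F f : R -> R) : (forall t, is_derive t 1 F (f t)) -> continuous f ->
    (\int[lebesgue_measure]_(t in `[- pi, pi]) f t)%R = F pi - F (- pi).
  move=> dF cf; rewrite /Rintegral (@continuous_FTC2 _ f F) //.
  - exact: continuous_subspaceT.
  - have cF : continuous F.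
      by move=> t; apply: differentiable_continuous; apply/derivable1_diffP; have [] := dF t.
    split.
    + by move=> t _; have [] := dF t.
    + by apply: cvg_at_right_filter; exact: cF.
    + by apply: cvg_at_left_filter; exact: cF.
  - by move=> t _; rewrite derive1E; apply: derive_val.
have [cc cs] := ccontinuous_expi k%:~R.
have dk (t : R) : is_derive t 1 (fun s => k%:~R * s) k%:~R.
  by rewrite -[X in is_derive _ _ _ X]mulr1; apply: is_deriveZ.
suff -> : cintegral (- pi) pi (fun t : R => expi (k%:~R * t)) = 0 by rewrite mulr0.
have d1 (t : R) : is_derive t 1 (fun t => (k%:~R)^-1 * sin (k%:~R * t)) (cos (k%:~R * t)).
  have -> : cos (k%:~R * t) = k%:~R^-1 * (k%:~R * cos (k%:~R * t)) by rewrite mulKf.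
  apply: is_deriveZ.
  rewrite mulrC; exact: (@is_derive1_comp _ sin (fun s => k%:~R * s) t _ _ (is_derive_sin _) (dk t)).
have d2 (t : R) : is_derive t 1 (fun t => - (k%:~R)^-1 * cos (k%:~R * t)) (sin (k%:~R * t)).
  have -> : sin (k%:~R * t) = - k%:~R^-1 * (k%:~R * - sin (k%:~R * t)).
    by rewrite mulrN mulrNN mulKf.
  apply: is_deriveZ.
  rewrite mulrC; exact: (@is_derive1_comp _ cos (fun s => k%:~R * s) t _ _ (is_derive_cos _) (dk t)).
rewrite /cintegral; apply: complex_eqP => /=.
  by rewrite (FTC _ _ d1 cc) mulrN sinN sin_kpi; ring.
by rewrite (FTC _ _ d2 cs) mulrN cosN; ring.
Qed.

End ComplexContinuous.

(** * Iterated integrals of trigonometric sums and of their uniform limits *)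

Section IteratedIntegral.
Variables (R : realType) (N : nat).
Implicit Types (s : seq (R[i] * ('I_N -> int))) (m a : 'I_N -> int) (y : 'I_N -> R).

Definition wave a y : R[i] := \prod_(l < N) expi ((a l)%:~R * y l).

Definition trigsum s y : R[i] := \sum_(u <- s) u.1 * wave u.2 y.

(** Integration over [y_j] against [exp (i m_j y_j) / (2 pi)] keeps the frequencies [- m_j]; the
    entry is reset to [0] since the variable is gone. *)
Definition select m (j : 'I_N) s : seq (R[i] * ('I_N -> int)) :=
  [seq (u.1, [eta u.2 with j |-> 0] : 'I_N -> int) | u <- s & u.2 j == - m j].

Lemma wave_eta a y j t :
  wave a [eta y with j |-> t] = expi ((a j)%:~R * t) * wave [eta a with j |-> 0] y.
Proof.
rewrite /wave (bigD1 j) //= eqxx [X in _ = _ * X](bigD1 j) //= eqxx mul0r expi0 mul1r.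
by congr (_ * _); apply: eq_bigr => l lj; rewrite (negPf lj).
Qed.

Lemma wave0 a : wave a (fun=> 0) = 1.
Proof. by apply: big1 => l _; rewrite mulr0 expi0. Qed.

Lemma trigsum_slice_continuous s y j :
  ccontinuous (fun t => trigsum s [eta y with j |-> t]).
Proof.
apply: ccontinuous_sum => u; under eq_fun do rewrite wave_eta.
apply: (ccontinuousM (g := fun=> u.1)); first exact: ccontinuous_cst.
apply: (ccontinuousM (h := fun=> wave [eta u.2 with j |-> 0] y)); last exact: ccontinuous_cst.
exact: ccontinuous_expi.
Qed.

Lemma plane_wave_continuous (k : R) : ccontinuous (fun t => ((2 * pi)^-1)%:C * expi (k * t)).
Proof.
apply: (ccontinuousM (g := fun=> _)); first exact: ccontinuous_cst.
exact: ccontinuous_expi.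
Qed.

Lemma cintegral_trigsum m j s y :
  cintegral (- pi) pi (fun t =>
      ((2 * pi)^-1)%:C * expi ((m j)%:~R * t) * trigsum s [eta y with j |-> t])
  = trigsum (select m j s) y.
Proof.
pose F (u : R[i] * ('I_N -> int)) t := (u.1 * wave [eta u.2 with j |-> 0] y) *
  (((2 * pi)^-1)%:C * expi ((m j + u.2 j)%:~R * t)).
have -> : (fun t => ((2 * pi)^-1)%:C * expi ((m j)%:~R * t) * trigsum s [eta y with j |-> t])
   = (fun t => \sum_(u <- s) F u t).
  apply/funext => t; rewrite /trigsum mulr_sumr; apply: eq_bigr => u _.
  rewrite wave_eta /F intrD [(_ + _) * t]mulrDl expiD; ring.
rewrite cintegral_sum => [|u]; last first.
  apply: (ccontinuousM (g := fun=> _)); first exact: ccontinuous_cst.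
  exact: plane_wave_continuous.
rewrite /trigsum /select big_map big_filter [RHS]big_mkcond; apply: eq_bigr => u _.
rewrite cintegralZ ?cintegral_expi; last exact: plane_wave_continuous.
by rewrite addrC addr_eq0; case: ifP => _; rewrite ?mulr1 ?mulr0.
Qed.

Lemma iter_integral_trigsum m js s y :
  iter_integral m js (trigsum s) y = trigsum (foldr (select m) s js) y.
Proof.
elim: js y => [|j js IH] y //=.
by rewrite -cintegral_trigsum; congr cintegral; apply/funext => t; rewrite IH.
Qed.

(** [Q] looks only at frequencies outside [js], the others having been erased by [select]. In the
    induction the test on the outermost variable becomes part of [Q]. *)
Lemma sum_select m js s (Q : pred ('I_N -> int)) : uniq js ->
  (forall a b, (forall l, l \notin js -> a l = b l) -> Q a = Q b) ->
  \sum_(u <- foldr (select m) s js | Q u.2) u.1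
  = \sum_(u <- s | all (fun j => u.2 j == - m j) js && Q u.2) u.1.
Proof.
elim: js Q => [|j js IH] Q //= /andP [jjs ujs] hQ.
rewrite /select big_map big_filter_cond /=.
rewrite (IH (fun a => (a j == - m j) && Q [eta a with j |-> 0])) //.
  apply: eq_bigl => u; rewrite andbCA andbA; congr (_ && _).
  by apply: hQ => l; rewrite inE negb_or /= => /andP [/negPf ->].
move=> a b hab; rewrite hab //; congr (_ && _); apply: hQ => l.
by rewrite inE negb_or /= => /andP [/negPf -> ] /hab.
Qed.

Lemma iter_integral_coef m s :
  iter_integral m (enum 'I_N) (trigsum s) (fun=> 0)
  = \sum_(u <- s | [forall l, u.2 l == - m l]) u.1.
Proof.
rewrite iter_integral_trigsum /trigsum.
under eq_bigr do rewrite wave0 mulr1.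
have /= -> := @sum_select m (enum _) s predT (enum_uniq _) (fun _ _ _ => erefl).
apply: eq_bigl => u; rewrite andbT; apply/allP/forallP => [h l|h l _]; last exact: h.
by apply: h; rewrite mem_enum.
Qed.

Definition trig_approximable (G : ('I_N -> R) -> R[i]) : Prop :=
  forall e, 0 < e -> exists s, forall y, N1 (G y - trigsum s y) <= e.

Lemma iter_integral_approx m js G : trig_approximable G ->
  forall s e, (forall y, N1 (G y - trigsum s y) <= e) ->
  forall y, N1 (iter_integral m js G y - iter_integral m js (trigsum s) y) <= 4 ^+ size js * e.
Proof.
move=> hG; elim: js => [|j js IH] s e he y; first by rewrite expr0 mul1r.
have pi0 := pi_gt0 R.
(* The inner integral is continuous in the outer variable as a uniform limit of trigonometric sums;
   this needs approximations of every accuracy, not only the given [s]. *)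
have hc y0 : ccontinuous (fun t => iter_integral m js G [eta y0 with j |-> t]).
  apply: ccontinuous_approx => d d0.
  have d1 : 0 < d / 4 ^+ size js by rewrite divr_gt0 // exprn_gt0.
  have [s' hs'] := hG _ d1.
  exists (fun t => iter_integral m js (trigsum s') [eta y0 with j |-> t]).
    under eq_fun do rewrite iter_integral_trigsum; exact: trigsum_slice_continuous.
  move=> t; apply: le_trans (IH _ _ hs' _) _.
  by rewrite mulrC divfK // gt_eqF // exprn_gt0.
have hc' y0 : ccontinuous (fun t => iter_integral m js (trigsum s) [eta y0 with j |-> t]).
  under eq_fun do rewrite iter_integral_trigsum; exact: trigsum_slice_continuous.
have cG := ccontinuousM (plane_wave_continuous (m j)%:~R) (hc y).
have cT := ccontinuousM (plane_wave_continuous (m j)%:~R) (hc' y).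
rewrite /= -[X in _ - X]mul1r -mulNr -cintegralZ // -cintegralD //; last first.
  apply: (ccontinuousM (g := fun=> _)) => //; exact: ccontinuous_cst.
have pipi : - pi <= pi :> R by lra.
(* The factor [4] per integration: [2 (2 pi)] from [N1_cintegral], and [(2 pi)^-1] times the bound
   [2] for the plane wave. *)
have -> : 4 ^+ (size js).+1 * e = 2 * (pi - - pi) * ((2 * pi)^-1 * 2 * (4 ^+ size js * e)).
  have -> : 2 * (pi - - pi) = 2 * (2 * pi) :> R by ring.
  have -> : 2 * (2 * pi) * ((2 * pi)^-1 * 2 * (4 ^+ size js * e))
    = ((2 * pi) * (2 * pi)^-1) * (4 * (4 ^+ size js * e)) :> R by ring.
  by rewrite divff ?mulf_neq0 ?gt_eqF // mul1r exprS mulrA.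
apply: N1_cintegral => //.
  apply: ccontinuousD => //; apply: (ccontinuousM (g := fun=> _)) => //; exact: ccontinuous_cst.
move=> t.
have -> : ((2 * pi)^-1)%:C * expi ((m j)%:~R * t) * iter_integral m js G [eta y with j |-> t] +
   -1 * (((2 * pi)^-1)%:C * expi ((m j)%:~R * t) * iter_integral m js (trigsum s) [eta y with j |-> t])
  = ((2 * pi)^-1)%:C * expi ((m j)%:~R * t) *
    (iter_integral m js G [eta y with j |-> t] - iter_integral m js (trigsum s) [eta y with j |-> t]).
  by ring.
apply: le_trans (N1M _ _) _; apply: ler_pM; rewrite ?N1_ge0 //; last exact: IH.
have hp : 0 <= (2 * pi)^-1 :> R by rewrite invr_ge0 mulr_ge0 // ltW.
apply: le_trans (N1M _ _) _; rewrite N1_real ger0_norm //.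
exact: (ler_pM hp (N1_ge0 _) (lexx _) (N1_expi _)).
Qed.

(** The integrals of the approximating sums are all equal to [V] from [M0] on while the error tends
    to zero, so the value is exact. *)
Lemma iter_integral_limit m G (s : nat -> seq (R[i] * ('I_N -> int))) (A r : R) V M0 :
  0 <= r -> r < 1 -> 0 <= A ->
  (forall M y, N1 (G y - trigsum (s M) y) <= A * r ^+ M) ->
  (forall M, (M0 <= M)%N -> \sum_(u <- s M | [forall l, u.2 l == - m l]) u.1 = V) ->
  iter_integral m (enum 'I_N) G (fun=> 0) = V.
Proof.
move=> r0 r1 A0 hG hV.
have small B e : 0 <= B -> 0 < e -> exists2 M, (M0 <= M)%N & B * r ^+ M <= e.
  move=> B0 e0; have /cvgrPdist_le/(_ _ e0) : (fun M => B * r ^+ M) @ \oo --> (0 : R).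
    rewrite -(mulr0 B); apply: cvgMr; apply: cvg_expr; by rewrite ger0_norm.
  move=> [K _ hK]; exists (maxn K M0); first exact: leq_maxr.
  have := hK (maxn K M0) (leq_maxl _ _); rewrite /= sub0r normrN.
  by rewrite ger0_norm // mulr_ge0 // exprn_ge0.
have hap : trig_approximable G.
  by move=> e e0; have [M _ hM] := small A e A0 e0; exists (s M) => y; apply: le_trans (hG M y) hM.
apply/eqP; rewrite -subr_eq0; apply/eqP; apply: N1_eq0; apply/eqP.
rewrite eq_le N1_ge0 andbT leNgt; apply/negP => h0.
set K : R := 4 ^+ size (enum 'I_N).
have K0 : 0 <= K by rewrite exprn_ge0.
have [M hM1 hM2] := small (K * A) _ (mulr_ge0 K0 A0) (divr_gt0 h0 (ltr0Sn _ 1)).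
have := iter_integral_approx m (enum 'I_N) hap (hG M) (fun=> 0).
rewrite iter_integral_coef hV // -/K mulrA => h.
by have := le_trans h hM2; lra.
Qed.

Lemma iter_integral_eq0 m js G :
  (forall y, (forall j, - pi <= y j <= pi) -> G y = 0) ->
  forall y, (forall j, - pi <= y j <= pi) -> iter_integral m js G y = 0.
Proof.
move=> hG; elim: js => [|j js IH] y hy /=; first exact: hG.
have h t : t \in (`[- pi, pi]%classic : set R) ->
    ((2 * pi)^-1)%:C * expi ((m j)%:~R * t) * iter_integral m js G [eta y with j |-> t] = 0.
  rewrite inE /= in_itv /= => ht; rewrite IH ?mulr0 // => l /=.
  by case: eqP.
rewrite /cintegral; apply: complex_eqP => /=.
  by under eq_Rintegral => t ht do rewrite h //=; rewrite Rintegral_cst ?mul0r.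
by under eq_Rintegral => t ht do rewrite h //=; rewrite Rintegral_cst ?mul0r.
Qed.

End IteratedIntegral.

Section GeometricApproximation.
Variables (R : realType) (V : Type).
Implicit Types (G H : V -> R[i]) (S T : nat -> V -> R[i]).

(** Uniform approximation at a geometric rate. The bound on [G] is included to make the notion
    stable under products. *)
Definition geo_approx G T : Prop := exists A r : R, [/\ 0 <= r, r < 1, 0 <= A &
  forall M y, N1 (G y - T M y) <= A * r ^+ M /\ N1 (G y) <= A].

Lemma geo_approx1 : geo_approx (fun=> 1) (fun _ _ => 1).
Proof.
exists 1, 0; split => // M y; rewrite subrr N1_0 mul1r exprn_ge0 //.
by split => //; rewrite (N1_real 1) normr1.
Qed.

Lemma geo_approxM G H S T : geo_approx G S -> geo_approx H T ->
  geo_approx (fun y => G y * H y) (fun M y => S M y * T M y).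
Proof.
move=> [A [r [r0 r1 A0 hG]]] [B [q [q0 q1 B0 hH]]].
have hm : 0 <= Num.max r q by rewrite le_max r0.
(* Since [N1 (T M y) <= 2 B], the two parts of the error of the product contribute [A B] and
   [2 A B]. *)
exists (3 * A * B), (Num.max r q); split => //.
- by rewrite gt_max r1.
- by rewrite !mulr_ge0.
move=> M y; have [hG1 hG2] := hG M y; have [hH1 hH2] := hH M y.
have h1 : r ^+ M <= Num.max r q ^+ M by rewrite lerXn2r ?nnegrE // le_max lexx.
have h2 : q ^+ M <= Num.max r q ^+ M by rewrite lerXn2r ?nnegrE // le_max lexx orbT.
set t := Num.max r q ^+ M in h1 h2 *.
have q1M : q ^+ M <= 1 by rewrite exprn_ile1 // ltW.
have hT : N1 (T M y) <= 2 * B.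
  have -> : T M y = H y + - (H y - T M y) by ring.
  apply: le_trans (N1D _ _) _; rewrite N1N mulrDl mul1r lerD //.
  by apply: le_trans hH1 _; rewrite ler_piMr.
split; last first.
  apply: le_trans (N1M _ _) _; apply: le_trans (ler_pM _ _ hG2 hH2) _; rewrite ?N1_ge0 //.
  by rewrite -mulrA ler_peMl ?mulr_ge0 // ler1n.
have -> : G y * H y - S M y * T M y = G y * (H y - T M y) + (G y - S M y) * T M y by ring.
apply: le_trans (N1D _ _) _.
have -> : 3 * A * B * t = A * (B * t) + (A * t) * (2 * B) by ring.
apply: lerD; apply: le_trans (N1M _ _) _; apply: ler_pM; rewrite ?N1_ge0 //.
- by apply: le_trans hH1 _; apply: ler_wpM2l.
- by apply: le_trans hG1 _; apply: ler_wpM2l.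
Qed.

Lemma geo_approx_prod (I : Type) (s : seq I) (G : I -> V -> R[i]) (T : I -> nat -> V -> R[i]) :
  (forall i, geo_approx (G i) (T i)) ->
  geo_approx (fun y => \prod_(i <- s) G i y) (fun M y => \prod_(i <- s) T i M y).
Proof.
move=> h; elim: s => [|i s IH].
  under eq_fun do rewrite big_nil.
  by under [X in geo_approx _ X]eq_fun do under eq_fun do rewrite big_nil; exact: geo_approx1.
under eq_fun do rewrite big_cons.
by under [X in geo_approx _ X]eq_fun do under eq_fun do rewrite big_cons; exact: geo_approxM.
Qed.

Lemma geo_approx_one_sub_pow (s q : R) (t : V -> R) : 0 <= q -> q < 1 ->
  geo_approx (fun y => one_sub_pow s (q%:C * expi (t y)))
    (fun M y => \sum_(k < M) (gbinom s k)%:C * (- (q%:C * expi (t y))) ^+ k).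
Proof.
move=> q0 q1; have [A [r [r0 r1 A0 h]]] := one_sub_pow_approx s q0 q1.
exists A, r; split => // M y; split; first exact: h.
by have := h 0%N (t y); rewrite big_ord0 subr0 expr0 mulr1.
Qed.

End GeometricApproximation.

(** * The regularized integral evaluated as a polynomial *)

Section KernelExpansion.
Variables (R : realType) (N : nat) (lam : R).
Implicit Types (m : 'I_N -> int) (x y : 'I_N -> R).

Definition kernel_trunc eps x (M : nat) y : R[i] :=
  (\prod_(p : idx_pair N) \sum_(k < M) (gbinom lam k)%:C *
     (- ((expR (- ((pair_snd p - pair_fst p)%N%:R * eps)))%:C
        * expi (y (pair_fst p) - y (pair_snd p)))) ^+ k)
  * \prod_(j < N) \prod_(k < N) \sum_(i < M) (gbinom (- lam) i)%:C *
      (- ((expR (- ((j.+1)%:R * eps)))%:C * expi (x k - y j))) ^+ i.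

Lemma P_kernel_approx eps x : 0 < eps ->
  geo_approx (P_kernel lam eps x) (kernel_trunc eps x).
Proof.
move=> e0; have hq (k : nat) : (0 < k)%N -> expR (- (k%:R * eps)) < 1 :> R.
  by move=> k0; rewrite -[X in _ < X]expR0 ltr_expR oppr_lt0 mulr_gt0 // ltr0n.
apply: geo_approxM.
  apply: geo_approx_prod => p; apply: geo_approx_one_sub_pow; first exact: expR_ge0.
  by apply: hq; rewrite subn_gt0 ltn_pair.
apply: geo_approx_prod => j; apply: geo_approx_prod => k.
by apply: geo_approx_one_sub_pow; [exact: expR_ge0|exact: hq].
Qed.

Lemma gbinom_rising (s : R) k : (gbinom s k)%:C * (-1) ^+ k = rising (- s%:C) k.
Proof.
rewrite /gbinom /rising real_complexM mulrAC; congr (_ * _).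
  have -> : (-1) ^+ k = \prod_(i < k) (-1 : R[i]) by rewrite prodr_const card_ord.
  rewrite (rmorph_prod (real_complex R)) -big_split /=.
  by apply: eq_bigr => i _; rewrite rmorphB rmorph_nat mulrN1 opprB addrC.
by rewrite fmorphV rmorph_nat.
Qed.

(** A term of the expanded kernel is indexed by [t = (mu, nu)], the exponents of the numerator and
    denominator factors; [kcoef] is its coefficient and [kexpo] its frequency in [y]. *)
Definition kcoef eps x M (t : {ffun idx_pair N -> 'I_M} * {ffun 'I_N -> {ffun 'I_N -> 'I_M}}) : R[i] :=
  (\prod_p (rising (- lam%:C) (t.1 p)
     * (expR (- ((pair_snd p - pair_fst p)%N%:R * eps)))%:C ^+ t.1 p))
  * \prod_j \prod_i (rising lam%:C (t.2 j i)
     * ((expR (- (j.+1%:R * eps)))%:C * expi (x i)) ^+ t.2 j i).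

Definition kexpo M (t : {ffun idx_pair N -> 'I_M} * {ffun 'I_N -> {ffun 'I_N -> 'I_M}}) : 'I_N -> int :=
  fun l => vecmu [ffun p => val (t.1 p)] l - (\sum_i t.2 l i)%N%:Z.

Lemma wave_kexpo M t y : wave (@kexpo M t) y =
  (\prod_p expi (y (pair_fst p) - y (pair_snd p)) ^+ t.1 p)
  * \prod_j \prod_i expi (- y j) ^+ t.2 j i.
Proof.
under eq_bigr do rewrite -expiMn.
under [X in _ * X]eq_bigr do under eq_bigr do rewrite -expiMn.
under [X in _ * X]eq_bigr do rewrite -expi_sum.
rewrite -!expi_sum -expiD /wave -expi_sum; congr expi.
under eq_bigr do rewrite /kexpo intrB mulrBl.
rewrite big_split /=; congr (_ + _); last first.
  by apply: eq_bigr => j _; rewrite -mulr_suml mulrN -natr_sum pmulrn.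
under eq_bigr do rewrite vecmuE rmorph_sum mulr_suml.
rewrite exchange_big; apply: eq_bigr => p _ /=; rewrite ffunE.
rewrite -(sum_posroot y p) mulr_sumr; apply: eq_bigr => l _.
by rewrite intrM -mulrA [X in _ * X]mulrzl.
Qed.

Definition kseq eps x M : seq (R[i] * ('I_N -> int)) :=
  [seq (kcoef eps x t, kexpo t)
     | t : {ffun idx_pair N -> 'I_M} * {ffun 'I_N -> {ffun 'I_N -> 'I_M}}].

Lemma kernel_truncE eps x M y : kernel_trunc eps x M y = trigsum (kseq eps x M) y.
Proof.
have tE s (q : R) (u : R) k : (gbinom s k)%:C * (- (q%:C * expi u)) ^+ k
    = (rising (- s%:C) k * q%:C ^+ k) * expi u ^+ k.
  rewrite -gbinom_rising -[- (q%:C * _)]mulN1r !exprMn -!mulrA; done.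
rewrite /kernel_trunc /trigsum /kseq big_map big_enum.
transitivity ((\sum_(mu : {ffun idx_pair N -> 'I_M}) \prod_p
    (rising (- lam%:C) (mu p) * (expR (- ((pair_snd p - pair_fst p)%N%:R * eps)))%:C ^+ mu p
      * expi (y (pair_fst p) - y (pair_snd p)) ^+ mu p))
  * \sum_(nu : {ffun 'I_N -> {ffun 'I_N -> 'I_M}}) \prod_j \prod_i
    (rising lam%:C (nu j i) * ((expR (- (j.+1%:R * eps)))%:C * expi (x i)) ^+ nu j i
      * expi (- y j) ^+ nu j i)).
  congr (_ * _).
    rewrite -(bigA_distr_bigA (fun p (k : 'I_M) => rising (- lam%:C) k
      * (expR (- ((pair_snd p - pair_fst p)%N%:R * eps)))%:C ^+ k
      * expi (y (pair_fst p) - y (pair_snd p)) ^+ k)); apply: eq_bigr => p _; apply: eq_bigr => k _; exact: tE.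
  rewrite -(bigA_distr_bigA (fun (j : 'I_N) (k : {ffun 'I_N -> 'I_M}) => \prod_i
    (rising lam%:C (k i) * ((expR (- (j.+1%:R * eps)))%:C * expi (x i)) ^+ k i
      * expi (- y j) ^+ k i))).
  apply: eq_bigr => j _; rewrite -(bigA_distr_bigA (fun (i : 'I_N) (k : 'I_M) =>
    (rising lam%:C k * ((expR (- (j.+1%:R * eps)))%:C * expi (x i)) ^+ k
      * expi (- y j) ^+ k))).
  apply: eq_bigr => i _; apply: eq_bigr => k _; rewrite tE rmorphN opprK.
  by rewrite expiD !exprMn !mulrA.
rewrite big_distrlr /= pair_big /=; apply: eq_bigr => t _.
rewrite wave_kexpo /kcoef [RHS]mulrACA -!big_split /=; congr (_ * _).
by apply: eq_bigr => j _; rewrite -big_split.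
Qed.

(** On the terms of frequency [- m], which survive the integration, the powers of the regulators
    combine by [sum_weight_vecmu] into a factor independent of [t]. *)
Lemma kcoef_eps eps x m M (t : {ffun idx_pair N -> 'I_M} * {ffun 'I_N -> {ffun 'I_N -> 'I_M}}) :
  [forall l, kexpo t l == - m l] ->
  kcoef eps x t = (expR (- ((\sum_(j < N) j.+1%:Z * m j)%:~R * eps)))%:C *
    ((\prod_p rising (- lam%:C) (t.1 p)) *
     \prod_j \prod_i (rising lam%:C (t.2 j i) * expi (x i) ^+ t.2 j i)).
Proof.
move=> /forallP ht.
have hl l : (\sum_i t.2 l i)%N%:Z = m l + vecmu [ffun p => val (t.1 p)] l.
  by have := ht l; rewrite /kexpo subr_eq eq_sym [X in X == _]addrC subr_eq [X in _ == X]addrC => /eqP.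
have qE (k : nat) (i : nat) : (expR (- (k%:R * eps)))%:C ^+ i = (expR (- ((k * i)%N%:R * eps)))%:C :> R[i].
  by rewrite -real_complexX -expRM_natl natrM; congr (expR _)%:C; ring.
rewrite /kcoef big_split /=.
under [X in _ * X = _]eq_bigr do under eq_bigr do rewrite exprMn mulrCA qE.
under [X in _ * X = _]eq_bigr do rewrite big_split /=.
rewrite [X in _ * X = _]big_split /=.
under [X in _ * X * _ = _]eq_bigr do rewrite qE.
rewrite [X in _ * (X * _) = _](_ : _ = (expR (- ((\sum_(j < N) (j.+1 * \sum_i t.2 j i))%N%:R * eps)))%:C); last first.
  rewrite natr_sum mulr_suml -sumrN expR_sum (rmorph_prod (real_complex R)).
  apply: eq_bigr => j _; rewrite big_distrr /= natr_sum mulr_suml -sumrN expR_sum.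
  by rewrite (rmorph_prod (real_complex R)).
rewrite [X in _ * X * _ = _](_ : _ = (expR (- ((\sum_p ((pair_snd p - pair_fst p) * t.1 p))%N%:R * eps)))%:C); last first.
  by rewrite natr_sum mulr_suml -sumrN expR_sum (rmorph_prod (real_complex R)).
set P := \prod_p _; set Q := \prod_j _; set S1 := (_ * eps); set S2 := (_ * eps); set S3 := (_ * eps).
have -> : - S3 = - S1 - S2.
  rewrite /S1 /S2 /S3 -opprD -mulrDl; congr (- (_ * _)).
  rewrite -natrD pmulrn; congr (_%:~R); rewrite PoszD.
  have := sum_weight_vecmu [ffun p => val (t.1 p)] => hw.
  transitivity (\sum_(j < N) j.+1%:Z * (m j + vecmu [ffun p => val (t.1 p)] j)
     + \sum_(p : idx_pair N) ((pair_snd p - pair_fst p) * t.1 p)%N%:Z).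
    under [X in _ = X + _]eq_bigr do rewrite mulrDr.
    rewrite big_split /= hw; under [X in _ = _ - X + _]eq_bigr do rewrite ffunE.
    by rewrite subrK.
  rewrite addrC; congr (_ + _).
    by rewrite -(big_morph Posz PoszD (erefl _)).
  rewrite (big_morph Posz PoszD (erefl _)); apply: eq_bigr => j _.
  by rewrite -hl PoszM.
by rewrite expRD real_complexM; ring.
Qed.

Lemma sum_kcoef eps x m M :
  let mf : {ffun 'I_N -> int} := [ffun j => m j] in
  (`|height mf| < M)%N -> (`|(\sum_j mf j)%R| < M)%N ->
  \sum_(u <- kseq eps x M | [forall l, u.2 l == - m l]) u.1
  = (expR (- ((\sum_(j < N) j.+1%:Z * m j)%:~R * eps)))%:C
    * mpoly.meval (fun j => expi (x j)) (Ppol lam%:C mf).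
Proof.
move=> mf h1 h2; rewrite (meval_Ppol_ord _ _ h1 h2) /kseq big_map big_enum_cond /=.
rewrite (eq_bigr _ (fun t ht => kcoef_eps eps x (m := m) ht)) -mulr_sumr; congr (_ * _).
rewrite pair_big_dep /=; apply: eq_bigl => t /=; apply: eq_forallb => l.
rewrite /kexpo ffunE subr_eq eq_sym [X in X == _]addrC subr_eq [X in _ == X]addrC.
by [].
Qed.

Lemma iter_integral_kernel eps x m : 0 < eps ->
  iter_integral m (enum 'I_N) (P_kernel lam eps x) (fun=> 0)
  = (expR (- ((\sum_(j < N) j.+1%:Z * m j)%:~R * eps)))%:C
    * mpoly.meval (fun j => expi (x j)) (Ppol lam%:C [ffun j => m j]).
Proof.
move=> e0; have [A [r [r0 r1 A0 h]]] := P_kernel_approx x e0.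
set mf : {ffun 'I_N -> int} := [ffun j => m j].
apply: (@iter_integral_limit _ _ m _ (kseq eps x) A r _
  (maxn `|height mf|.+1 `|(\sum_j mf j)%R|.+1)) => // [M y|M].
  by rewrite -kernel_truncE; have [] := h M y.
rewrite geq_max => /andP [h1 h2]; exact: sum_kcoef.
Qed.

(** For each [eps > 0] the integral is exactly the polynomial value times
    [exp (- eps \sum_j j m_j)], and the limit only removes this factor. *)
Lemma P_funE x m :
  P_fun lam m x = mpoly.meval (fun j => expi (x j)) (Ppol lam%:C [ffun j => m j]).
Proof.
set V := mpoly.meval _ _; set w : R := (\sum_(j < N) j.+1%:Z * m j)%:~R.
have cv (c : R) : (expR (- (w * e)) * c) @[e --> 0^'+] --> c.
  suff : (expR (- (w * e)) * c) @[e --> (0 : R)] --> expR (- (w * 0)) * c.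
    by rewrite mulr0 oppr0 expR0 mul1r => ?; apply: cvg_at_right_filter.
  apply: cvgM; last exact: cvg_cst.
  apply: (@continuous_comp _ _ _ (fun e => - (w * e)) expR); last exact: continuous_expR.
  by apply: cvgN; apply: cvgM; [exact: cvg_cst|exact: cvg_id].
have lim_eq (p : R[i] -> R) : (forall (a : R) z, p (a%:C * z) = a * p z) ->
    lim ((fun e => p (iter_integral m (enum 'I_N) (P_kernel lam e x) (fun=> 0))) e @[e --> 0^'+]) = p V.
  move=> hp; apply: cvg_lim => //.
  apply: cvg_trans (cv (p V)); apply: near_eq_cvg.
  near=> e; rewrite iter_integral_kernel ?hp //.
rewrite /P_fun /clim_at_right0; apply: complex_eqP; rewrite /= lim_eq // => a z.
  by rewrite creM /= mul0r subr0.
by rewrite cimM /= mul0r addr0.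
Unshelve. all: by end_near.
Qed.

End KernelExpansion.

(** * Density of the torus *)

Section TorusDensity.
Variables (R : realType) (N : nat).
Implicit Types (x : 'I_N -> R).

Definition zof_angles x : 'I_N -> R[i] := fun j => expi (x j).

Definition torus_cube (z : 'I_N -> R[i]) : Prop :=
  exists2 x, (forall j, - pi <= x j <= pi) & z = zof_angles x.

(** The coefficients of a polynomial are its Fourier coefficients, hence iterated integrals of its
    values on the cube. *)
Lemma zariski_dense_torus_cube : zariski_dense torus_cube.
Proof.
move=> p hp; apply/mpolyP => m; rewrite mcoeff0.
pose s : seq (R[i] * ('I_N -> int)) := [seq (mcoeff m' p, (fun l => Posz (fun_of_multinom m' l))) | m' <- msupp p].
(* Integration against the plane wave of [mi] selects the frequency [- mi], hence the sign. *)
pose mi : 'I_N -> int := fun l => - Posz (fun_of_multinom m l).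
have hs y : trigsum s y = meval (zof_angles y) p.
  rewrite mevalE /trigsum big_map; apply: eq_bigr => m' _.
  by congr (_ * _); apply: eq_bigr => l _; rewrite /zof_angles -expiMn.
have h0 : iter_integral mi (enum 'I_N) (trigsum s) (fun=> 0) = 0.
  apply: iter_integral_eq0 => [y hy|_].
    by rewrite hs; apply: hp; exists y.
  by have := pi_gt0 R; lra.
rewrite -h0 iter_integral_coef big_map /=.
have e (m' : multinom N) : [forall l, Posz (fun_of_multinom m' l) == - mi l] = (m' == m).
  apply/forallP/eqP => [h|-> l]; last by rewrite opprK.
  by apply/mnmP => l; have := h l; rewrite opprK => /eqP [].
under eq_bigl do rewrite e.
have [mp|mp] := boolP (m \in msupp p).
  by rewrite (big_rem m) //= eqxx big1_seq ?addr0 // => m' /andP [/eqP ->]; rewrite (mem_rem_uniqF _ (msupp_uniq p)).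
rewrite big1_seq; first by apply/eqP; rewrite mcoeff_eq0.
by move=> m' /andP [/eqP -> h]; rewrite h in mp.
Qed.

Lemma expi_sub (a b : R) :
  expi a - expi b = expi ((a + b) / 2) * (0 +i* (2 * sin ((a - b) / 2))).
Proof.
have -> : expi a = expi ((a + b) / 2) * expi ((a - b) / 2).
  by rewrite -expiD; congr expi; field.
have -> : expi b = expi ((a + b) / 2) * expi (- ((a - b) / 2)).
  by rewrite -expiD; congr expi; field.
rewrite -mulrBr; congr (_ * _); apply: complex_eqP; rewrite ?creD ?cimD ?creN ?cimN /=.
  by rewrite cosN subrr.
by rewrite sinN; ring.
Qed.

Lemma expi_eq (a b : R) : (expi a == expi b) = (sin ((a - b) / 2) == 0).
Proof.
rewrite -subr_eq0 expi_sub mulf_eq0 (negPf (expi_neq0 _)) /= eq_complex /= eqxx /=.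
by rewrite mulf_eq0 pnatr_eq0.
Qed.

Lemma config_inj x : config x -> forall k l, k != l -> zof_angles x k != zof_angles x l.
Proof.
move=> [_ hx] k l; rewrite -(inj_eq val_inj) /= neq_ltn => /orP [h|h].
  by rewrite expi_eq; exact: (hx (exist _ (k, l) h)).
by rewrite eq_sym expi_eq; exact: (hx (exist _ (l, k) h)).
Qed.

Lemma vandermonde_neq0 (C : numFieldType) : @vandermonde N C predT != 0.
Proof.
apply/eqP => h; have := @meval_vandermonde N C predT (fun j : 'I_N => j%:R).
rewrite h meval0 => /esym/eqP; rewrite prodf_seq_eq0 => /hasP [p _ /= ].
by rewrite subr_eq0 eqr_nat; have := ltn_pair p; case: ltngtP.
Qed.

(** The Vandermonde product vanishes on the cube outside [config]; without a witness its product
    with [p] would vanish on the whole cube. *)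
Lemma config_witness (p : mpoly N R[i]) : p != 0 ->
  exists2 x, config x & meval (zof_angles x) p != 0.
Proof.
move=> p0; apply: contrapT => no.
suff : p * @vandermonde N R[i] predT = 0.
  by move/eqP; rewrite mulf_eq0 (negPf p0) (negPf (vandermonde_neq0 _)).
apply: zariski_dense_torus_cube => z [x hx ->]; rewrite mevalM meval_vandermonde.
have [cx|ncx] := pselect (config x).
  case: (eqVneq (meval (zof_angles x) p) 0) => [->|h]; first by rewrite mul0r.
  by case: no; exists x.
have [p1 /eqP hp1] : exists p1 : idx_pair N, sin ((x (pair_fst p1) - x (pair_snd p1)) / 2) == 0.
  apply: contrapT => h; apply: ncx; split => // p1; apply/negP => h1; apply: h; by exists p1.
rewrite (bigD1 p1) //= [X in _ * (X * _)](_ : _ = 0) ?mul0r ?mulr0 //.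
by apply/eqP; rewrite subr_eq0 expi_eq hp1.
Qed.

End TorusDensity.

Lemma zariski_dense_full (R : realType) M : @zariski_dense M R[i] (fun _ => True).
Proof. by move=> p hp; apply: zariski_dense_torus_cube => z _; apply: hp. Qed.

(** * Derivatives, and conjugation of the Hamiltonian by the ground state *)

Section ComplexDerivative.
Variable R : realType.
Implicit Types (g h : R -> R[i]) (t : R) (c d : R[i]).

Definition is_cder g t d : Prop :=
  is_derive t 1 (fun s => complex.Re (g s)) (complex.Re d) /\
  is_derive t 1 (fun s => complex.Im (g s)) (complex.Im d).

Lemma is_cder_cderivable g t d : is_cder g t d -> cderivable g t.
Proof. by move=> [[h1 _] [h2 _]]. Qed.

Lemma is_cder_cderive1 g t d : is_cder g t d -> cderive1 g t = d.
Proof.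
move=> [h1 h2]; rewrite /cderive1 !derive1E.
by rewrite (@derive_val _ _ _ _ _ _ _ h1) (@derive_val _ _ _ _ _ _ _ h2); case: d h1 h2.
Qed.

Lemma is_cder_eq g t c d : is_cder g t c -> c = d -> is_cder g t d.
Proof. by move=> h <-. Qed.

Lemma near_is_cder g h t d : (\forall s \near t, h s = g s) -> is_cder h t d -> is_cder g t d.
Proof.
move=> hn [h1 h2]; split.
  by apply: near_eq_is_derive h1; apply: filterS hn => s ->.
by apply: near_eq_is_derive h2; apply: filterS hn => s ->.
Qed.

Lemma is_cder_cst c t : is_cder (fun=> c) t 0.
Proof. by split; exact: is_derive_cst. Qed.

Lemma is_cder_real (f : R -> R) t a : is_derive t 1 f a -> is_cder (fun s => (f s)%:C) t a%:C.
Proof. by move=> h; split => //=; exact: is_derive_cst. Qed.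

Lemma is_cderD g h t c d : is_cder g t c -> is_cder h t d ->
  is_cder (fun s => g s + h s) t (c + d).
Proof.
move=> [g1 g2] [h1 h2]; split; [under eq_fun do rewrite creD|under eq_fun do rewrite cimD].
  by rewrite creD; exact: is_deriveD.
by rewrite cimD; exact: is_deriveD.
Qed.

Lemma is_cderM g h t c d : is_cder g t c -> is_cder h t d ->
  is_cder (fun s => g s * h s) t (c * h t + g t * d).
Proof.
move=> [g1 g2] [h1 h2]; split; [under eq_fun do rewrite creM|under eq_fun do rewrite cimM].
  apply: is_derive_eq (is_deriveB (is_deriveM g1 h1) (is_deriveM g2 h2)) _.
  by rewrite creD !creM /= /GRing.scale /=; ring.
apply: is_derive_eq (is_deriveD (is_deriveM g1 h2) (is_deriveM g2 h1)) _.
by rewrite cimD !cimM /= /GRing.scale /=; ring.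
Qed.

Lemma is_cderZ c g t d : is_cder g t d -> is_cder (fun s => c * g s) t (c * d).
Proof. by move=> h; apply: is_cder_eq (is_cderM (is_cder_cst c t) h) _; rewrite mul0r add0r. Qed.

Lemma is_cder_sum (I : Type) (s : seq I) (G : I -> R -> R[i]) t (d : I -> R[i]) :
  (forall i, is_cder (G i) t (d i)) ->
  is_cder (fun u => \sum_(i <- s) G i u) t (\sum_(i <- s) d i).
Proof.
move=> hG; elim: s => [|i s IH].
  by rewrite big_nil; under eq_fun do rewrite big_nil; exact: is_cder_cst.
by rewrite big_cons; under eq_fun do rewrite big_cons; exact: is_cderD.
Qed.

(** Logarithmic form of the product rule. *)
Lemma is_cder_prod (I : Type) (s : seq I) (G : I -> R -> R[i]) t (l : I -> R[i]) :
  (forall i, is_cder (G i) t (l i * G i t)) ->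
  is_cder (fun u => \prod_(i <- s) G i u) t ((\sum_(i <- s) l i) * \prod_(i <- s) G i t).
Proof.
move=> hG; elim: s => [|i s IH].
  by rewrite !big_nil mul0r; under eq_fun do rewrite big_nil; exact: is_cder_cst.
rewrite !big_cons; under eq_fun do rewrite big_cons.
by apply: is_cder_eq (is_cderM (hG i) IH) _; ring.
Qed.

Lemma is_cder_comp g (f : R -> R) t a d : is_derive t 1 f a -> is_cder g (f t) d ->
  is_cder (fun s => g (f s)) t (a%:C * d).
Proof.
move=> hf [h1 h2]; split.
  apply: is_derive_eq (is_derive1_comp h1 hf) _.
  by rewrite creM /= mul0r subr0 mulrC.
apply: is_derive_eq (is_derive1_comp h2 hf) _.
by rewrite cimM /= mul0r addr0 mulrC.
Qed.

Lemma is_cder_expi t : is_cder (@expi R) t ((0 +i* 1) * expi t).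
Proof.
split; rewrite ?creM ?cimM /=.
  by rewrite mul0r mul1r sub0r; exact: is_derive_cos.
by rewrite mul0r mul1r add0r; exact: is_derive_sin.
Qed.

Lemma is_derive_linear (k t : R) : is_derive t 1 (fun s => k * s) k.
Proof. by rewrite -[X in is_derive _ _ _ X]mulr1; apply: is_deriveZ. Qed.

Lemma is_cder_wave (k t : R) : is_cder (fun s => expi (k * s)) t ((0 +i* 1) * (k%:C * expi (k * t))).
Proof.
by apply: is_cder_eq (is_cder_comp (is_derive_linear k t) (is_cder_expi _)) _; rewrite mulrCA.
Qed.

Definition cot_half (r : R) : R := cos (r / 2) / sin (r / 2).

Lemma is_derive_sin_half (r : R) : is_derive r 1 (fun s : R => sin (s / 2)) (cos (r / 2) / 2).
Proof.
have h : is_derive r 1 (fun s : R => s / 2) 2^-1.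
  by under eq_fun do rewrite mulrC; exact: is_derive_linear.
exact: (is_derive1_comp (is_derive_sin _) h).
Qed.

Lemma is_derive_cos_half (r : R) : is_derive r 1 (fun s : R => cos (s / 2)) (- (sin (r / 2) / 2)).
Proof.
have h : is_derive r 1 (fun s : R => s / 2) 2^-1.
  by under eq_fun do rewrite mulrC; exact: is_derive_linear.
by apply: is_derive_eq (is_derive1_comp (is_derive_cos _) h) _; rewrite mulNr.
Qed.

Lemma is_derive_cot_half (r : R) : sin (r / 2) != 0 ->
  is_derive r 1 cot_half (- (2 * sin (r / 2) ^+ 2)^-1).
Proof.
move=> s0.
apply: is_derive_eq (is_deriveM (is_derive_cos_half r) (is_deriveV s0 (is_derive_sin_half r))) _.
have := cos2Dsin2 (r / 2); set c := cos _; set s := sin _ => h.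
have -> : (2 * s ^+ 2)^-1 = (c ^+ 2 + s ^+ 2) * (2 * s ^+ 2)^-1 by rewrite h mul1r.
by rewrite /GRing.scale /=; field.
Qed.

Lemma powR_pred (s lam : R) : 0 < s -> s `^ lam = s `^ (lam - 1) * s.
Proof.
move=> s0; rewrite -[X in _ = _ * X](powRr1 (ltW s0)) -powRD ?subrK //.
by rewrite (gt_eqF s0) implybT.
Qed.

Lemma near_sin_half (r : R) (P : R -> bool) :
  (forall u : R, P u -> \forall v \near u, P v) ->
  P (sin (r / 2)) -> \forall s \near r, P (sin (s / 2)).
Proof.
move=> hP /hP.
have : {for r, continuous (fun s : R => sin (s / 2))}.
  apply: differentiable_continuous; apply/derivable1_diffP.
  by have [] := is_derive_sin_half r.
by move=> /(_ _) hc /hc.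
Qed.

(** Away from the zeros of the sine the phase is locally constant, so the logarithmic derivative is
    [(lam / 2) cot (r / 2)] for either sign. *)
Lemma is_cder_sin_half_pow (lam r : R) : sin (r / 2) != 0 ->
  is_cder (sin_half_pow lam) r ((lam / 2 * cot_half r)%:C * sin_half_pow lam r).
Proof.
move=> s0; case: (ltgtP 0 (sin (r / 2))) s0 => // [sp|sn] _.
  apply: (@near_is_cder _ (fun s => (sin (s / 2) `^ lam)%:C)).
    apply: filterS (@near_sin_half r (fun u => 0 < u) _ sp) => [s hs|u u0].
      by rewrite /sin_half_pow ltW.
    exact: lt_nbhsr.
  apply: is_cder_eq (is_cder_real (is_derive1_comp (is_derive1_powR _ sp) (is_derive_sin_half r))) _.
  rewrite /sin_half_pow ltW // -real_complexM; congr (_%:C).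
  by rewrite (powR_pred lam sp) /cot_half; field; rewrite gt_eqF.
have np : 0 < - sin (r / 2) by rewrite oppr_gt0.
apply: (@near_is_cder _ (fun s => expi (pi * lam) * ((- sin (s / 2)) `^ lam)%:C)).
  apply: filterS (@near_sin_half r (fun u => u < 0) _ sn) => [s hs|u u0].
    by rewrite /sin_half_pow leNgt hs.
  exact: lt_nbhsl.
have dN : is_derive r 1 (fun s : R => - sin (s / 2)) (- (cos (r / 2) / 2)).
  exact: is_deriveN (is_derive_sin_half r).
have dP : is_derive r 1 (fun s : R => (- sin (s / 2)) `^ lam)
    (lam * (- sin (r / 2)) `^ (lam - 1) * - (cos (r / 2) / 2)).
  have := @is_derive1_comp _ (fun u : R => u `^ lam) (fun s : R => - sin (s / 2)) r _ _
    (is_derive1_powR lam np) dN.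
  by [].
apply: is_cder_eq (is_cderZ _ (is_cder_real dP)) _.
rewrite /sin_half_pow leNgt sn /= mulrCA -real_complexM; congr (_ * _%:C).
by rewrite (powR_pred lam np) /cot_half; field; rewrite lt_eqF.
Qed.

End ComplexDerivative.

Section Hamiltonian.
Variables (R : realType) (N : nat) (lam : R).
Implicit Types (x : 'I_N -> R) (p : mpoly N R[i]) (j : 'I_N).

Let im1 : R[i] := 0 +i* 1.

Definition pval p x : R[i] := meval (zof_angles x) p.

Lemma is_cder_pval p x j : is_cder (slice (pval p) x j) (x j) (im1 * pval (theta j p) x).
Proof.
pose w (m : multinom N) : 'I_N -> int := fun l => Posz (fun_of_multinom m l).
have pE q y : pval q y = \sum_(m <- msupp q) mcoeff m q * wave (w m) y.
  rewrite /pval mevalE; apply: eq_bigr => m _.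
  by congr (_ * _); apply: eq_bigr => l _; rewrite /zof_angles -expiMn.
have tE y : pval (theta j p) y = \sum_(m <- msupp p) mcoeff m p * ((w m j)%:~R * wave (w m) y).
  rewrite {1}[p]mpolyE raddf_sum /pval rmorph_sum /=; apply: eq_bigr => m _.
  rewrite linearZ /= thetaX !mevalZ mevalX; congr (_ * (_ * _)).
  by apply: eq_bigr => l _; rewrite /zof_angles -expiMn.
rewrite tE mulr_sumr; have -> : slice (pval p) x j = fun t =>
    \sum_(m <- msupp p) (mcoeff m p * wave [eta w m with j |-> 0] x) * expi ((w m j)%:~R * t).
  apply/funext => t; rewrite /slice pE; apply: eq_bigr => m _.
  by rewrite wave_eta -mulrA; congr (_ * _); exact: mulrC.
apply: is_cder_sum => m; apply: is_cder_eq (is_cderZ _ (is_cder_wave _ _)) _.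
have -> : wave (w m) x = expi ((w m j)%:~R * x j) * wave [eta w m with j |-> 0] x.
  by rewrite -wave_eta; congr wave; apply/funext => l /=; case: eqP => [->|].
rewrite (rmorph_int (real_complex R)) -/im1; ring.
Qed.

Definition offdiag x : Prop :=
  forall p : idx_pair N, sin ((x (pair_fst p) - x (pair_snd p)) / 2) != 0.

Definition cotp x (p : idx_pair N) : R := cot_half (x (pair_fst p) - x (pair_snd p)).

(** The logarithmic derivative of [Psi0] in [x_j] ([is_cder_Psi0]). *)
Definition logd x j : R := \sum_(p : idx_pair N) (posroot p j)%:~R * (lam / 2 * cotp x p).

Definition dlogd x j : R := \sum_(p : idx_pair N)
  (posroot p j)%:~R ^+ 2 * (lam / 2 * - (2 * sin ((x (pair_fst p) - x (pair_snd p)) / 2) ^+ 2)^-1).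

Lemma slice_slice (f : ('I_N -> R) -> R[i]) x j t : slice f [eta x with j |-> t] j = slice f x j.
Proof.
apply/funext => s; rewrite /slice; congr f; apply/funext => l /=.
by case: eqP.
Qed.

Lemma slice_self (f : ('I_N -> R) -> R[i]) x j : slice f x j (x j) = f x.
Proof. by rewrite /slice; congr f; apply/funext => l /=; case: eqP => [->|]. Qed.

Lemma is_derive_diff x j (p : idx_pair N) (a b : 'I_N) (c : R) :
  c = (a == j)%:R - (b == j)%:R ->
  is_derive (x j) 1 (fun t : R => ([eta x with j |-> t] : 'I_N -> R) a
     - ([eta x with j |-> t] : 'I_N -> R) b) c.
Proof.
move=> ->; have h (l : 'I_N) : is_derive (x j) 1 (fun t : R => ([eta x with j |-> t] : 'I_N -> R) l) (l == j)%:R.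
  by move=> /=; case: eqP => _; [exact: is_derive_id|exact: is_derive_cst].
exact: is_deriveB.
Qed.

Lemma posrootR (p : idx_pair N) j :
  (posroot p j)%:~R = (pair_fst p == j)%:R - (pair_snd p == j)%:R :> R.
Proof. by rewrite ffunE rmorphB. Qed.

Lemma eta_self x j : ([eta x with j |-> x j] : 'I_N -> R) = x.
Proof. by apply/funext => l /=; case: eqP => [->|]. Qed.

Lemma cot_halfN (r : R) : cot_half (- r) = - cot_half r.
Proof. by rewrite /cot_half mulNr cosN sinN invrN mulrN. Qed.

Lemma is_cder_Psi0 x j : offdiag x ->
  is_cder (slice (Psi0 lam) x j) (x j) ((logd x j)%:C * Psi0 lam x).
Proof.
move=> hx; pose e t : 'I_N -> R := [eta x with j |-> t].
pose G (p : idx_pair N) t := sin_half_pow lam (e t (pair_snd p) - e t (pair_fst p)).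
pose l (p : idx_pair N) : R[i] := ((posroot p j)%:~R * (lam / 2 * cotp x p))%:C.
have ex : e (x j) = x by apply/funext => k; rewrite /e /=; case: eqP => [->|].
suff hG (p : idx_pair N) : is_cder (G p) (x j) (l p * G p (x j)).
  have := is_cder_prod (index_enum (idx_pair N)) hG.
  by rewrite /G ex -(rmorph_sum (real_complex R)).
have s0 : sin ((x (pair_snd p) - x (pair_fst p)) / 2) != 0.
  by rewrite -opprB mulNr sinN oppr_eq0; exact: hx.
have hc : - (posroot p j)%:~R = (pair_snd p == j)%:R - (pair_fst p == j)%:R :> R.
  by rewrite posrootR opprB.
have he := @is_derive_diff x j p _ _ _ hc.
have s1 : sin ((e (x j) (pair_snd p) - e (x j) (pair_fst p)) / 2) != 0 by rewrite ex.
apply: is_cder_eq (is_cder_comp he (is_cder_sin_half_pow lam s1)) _.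
rewrite mulrA -real_complexM /G /l /cotp ex; congr (_%:C * _).
by rewrite -[x (pair_snd p) - _]opprB cot_halfN; ring.
Qed.

Lemma is_derive_logd x j : offdiag x ->
  is_derive (x j) 1 (fun t => logd [eta x with j |-> t] j) (dlogd x j).
Proof.
move=> hx; rewrite /logd /dlogd.
have -> : (fun t => \sum_(p : idx_pair N) (posroot p j)%:~R * (lam / 2 * cotp [eta x with j |-> t] p))
   = (\sum_(p : idx_pair N) (fun t => (posroot p j)%:~R * (lam / 2 * cotp [eta x with j |-> t] p))).
  by apply/funext => t; rewrite fct_sumE.
elim/big_ind2: _ => [|f a g b hf hg|p _]; [exact: is_derive_cst|exact: is_deriveD|].
have s0 : sin ((x (pair_fst p) - x (pair_snd p)) / 2) != 0 by exact: hx.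
have hd := is_derive_diff x p (posrootR p j).
have hc : is_derive (x j) 1 (fun t => cotp [eta x with j |-> t] p)
    (- (2 * sin ((x (pair_fst p) - x (pair_snd p)) / 2) ^+ 2)^-1 * (posroot p j)%:~R).
  have h1 : is_derive (([eta x with j |-> x j] : 'I_N -> R) (pair_fst p)
      - ([eta x with j |-> x j] : 'I_N -> R) (pair_snd p)) 1 (@cot_half R)
      (- (2 * sin ((x (pair_fst p) - x (pair_snd p)) / 2) ^+ 2)^-1).
    by rewrite eta_self; exact: is_derive_cot_half.
  exact: (@is_derive1_comp _ (@cot_half R) (fun t => ([eta x with j |-> t] : 'I_N -> R) (pair_fst p)
      - ([eta x with j |-> t] : 'I_N -> R) (pair_snd p)) (x j) _ _ h1 hd).
apply: is_derive_eq (is_deriveZ _ (is_deriveZ _ hc)) _.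
by rewrite /GRing.scale /=; ring.
Qed.

Lemma near_offdiag x j : offdiag x -> \forall t \near x j, offdiag [eta x with j |-> t].
Proof.
move=> hx; pose e t : 'I_N -> R := [eta x with j |-> t].
suff hn (p : idx_pair N) : \forall t \near x j, sin ((e t (pair_fst p) - e t (pair_snd p)) / 2) != 0.
  exact: filter_forall hn.
have hd := is_derive_diff x p (posrootR p j).
have hs := @is_derive1_comp _ (fun s : R => sin (s / 2)) (fun t => ([eta x with j |-> t] : 'I_N -> R)
  (pair_fst p) - ([eta x with j |-> t] : 'I_N -> R) (pair_snd p)) (x j) _ _ (is_derive_sin_half _) hd.
have : {for x j, continuous (fun t : R => sin ((([eta x with j |-> t] : 'I_N -> R) (pair_fst p)
     - ([eta x with j |-> t] : 'I_N -> R) (pair_snd p)) / 2))}.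
  apply: differentiable_continuous; apply/derivable1_diffP.
  by have [] := hs.
move=> hc; apply: (hc (fun u => u != 0)).
have eE (l : 'I_N) : (if l == j then x j else x l) = x l by case: eqP => [->|].
rewrite /= !eE.
by apply: open_nbhs_nbhs; split; [exact: open_neq|exact: hx].
Qed.

End Hamiltonian.

Section GroundStateConstant.
Variables (C : numFieldType) (N : nat).

(** [rho] is the Weyl vector, half the sum of the positive roots. *)
Lemma sum_posroot_rho (j : 'I_N) : \sum_(p : idx_pair N) (posroot p j)%:~R = 2 * rho C j.
Proof.
have := sum_pair_posroot (fun _ _ => 1 : C) j.
under eq_bigr do rewrite mulr1; move=> ->.
have E k (kN : (k <= N)%N) : \sum_(c < N | (c < k)%N) (1 : C) = k%:R.
  by rewrite (big_ord_narrow kN) sumr_const card_ord.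
have hN : \sum_(c < N) (1 : C) = N%:R by rewrite sumr_const card_ord.
have := hN; rewrite (bigID (fun c : 'I_N => (c < j.+1)%N)) /= E ?ltn_ord //.
have -> : \sum_(i < N | ~~ (i < j.+1)%N) (1 : C) = \sum_(d < N | (j < d)%N) 1.
  by apply: eq_bigl => d; rewrite -leqNgt.
move=> h; rewrite E ?(ltnW (ltn_ord j)) // /rho -h -natr1; field.
by [].
Qed.

Lemma sum_sqr_posroot (c : idx_pair N -> C) :
  \sum_(j < N) (\sum_(p : idx_pair N) (posroot p j)%:~R * c p) ^+ 2
  = \sum_(p : idx_pair N) \sum_(q : idx_pair N)
     ((posroot q (pair_fst p))%:~R - (posroot q (pair_snd p))%:~R) * (c p * c q).
Proof.
under eq_bigr do rewrite expr2 mulr_suml.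
rewrite exchange_big; apply: eq_bigr => p _ /=.
under eq_bigr do rewrite mulr_sumr.
rewrite exchange_big; apply: eq_bigr => q _ /=.
have := sum_posroot (fun j => (posroot q j)%:~R : C) p => <-.
rewrite mulr_suml; apply: eq_bigr => j _.
rewrite -mulrzl; ring.
Qed.

(** The ground state energy, up to [lam^2], in the form in which the three-body lemma delivers
    constants. *)
Lemma sum_sqr_rho :
  4 * \sum_(j < N) rho C j ^+ 2
  = 2 * \sum_(p : idx_pair N) ((pair_snd p)%:R - (pair_fst p)%:R).
Proof.
have h : \sum_(p : idx_pair N) \sum_(q : idx_pair N)
     ((posroot q (pair_fst p))%:~R - (posroot q (pair_snd p))%:~R) * (1 * 1)
   = 2 * \sum_(p : idx_pair N) ((pair_snd p)%:R - (pair_fst p)%:R) :> C.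
  (* The constants [A = 1] and [Z = -1] satisfy the addition formula. *)
  have e : 1 * 1 = -1 + 1 * 1 + 1 * 1 :> C by ring.
  have := @sum_pair_pair_posroot N C (fun _ _ _ _ => 1 * 1) (fun _ _ => -1)
    (fun _ _ _ _ _ _ => erefl) (fun _ _ _ _ _ => e).
  have -> : \sum_(p : idx_pair N) ((pair_snd p)%:R - (pair_fst p)%:R) * -1
     = - \sum_(p : idx_pair N) ((pair_snd p)%:R - (pair_fst p)%:R) :> C.
    by rewrite -sumrN; apply: eq_bigr => p _; rewrite mulrN1.
  rewrite sumrN mulr1 !mulrN addNr => /eqP; rewrite subr_eq0 => /eqP ->.
  by [].
rewrite -h -(sum_sqr_posroot (fun=> 1)) mulr_sumr; apply: eq_bigr => j _.
by under [in RHS]eq_bigr do rewrite mulr1; rewrite sum_posroot_rho exprMn -natrX.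
Qed.
End GroundStateConstant.

Section HamiltonianConjugation.
Variables (R : realType) (N : nat) (lam : R).
Implicit Types (x : 'I_N -> R) (p : mpoly N R[i]) (j : 'I_N).

Let im1 : R[i] := 0 +i* 1.

Lemma real_complexD (a b : R) : (a + b)%:C = a%:C + b%:C.
Proof. exact: rmorphD. Qed.

(** The counterpart of [geom_triple], in the shape that the three-body lemma requires, with
    [Z = 1]. *)
Lemma cot_half_add (a b : R) : sin (a / 2) != 0 -> sin (b / 2) != 0 ->
  sin ((a + b) / 2) != 0 ->
  cot_half a * cot_half b
  = 1 + cot_half (a + b) * cot_half a + cot_half (a + b) * cot_half b.
Proof.
rewrite /cot_half mulrDl sinD cosD.
set ca := cos (a / 2); set sa := sin (a / 2); set cb := cos _; set sb := sin _.
move=> h1 h2 h3; field; by rewrite h1 h2 h3.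
Qed.

Lemma cot_half_sqr (a : R) : sin (a / 2) != 0 -> cot_half a ^+ 2 + 1 = (sin (a / 2) ^+ 2)^-1.
Proof.
move=> h; rewrite /cot_half; have := cos2Dsin2 (a / 2).
set c := cos _; set s := sin _ in h * => e.
have -> : (s ^+ 2)^-1 = (c ^+ 2 + s ^+ 2) * (s ^+ 2)^-1 by rewrite e mul1r.
by field.
Qed.

(** In the squared gradient of [log Psi0], products of cotangents of different pairs collapse to
    constants. Together with the squares they give the potential, up to a factor, minus the ground
    state energy. *)
Lemma sum_sqr_logd x : offdiag x ->
  \sum_j logd lam x j ^+ 2 = lam ^+ 2 / 2 * \sum_(p : idx_pair N)
     (sin ((x (pair_fst p) - x (pair_snd p)) / 2) ^+ 2)^-1
  - energyC lam (0 : {ffun 'I_N -> int}).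
Proof.
move=> hx.
have hd (a b : 'I_N) : (a < b)%N -> sin ((x a - x b) / 2) != 0.
  by move=> ab; exact: (hx (exist _ (a, b) ab)).
have -> : energyC lam (0 : {ffun 'I_N -> int}) = lam ^+ 2 * \sum_(j < N) rho R j ^+ 2.
  by rewrite /energyC mulr_sumr; apply: eq_bigr => j _; rewrite ffunE mulr0z add0r exprMn.
have -> : \sum_j logd lam x j ^+ 2 = (lam / 2) ^+ 2 *
    \sum_(j < N) (\sum_(p : idx_pair N) (posroot p j)%:~R * cotp x p) ^+ 2.
  rewrite mulr_sumr; apply: eq_bigr => j _; rewrite -exprMn; congr (_ ^+ 2).
  by rewrite /logd mulr_sumr; apply: eq_bigr => p _; ring.
rewrite sum_sqr_posroot.
pose A (a b c d : 'I_N) := cot_half (x a - x b) * cot_half (x c - x d).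
have h1 (a b c d : 'I_N) : (a < b)%N -> (c < d)%N -> A a b c d = A c d a b.
  by move=> _ _; rewrite /A mulrC.
have h2 (a b d : 'I_N) : (a < b)%N -> (b < d)%N -> A a b b d = 1 + A a d a b + A a d b d.
  move=> ab bd; have e : x a - x d = (x a - x b) + (x b - x d) by ring.
  by rewrite /A e; apply: cot_half_add; rewrite -?e; apply: hd => //; exact: ltn_trans bd.
have := @sum_pair_pair_posroot N R A (fun _ _ => 1) h1 h2.
under [X in _ + 2 * X = _]eq_bigr do rewrite mulr1.
have hA : \sum_(p : idx_pair N) 1 + \sum_(p : idx_pair N) A (pair_fst p) (pair_snd p) (pair_fst p) (pair_snd p)
   = \sum_(p : idx_pair N) (sin ((x (pair_fst p) - x (pair_snd p)) / 2) ^+ 2)^-1.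
  rewrite -big_split; apply: eq_bigr => p _; rewrite -cot_half_sqr; last exact: hx.
  by rewrite addrC expr2.
rewrite -sum_sqr_rho -mulrDr hA; set S := \sum_p \sum_q _; set T := \sum_p _^-1.
set r := \sum_j _ => e.
have -> : S = 2 * T - 4 * r by rewrite -e addrK.
by field.
Qed.

Lemma sum_logd (V : 'I_N -> R[i]) x :
  \sum_j (logd lam x j)%:C * V j
  = \sum_(p : idx_pair N) (lam / 2 * cotp x p)%:C * (V (pair_fst p) - V (pair_snd p)).
Proof.
under eq_bigr do rewrite /logd (rmorph_sum (real_complex R)) mulr_suml.
rewrite exchange_big; apply: eq_bigr => p _ /=.
rewrite -(sum_posroot V p) mulr_sumr; apply: eq_bigr => j _.
by rewrite real_complexM (rmorph_int (real_complex R)) -mulrzl; ring.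
Qed.

Lemma im1_sqr : im1 * im1 = -1.
Proof. by apply: complex_eqP; rewrite ?creM ?cimM ?creN ?cimN /=; ring. Qed.

Lemma expi_ratio (a b : R) : sin ((a - b) / 2) != 0 ->
  (expi a + expi b) / (expi a - expi b) = - (im1 * (cot_half (a - b))%:C).
Proof.
move=> h; have h0 : expi a - expi b != 0 by rewrite subr_eq0 expi_eq.
apply: (canLR (mulfK h0)).
have -> : expi a + expi b = expi ((a + b) / 2) * (2 * cos ((a - b) / 2))%:C.
  have -> : expi a = expi ((a + b) / 2) * expi ((a - b) / 2).
    by rewrite -expiD; congr expi; field.
  have -> : expi b = expi ((a + b) / 2) * expi (- ((a - b) / 2)).
    by rewrite -expiD; congr expi; field.
  rewrite -mulrDr; congr (_ * _); apply: complex_eqP; rewrite ?creD ?cimD /= ?cosN ?sinN; ring.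
rewrite expi_sub mulrCA mulNr; congr (_ * _).
apply: complex_eqP; rewrite ?creN ?cimN ?creM ?cimM /= /cot_half; last by ring.
by field.
Qed.

(** The quotient [(z_j + z_k) / (z_j - z_k)] is [- i cot ((x_j - x_k) / 2)], so the first-order part
    of [laplace] is the cross term of [p] with the logarithmic gradient of [Psi0]. *)
Lemma laplace_pval x p : offdiag x ->
  laplace lam%:C (zof_angles x) p
  = \sum_j pval (theta j (theta j p)) x - 2 * im1 * \sum_j (logd lam x j)%:C * pval (theta j p) x
    + (energyC lam (0 : {ffun 'I_N -> int}))%:C * pval p x.
Proof.
move=> hx; rewrite /laplace; congr (_ + _ + _); last first.
  congr (_ * _); rewrite /energyC (rmorph_sum (real_complex R)); apply: eq_bigr => j _.
  rewrite !ffunE !mulr0z !add0r [RHS](rmorphXn (real_complex R)) /=.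
  rewrite [X in _ = X ^+ 2](rmorphM (real_complex R)) /=; congr ((_ * _) ^+ 2).
  rewrite /rho (rmorphB (real_complex R)) rmorph_nat rmorphM rmorphD rmorph_nat rmorph1 fmorphV rmorph_nat.
  by [].
rewrite (sum_logd (fun j => pval (theta j p) x)) !mulr_sumr -sumrN; apply: eq_bigr => q _.
rewrite expi_ratio; last exact: hx.
have -> : (lam / 2 * cotp x q)%:C = lam%:C / 2 * (cotp x q)%:C.
  by rewrite !real_complexM (fmorphV (real_complex R)) (rmorph_nat (real_complex R)).
have aux (i c a b l : R[i]) :
    l * (- (i * c) * (a - b)) = - (2 * i * (l / 2 * c * (a - b))) by field.
exact: aux.
Qed.

Definition pval_Psi0 p : ('I_N -> R) -> R[i] := times_Psi0 lam (pval p).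

Definition dpval_Psi0 p j x : R[i] :=
  im1 * pval_Psi0 (theta j p) x + (logd lam x j)%:C * pval_Psi0 p x.

Lemma is_cder_pval_Psi0 p j x : offdiag x ->
  is_cder (slice (pval_Psi0 p) x j) (x j) (dpval_Psi0 p j x).
Proof.
move=> hx; apply: is_cder_eq (is_cderM (is_cder_pval p x j) (is_cder_Psi0 lam j hx)) _.
by rewrite !slice_self /dpval_Psi0 /pval_Psi0 /times_Psi0 -/im1; ring.
Qed.

Lemma partial_pval_Psi0 p j x : offdiag x -> partial j (pval_Psi0 p) x = dpval_Psi0 p j x.
Proof. by move=> hx; exact: is_cder_cderive1 (is_cder_pval_Psi0 p j hx). Qed.

Lemma is_cder_partial_pval_Psi0 p j x : offdiag x ->
  is_cder (slice (partial j (pval_Psi0 p)) x j) (x j)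
    (im1 * dpval_Psi0 (theta j p) j x
     + ((dlogd lam x j)%:C * pval_Psi0 p x + (logd lam x j)%:C * dpval_Psi0 p j x)).
Proof.
move=> hx; apply: (@near_is_cder _ _ (fun t => im1 * slice (pval_Psi0 (theta j p)) x j t
   + (logd lam [eta x with j |-> t] j)%:C * slice (pval_Psi0 p) x j t)).
  apply: filterS (near_offdiag j hx) => t ht.
  by rewrite [RHS]/slice partial_pval_Psi0.
apply: is_cderD; first by apply: is_cderZ; exact: is_cder_pval_Psi0.
apply: is_cder_eq (is_cderM (is_cder_real (is_derive_logd lam j hx)) (is_cder_pval_Psi0 p j hx)) _.
by rewrite slice_self eta_self.
Qed.

Lemma twice_differentiable_pval_Psi0 p x : offdiag x -> twice_differentiable (pval_Psi0 p) x.
Proof.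
move=> hx j; split; last exact: is_cder_cderivable (is_cder_partial_pval_Psi0 p j hx).
apply: filterS (near_offdiag j hx) => t ht.
have := is_cder_cderivable (is_cder_pval_Psi0 p j ht).
by rewrite slice_slice /= eqxx.
Qed.

Lemma sum_dlogd x : \sum_j dlogd lam x j
  = - (lam / 2) * \sum_(p : idx_pair N) (sin ((x (pair_fst p) - x (pair_snd p)) / 2) ^+ 2)^-1.
Proof.
rewrite /dlogd exchange_big mulr_sumr; apply: eq_bigr => p _ /=.
rewrite -mulr_suml invfM.
have -> : \sum_(j < N) (posroot p j)%:~R ^+ 2 = 2 :> R.
  have := sum_posroot (fun j => (posroot p j)%:~R : R) p.
  have [-> -> _] := posrootE p.
  have -> : 1%:~R - (-1)%:~R = 2 :> R by ring.
  by move=> h; rewrite -[RHS]h; apply: eq_bigr => j _; rewrite expr2 mulrzr.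
set v := (sin _ ^+ 2)^-1; by field.
Qed.

(** The sum over [j] of [dlogd + logd^2] has coefficient [- lam / 2 + lam^2 / 2] on the inverse
    squared sines, which is that of the potential; what remains is the ground state energy, the
    constant term of [laplace]. *)
Lemma hamiltonian_pval_Psi0 p x : offdiag x ->
  hamiltonian lam (pval_Psi0 p) x = laplace lam%:C (zof_angles x) p * Psi0 lam x.
Proof.
move=> hx; rewrite /hamiltonian (laplace_pval _ hx).
under eq_bigr => j _ do rewrite [partial _ _ _](is_cder_cderive1 (is_cder_partial_pval_Psi0 p j hx)).
rewrite (eq_bigr (fun j => (- pval (theta j (theta j p)) x
   + 2 * im1 * ((logd lam x j)%:C * pval (theta j p) x)
   + (dlogd lam x j + logd lam x j ^+ 2)%:C * pval p x) * Psi0 lam x)) => [|j _]; last first.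
  rewrite /dpval_Psi0 /pval_Psi0 /times_Psi0 real_complexD real_complexX.
  have aux (i a b c d L D : R[i]) : i * i = -1 ->
      i * (i * (a * d) + L * (b * d)) + (D * (c * d) + L * (i * (b * d) + L * (c * d)))
      = (- a + 2 * i * (L * b) + (D + L ^+ 2) * c) * d.
    move=> h; transitivity ((i * i * a + 2 * i * (L * b) + (D + L ^+ 2) * c) * d); first by ring.
    by rewrite h mulN1r.
  exact: aux im1_sqr.
rewrite -mulr_suml !big_split /= sumrN -!mulr_sumr -mulr_suml -(rmorph_sum (real_complex R)).
rewrite big_split /= sum_dlogd sum_sqr_logd // {1}/pval_Psi0 /times_Psi0.
set T := \sum_(p : idx_pair N) _.
have -> : \sum_(p0 : idx_pair N) (4 * sin ((x (pair_fst p0) - x (pair_snd p0)) / 2) ^+ 2)^-1 = T / 4.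
  by rewrite /T mulr_suml; apply: eq_bigr => q _; rewrite invfM mulrC.
set E0 := energyC _ _; set d := Psi0 _ _; set a := \sum_j pval _ x; set b := \sum_j _ * _; set c := pval _ x.
set w := 2 * lam * (lam - 1) * (T / 4); set u := - (lam / 2) * T + (lam ^+ 2 / 2 * T - E0).
have -> : E0%:C = w%:C - u%:C.
  by rewrite -real_complexN -real_complexD; congr (_%:C); rewrite /w /u; field.
move: w%:C u%:C => w' u'; rewrite -/im1; ring.
Qed.

End HamiltonianConjugation.

(** * The coefficients of the novel algorithm, and eigenfunctions as eigenpolynomials *)

Section FiniteSupportSums.
Variables (I : finType) (V : nmodType).

Lemma fsbig_boxsum (F : {ffun I -> nat} -> V) B :
  (forall (k : {ffun I -> nat}) i, (B <= k i)%N -> F k = 0) ->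
  \sum_(k \in [set: {ffun I -> nat}]) F k = boxsum B F.
Proof.
move=> hF; pose h (k : {ffun I -> 'I_B}) : {ffun I -> nat} := [ffun i => val (k i)].
have hI : injective h.
  move=> k k' /ffunP e; apply/ffunP => i; apply: val_inj; have := e i.
  by rewrite !ffunE.
rewrite (@fsbigE _ _ _ _ _ [seq h k | k : {ffun I -> 'I_B}]).
- by rewrite big_map -big_filter (eq_filter (a2 := xpredT)) ?filter_predT ?big_enum // => k; rewrite in_setT.
- by rewrite map_inj_uniq ?enum_uniq.
- by [].
move=> k _ kn; case: (boolP [forall i, (k i < B)%N]) => [/fintype.forallP H|]; last first.
  by rewrite negb_forall; case/fintype.existsP => i; rewrite -leqNgt; exact: hF.
case/negP: kn; apply/mapP; exists [ffun i => Ordinal (H i)]; rewrite ?mem_enum //.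
by apply/ffunP => i; rewrite !ffunE.
Qed.

End FiniteSupportSums.

Section Coefficients.
Variables (R : realType) (N : nat) (lam : R) (n : 'I_N -> int).
Hypotheses (lam_gt0 : 0 < lam) (n_adm : admissible n).

Let nf : {ffun 'I_N -> int} := [ffun j => n j].

Lemma energyC_finfun (m : {ffun 'I_N -> int}) : energyC lam m = energy lam m.
Proof. by []. Qed.

Lemma real_complexE (m : {ffun 'I_N -> int}) : energyC lam%:C m = (energyC lam m)%:C.
Proof.
rewrite /energyC (rmorph_sum (real_complex R)); apply: eq_bigr => j _.
have -> : rho R[i] j = (rho R j)%:C.
  rewrite /rho (rmorphB (real_complex R)) (rmorphM (real_complex R)) (fmorphV (real_complex R)).
  by rewrite (rmorphD (real_complex R)) !(rmorph_nat (real_complex R)) (rmorph1 (real_complex R)).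
have E2 (u v w : R) : ((u + v * w) ^+ 2)%:C = (u%:C + v%:C * w%:C) ^+ 2.
  by rewrite real_complexX real_complexD real_complexM.
by rewrite -(rmorph_int (real_complex R)) -[LHS]E2.
Qed.

Lemma vecmu_mt_vec (mu : mtuple N) : vecmu mu = [ffun j => mt_vec mu j].
Proof.
by apply/ffunP => l; rewrite vecmuE ffunE; apply: eq_bigr => p _; rewrite ffunE.
Qed.

Lemma vadd_finfun mu : [ffun j => vadd n (mt_vec mu) j] = nf + vecmu mu.
Proof. by rewrite vecmu_mt_vec; apply/ffunP => j; rewrite !ffunE. Qed.

Lemma energy_vadd mu : energy lam (vadd n (mt_vec mu)) = energyC lam (nf + vecmu mu).
Proof. by rewrite -vadd_finfun; apply: eq_bigr => j _; rewrite ffunE. Qed.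

Lemma energy_nf : energy lam n = energyC lam nf.
Proof. by apply: eq_bigr => j _; rewrite ffunE. Qed.

Lemma energyC_vecmu mu : energyC lam (nf + vecmu mu) - energyC lam nf
  = \sum_j (vecmu mu j)%:~R ^+ 2 + 2 * \sum_(p : idx_pair N) (mu p)%:R *
    ((nf (pair_fst p) - nf (pair_snd p))%:~R + lam * ((pair_snd p)%:R - (pair_fst p)%:R)).
Proof.
pose g j : R := (nf j)%:~R + lam * rho R j.
have -> : \sum_(p : idx_pair N) (mu p)%:R * ((nf (pair_fst p) - nf (pair_snd p))%:~R
      + lam * ((pair_snd p)%:R - (pair_fst p)%:R)) = \sum_j (vecmu mu j)%:~R * g j.
  under [RHS]eq_bigr do rewrite vecmuE rmorph_sum mulr_suml.
  rewrite exchange_big; apply: eq_bigr => p _ /=.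
  transitivity ((mu p)%:R * (g (pair_fst p) - g (pair_snd p))).
    by congr (_ * _); rewrite /g /rho intrB -!natr1; ring.
  rewrite -(sum_posroot g p) mulr_sumr; apply: eq_bigr => j _.
  by rewrite intrM -mulrA [X in _ = _ * X]mulrzl.
rewrite /energyC -sumrB mulr_sumr -big_split; apply: eq_bigr => j _ /=.
by rewrite ffunE intrD /g; ring.
Qed.

(** [energyC_vecmu] writes the difference as a squared norm plus a combination of the [mu p], whose
    coefficients are positive because [n] is non-increasing and [lam > 0]. This justifies the
    divisions in the recursion. *)
Lemma energyC_vecmu_gt0 mu : mu != mt0 N -> energyC lam nf < energyC lam (nf + vecmu mu).
Proof.
move=> mu0; rewrite -subr_gt0 energyC_vecmu; apply: ltr_wpDl.
  by apply: sumr_ge0 => j _; exact: sqr_ge0.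
have [p hp] : exists p, mu p != 0%N.
  apply/fintype.existsP; apply: contraR mu0 => /fintype.existsPn h; apply/eqP/ffunP => p.
  by rewrite ffunE; apply/eqP; have := h p; rewrite negbK.
rewrite mulr_gt0 //.
have term_gt0 (q : idx_pair N) : 0 < (nf (pair_fst q) - nf (pair_snd q))%:~R
    + lam * ((pair_snd q)%:R - (pair_fst q)%:R) :> R.
  apply: ltr_wpDl.
    by rewrite ler0z subr_ge0 !ffunE; apply: n_adm.1; exact: ltnW (ltn_pair q).
  by rewrite mulr_gt0 // subr_gt0 ltr_nat ltn_pair.
rewrite (bigD1 p) //= ltr_wpDr //; last by rewrite mulr_gt0 // ltr0n lt0n.
by apply: sumr_ge0 => q _; rewrite mulr_ge0 ?ler0n // ltW.
Qed.

Lemma mt_size_lower (mu : mtuple N) p nu : (nu <= mu p)%N ->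
  (mt_size (mt_lower mu p nu) + nu)%N = mt_size mu.
Proof.
move=> h; rewrite /mt_size (bigD1 p) //= [RHS](bigD1 p) //= ffunE eqxx mul1n addnAC subnK //.
congr (_ + _)%N; apply: eq_bigr => q /negPf qp.
by rewrite ffunE qp mul0n subn0.
Qed.

Lemma mt_size_eq0 (mu : mtuple N) : (mt_size mu == 0%N) = (mu == mt0 N).
Proof.
rewrite sum_nat_eq0; apply/fintype.forallP/eqP => [h|-> p]; last by rewrite ffunE.
by apply/ffunP => p; rewrite ffunE; apply/eqP; exact: h.
Qed.

(** Each recursive call lowers the size. The lemma reconciles the fuel left in a call with the fuel
    [mt_size] used by [novel_coeff] for the lowered index. *)
Lemma novel_rec_fuel f f' mu : (mt_size mu <= f)%N -> (mt_size mu <= f')%N ->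
  novel_rec lam n f mu = novel_rec lam n f' mu.
Proof.
elim: f f' mu => [|f IH] [|f'] mu //=; rewrite ?leqn0 ?mt_size_eq0.
- by move=> /eqP ->; rewrite eqxx.
- by move=> _ /eqP ->; rewrite eqxx.
move=> h h'; case: ifP => // _; congr (_ * _ / _); apply: eq_bigr => p _.
apply: eq_big_nat => nu /andP [nu0 nup]; congr (_ * _).
have lt : (mt_size (mt_lower mu p nu) < mt_size mu)%N.
  by rewrite -(mt_size_lower nup) -[X in (X < _)%N]addn0 ltn_add2l.
by apply: IH; rewrite -ltnS; [exact: leq_trans lt h|exact: leq_trans lt h'].
Qed.

Lemma novel_coeff0 : novel_coeff lam n (mt0 N) = 1.
Proof. by rewrite /novel_coeff; case: (mt_size _) => [|k] /=; rewrite eqxx. Qed.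

Lemma novel_coeff_rec mu :
  (energyC lam (nf + vecmu mu) - energyC lam nf) * novel_coeff lam n mu =
  2 * lam * (lam - 1) * \sum_(p : idx_pair N) \sum_(s < mu p)
     s.+1%:R * novel_coeff lam n (mt_lower mu p s.+1).
Proof.
have [->|mu0] := eqVneq mu (mt0 N).
  rewrite (_ : vecmu _ = 0) ?addr0 ?subrr ?mul0r; last first.
    by rewrite /vecmu big1 // => p _; rewrite ffunE.
  by rewrite big1 ?mulr0 // => p _; rewrite ffunE big_ord0.
rewrite {1}/novel_coeff.
have : mt_size mu != 0%N by rewrite mt_size_eq0.
case E : (mt_size mu) => [//|f] _; rewrite /= (negPf mu0) energy_vadd energy_nf [LHS]mulrC divfK; last first.
  by rewrite gt_eqF // subr_gt0 energyC_vecmu_gt0.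
congr (_ * _); apply: eq_bigr => p _; rewrite big_add1 /= big_mkord; apply: eq_bigr => s _.
congr (_ * _); apply: novel_rec_fuel => //.
by rewrite -ltnS -E -(mt_size_lower (ltn_ord s)) addnS ltnS leq_addr.
Qed.

End Coefficients.

Section Eigenfunctions.
Variables (R : realType) (N : nat) (lam : R).
Implicit Types (p : mpoly N R[i]) (E : R).

Lemma Psi0_neq0 (x : 'I_N -> R) : config x -> Psi0 lam x != 0.
Proof.
move=> [_ hx]; apply/prodf_neq0 => q _; rewrite /sin_half_pow.
have s0 : sin ((x (pair_snd q) - x (pair_fst q)) / 2) != 0.
  by rewrite -opprB mulNr sinN oppr_eq0; exact: hx.
have pow_neq0 (s : R) : 0 < s -> (s `^ lam)%:C != 0.
  move=> h; have := powR_gt0 lam h; rewrite lt0r => /andP [h1 _].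
  by rewrite eq_complex /= negb_and h1.
case: ifP => [h|/negbT h]; first by apply: pow_neq0; rewrite lt_neqAle eq_sym s0.
by rewrite mulf_neq0 ?expi_neq0 // pow_neq0 // oppr_gt0 ltNge.
Qed.

Lemma eigenpoly_eigenfunction p E : p != 0 ->
  eigenpoly lam%:C (@torus_cube R N) E%:C p ->
  is_eigenfunction lam E (times_Psi0 lam (pval p)).
Proof.
move=> p0 pE; split.
  have [x cx hx] := config_witness p0; exists x => //.
  by rewrite /times_Psi0 mulf_neq0 // Psi0_neq0.
move=> x cx; have ox : offdiag x by case: cx.
split; first exact: twice_differentiable_pval_Psi0.
rewrite [LHS](hamiltonian_pval_Psi0 lam p ox) pE ?mulrA //; last exact: config_inj.
by exists x => //; case: cx.
Qed.

(** On [config] the factor [Psi0] does not vanish and can be cancelled; points of the cube with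
    distinct [exp (i x_j)] lie in [config]. *)
Lemma eigenfunction_eigenpoly p E : is_eigenfunction lam E (times_Psi0 lam (pval p)) ->
  p != 0 /\ eigenpoly lam%:C (@torus_cube R N) E%:C p.
Proof.
move=> [[x0 cx0 hx0] hE]; split.
  by apply: contraNneq hx0 => ->; rewrite /times_Psi0 /pval meval0 mul0r.
move=> z [x hx ->] zi.
have cx : config x.
  split => // q; rewrite -expi_eq; apply: zi; exact: neq_pair.
have ox : offdiag x by case: cx.
have [_ e] := hE _ cx.
apply: (mulIf (Psi0_neq0 cx)).
by rewrite -(hamiltonian_pval_Psi0 lam p ox) -mulrA -[RHS]e.
Qed.

End Eigenfunctions.

(** * The two algorithms as symmetric polynomials, and their comparison *)

Section NovelAlgorithm.
Variables (R : realType) (N : nat) (lam : R) (n : 'I_N -> int).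
Hypotheses (lam_gt0 : 0 < lam) (n_adm : admissible n) (nd : nondegenerate_energy lam n).

Let nf : {ffun 'I_N -> int} := [ffun j => n j].
Let a (mu : mtuple N) : R[i] := (novel_coeff lam n mu)%:C.
Let nn : multinom N := Multinom [tuple absz (n j) | j < N].

Definition novel_poly : mpoly N R[i] := Phipol lam%:C nf a.

Lemma zof_nn : zof nn = nf.
Proof. by apply/ffunP => j; rewrite !ffunE mnmE gez0_abs //; exact: n_adm.2. Qed.

Lemma nn_sorted (j k : 'I_N) : (j <= k)%N -> (fun_of_multinom nn k <= fun_of_multinom nn j)%N.
Proof.
move=> jk; rewrite -lez_nat !mnmE !gez0_abs; try exact: n_adm.2.
exact: n_adm.1.
Qed.

Lemma Phi_novelE : Phi_novel lam n = pval novel_poly.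
Proof.
apply/funext => x; rewrite /pval /novel_poly /Phipol /Phi_novel (fsbig_boxsum (B := `|height nf|.+1)).
  rewrite /boxsum rmorph_sum /=; apply: eq_bigr => k _.
  by rewrite P_funE mevalZ vadd_finfun.
move=> mu p hp; rewrite P_funE vadd_finfun meval_Ppol.
rewrite (bounded_vecmu (B := `|height nf|.+1) _ _ hp) ?mulr0 //.
  by apply: Psi_bounded; exact: f_bounded.
by apply: le_lt_trans (lez_abs _) _; rewrite ltz_nat.
Qed.

Lemma novel_poly_sym : novel_poly \is @symmetric N R[i].
Proof. exact: Phipol_sym. Qed.

Lemma novel_poly_neq0 : novel_poly != 0.
Proof.
rewrite /novel_poly -zof_nn; apply: (Phipol_neq0 (@zariski_dense_torus_cube R N)).
- exact: nn_sorted.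
- by rewrite ltcR.
- by move=> mu; rewrite realE -[0]/((0 : R)%:C) !lecR -realE num_real.
- by rewrite /a novel_coeff0.
Qed.

Lemma novel_poly_eigen : eigenpoly lam%:C (@torus_cube R N) (energy lam n)%:C novel_poly.
Proof.
move=> z _ zi; rewrite energy_nf -real_complexE; apply: laplace_Phipol => // mu.
rewrite !real_complexE -real_complexN -real_complexD -real_complexM novel_coeff_rec //.
rewrite !real_complexM (rmorph_sum (real_complex R)) real_complexD real_complexN.
rewrite (rmorph_nat (real_complex R)); congr (_ * _); apply: eq_bigr => p _.
rewrite (rmorph_sum (real_complex R)); apply: eq_bigr => s _.
by rewrite [LHS](rmorphM (real_complex R)) (rmorph_nat (real_complex R)).
Qed.

Lemma nondegenerate_multinom (m : multinom N) :
  (forall j k : 'I_N, (j <= k)%N -> (fun_of_multinom m k <= fun_of_multinom m j)%N) ->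
  energyC lam%:C (zof m) = (energy lam n)%:C -> m = nn.
Proof.
move=> ms; rewrite real_complexE => -[e].
have ma : admissible (fun j => Posz (fun_of_multinom m j)).
  by split => // j k jk; rewrite lez_nat; exact: ms.
have me : energy lam (fun j => Posz (fun_of_multinom m j)) = energy lam n.
  by rewrite -e; apply: eq_bigr => k _; rewrite ffunE.
by apply/mnmP => j; rewrite mnmE -(nd ma me).
Qed.

Lemma mdeg_nn : mdeg nn = label_degree n.
Proof. by rewrite mdegE; apply: eq_bigr => j _; rewrite mnmE. Qed.

Lemma exponents_nn : exponents nn = [seq absz (n j) | j <- enum 'I_N].
Proof. by apply: eq_map => j; rewrite mnmE. Qed.

Lemma novel_proportional_jack (kappa : intpart (label_degree n)) P :
  is_label_part kappa -> is_jack_family lam^-1 P ->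
  proportional (pval novel_poly) (fun x => symfun_eval (P kappa) (fun j => expi (x j))).
Proof.
rewrite /is_label_part -exponents_nn; move: kappa P; rewrite -mdeg_nn => kappa P hk hP.
have lead := eigenpoly_leading (@zariski_dense_torus_cube R N) novel_poly_eigen
  novel_poly_sym nondegenerate_multinom novel_poly_neq0.
have a0 : a (mt0 N) = 1 by rewrite /a novel_coeff0.
have ld m : mcoeff m (Phipol lam%:C (zof nn) a) != 0 -> m != nn -> (mheight nn < mheight m)%N.
  by rewrite zof_nn; exact: lead.2.
have [c c0 hc] := @Phipol_proportional_jack R lam N lam_gt0 (@zariski_dense_full R) nn a
  nn_sorted a0 P hP kappa hk ld.
by exists c => // x; rewrite -hc zof_nn.
Qed.

End NovelAlgorithm.

Section SutherlandAlgorithm.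
Variables (R : realType) (N : nat) (lam : R) (n : 'I_N -> int).
Hypothesis (n_adm : admissible n).

Let nf : {ffun 'I_N -> int} := [ffun j => n j].

Lemma suth_coeff_orderedb mu : suth_coeff lam n mu != 0 -> orderedb (vsub n (mt_vec mu)).
Proof.
rewrite /suth_coeff; case: (eqVneq mu (mt0 N)) => [-> _|mu0].
  apply/fintype.forallP => p; have h0 l : mt_vec (mt0 N) l = 0.
    by apply: big1 => q _; rewrite ffunE mul0r.
  by rewrite /vsub !h0 !subr0; apply: n_adm.1; exact: ltnW (ltn_pair p).
by case: (mt_size mu) => [|f] /=; rewrite (negPf mu0); case: ifP => //= [_|/negbFE //];
  rewrite eqxx.
Qed.

(** Discarding the unordered terms leaves vectors with non-negative entries: the
    last entry only increases, and it is the smallest one. *)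
Lemma orderedb_ge0 (mu : mtuple N) : orderedb (vsub n (mt_vec mu)) ->
  forall j, 0 <= vsub n (mt_vec mu) j.
Proof.
move=> /fintype.forallP ho j.
have N0 : (0 < N)%N by exact: leq_ltn_trans (ltn_ord j).
have lastP : (N.-1 < N)%N by rewrite prednK.
pose l := Ordinal lastP.
have l0 : 0 <= vsub n (mt_vec mu) l.
  rewrite /vsub addr_ge0 ?n_adm.2 // -sumrN; apply: sumr_ge0 => p _.
  have -> : (pair_fst p == l) = false.
    apply/negbTE; rewrite -val_eqE /= neq_ltn; apply/orP; left.
    by rewrite -ltnS prednK // (leq_ltn_trans (ltn_pair p)) // ltn_ord.
  by rewrite sub0r mulrN opprK mulr_ge0.
case: (ltngtP j l) => [jl|lj|/val_inj -> //]; last first.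
  have jN : (j <= N.-1)%N by rewrite -ltnS prednK.
  by move: jN; rewrite leqNgt lj.
exact: le_trans l0 (ho (exist _ (j, l) jl)).
Qed.

Lemma vsub_finfun mu : [ffun j => vsub n (mt_vec mu) j] = nf - vecmu mu.
Proof. by rewrite vecmu_mt_vec; apply/ffunP => j; rewrite !ffunE. Qed.

(** For a non-zero coefficient, [w = n - vecmu mu] has non-negative entries with the same sum as
    [n], so [mu p <= height w - height n] is at most [N \sum_j n_j - height n]. *)
Let bound : nat := (absz (N%:Z * \sum_j nf j) + absz (height nf)).+1.

Lemma suth_coeff_bound (mu : mtuple N) p : (bound <= mu p)%N -> suth_coeff lam n mu = 0.
Proof.
move=> hp; apply/eqP; apply: contraT => /suth_coeff_orderedb /orderedb_ge0 w0.
pose w : {ffun 'I_N -> int} := nf - vecmu mu.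
have {}w0 j : 0 <= w j by rewrite /w -vsub_finfun ffunE.
have hw : height w = height nf - height (vecmu mu) by rewrite /w raddfB.
have hle : height w <= N%:Z * \sum_j w j.
  rewrite /height mulr_sumr; apply: ler_sum => j _; apply: ler_wpM2r => //.
  by rewrite lez_nat ltnW.
have sw : \sum_j w j = \sum_j nf j.
  have -> : \sum_j w j = \sum_j (nf j - vecmu mu j) by apply: eq_bigr => j _; rewrite !ffunE.
  by rewrite sumrB sum_vecmu subr0.
have := height_vecmu_le mu p.
move: hp; rewrite /bound; rewrite hw sw in hle; move: hle.
move: (_ * _) (height nf) (height _) (mu p) => A B C k; clear; lia.
Qed.

(** [absz] changes only terms whose coefficient is zero: the other exponents are non-negative by
    [orderedb_ge0]. *)
Definition suth_poly : mpoly N R[i] := boxsum bound (fun mu : mtuple N =>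
  (suth_coeff lam n mu)%:C *:
    symmetrized_monomial R[i] (Multinom [tuple absz (vsub n (mt_vec mu) j) | j < N])).

Lemma suth_poly_sym : suth_poly \is @symmetric N R[i].
Proof. by rewrite rpred_sum // => k _; rewrite rpredZ // symmetrized_monomial_sym. Qed.

Lemma Phi_suthE : Phi_suth lam n = pval suth_poly.
Proof.
apply/funext => x; rewrite /pval /suth_poly /Phi_suth (fsbig_boxsum (B := bound)).
  rewrite /boxsum rmorph_sum /=; apply: eq_bigr => k _.
  rewrite mevalZ; set mu := [ffun i => _].
  have [->|c0] := eqVneq (suth_coeff lam n mu) 0; first by rewrite !mul0r.
  congr (_ * _); rewrite meval_symmetrized_monomial /S_fun; apply: eq_bigr => s _.
  apply: eq_bigr => j _; rewrite mnmE /zof_angles -expiMn; congr (expi (_ * _)).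
  by rewrite -[in LHS](gez0_abs (orderedb_ge0 (suth_coeff_orderedb c0) j)).
by move=> mu p /suth_coeff_bound ->; rewrite mul0r.
Qed.

End SutherlandAlgorithm.

(** The last clause starts from the eigenfunction property of Sutherland's function for the reason
    given at [suth_rec]. [eigenpoly_unique] then provides the factor, along which the
    proportionality to the Jack polynomial is carried over. *)
Theorem mainTheorem3 (R : realType) (N : nat) (lam : R) (n : 'I_N -> int)
    (hN : (2 <= N)%N) (hlam : 0 < lam) (hn : admissible n)
    (hnd : nondegenerate_energy lam n) :
  [/\ is_symmetric_poly (Phi_novel lam n),
      is_symmetric_poly (Phi_suth lam n),
      is_eigenfunction lam (energy lam n) (times_Psi0 lam (Phi_novel lam n)),
      proportional_to_jack n lam (Phi_novel lam n)
    & is_eigenfunction lam (energy lam n) (times_Psi0 lam (Phi_suth lam n)) ->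
      proportional (times_Psi0 lam (Phi_suth lam n))
                   (times_Psi0 lam (Phi_novel lam n)) /\
      proportional_to_jack n lam (Phi_suth lam n)].
Proof.
have novel_eigen := novel_poly_eigen hlam hn.
have novel_neq0 := novel_poly_neq0 hlam hn.
have [kappa hkappa] : exists kappa : intpart (label_degree n), is_label_part kappa.
  have sd : sumn [seq absz (n j) | j <- enum 'I_N] = label_degree n.
    by rewrite sumnE big_map big_enum.
  by have [kappa hk] := intpart_of sd; exists kappa.
rewrite Phi_novelE (Phi_suthE lam hn); split.
- by exists (novel_poly lam n) => //; exact: novel_poly_sym.
- by exists (suth_poly lam n) => //; exact: suth_poly_sym.
- exact: eigenpoly_eigenfunction.
- by exists kappa => // P; exact: novel_proportional_jack.
move=> /eigenfunction_eigenpoly [suth_neq0 suth_eigen].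
have [c c0 hc] := eigenpoly_unique (@zariski_dense_torus_cube R N) novel_eigen suth_eigen
  (novel_poly_sym lam n) (suth_poly_sym lam n) (nondegenerate_multinom hnd) novel_neq0 suth_neq0.
have hval x : pval (suth_poly lam n) x = c * pval (novel_poly lam n) x.
  by rewrite /pval hc mevalZ.
split; first by exists c => // x; rewrite /times_Psi0 hval mulrA.
exists kappa => // P hP.
have [d d0 hd] := novel_proportional_jack hlam hn hnd hkappa hP.
by exists (c * d); rewrite ?mulf_neq0 // => x; rewrite hval hd mulrA.
Qed.
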